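(* Let $\nu>0$, and let the force be given by a sufficiently smooth divergence-free vector field of form (A) or (B) (see context), with associated bound $G$: - in case (A), suppose that there exists a divergence-free vector field $H(x,s)$, independent of $\Omega$, satisfying $\partial_t\big[\frac1\Omega H(x,\Omega t)\big]=F(x_1+\Omega t,x')$ and $\sup_t\|H(\cdot,\Omega t)\|_{C^1(\mathbb{T}^3)}\le G$; - in case (B), $G$ is a number with $\|f\|_{C^1(\mathbb{T}^3)}\le G$. Then there exist $\Omega_0(\nu,G)>0$ and a constant $C^*$ depending only on $\nu$ such that for every $\Omega\ge\Omega_0$ the system $$v_t+v\cdot\nabla v-\nu\Delta v+\nabla p=F_\Omega,\qquad \mathrm{div}\,v=0,\qquad \int_{\mathbb{T}^3}v\,dx=0$$ has a time periodic solution $v_{per}$, with period $T_{per}=2\pi/\Omega$, satisfying $$\|v_{per}\|_{L_\infty(\mathbb{T}^3\times T_{per}\mathbb{S}^1)}\le\frac{C^*(1+\nu)G}{\Omega}.$$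
   Context: $\mathbb{T}^3=[0,2\pi]^3$ with periodic boundary conditions, $x=(x_1,x')$ with $x'=(x_2,x_3)$. $T_{per}\mathbb{S}^1$ denotes the circle of length $T_{per}$, so functions on $\mathbb{T}^3\times T_{per}\mathbb{S}^1$ are $T_{per}$-periodic in time. The force $F_\Omega(x,t)$, $\Omega>0$, has one of the following two forms. (A) $F_\Omega(x,t)=F(x_1+\Omega t,x')$, where $F:\mathbb{T}^3\to\mathbb{R}^3$ is a time-independent divergence-free vector field with $\int_{\mathbb{T}^3}F\,dx=0$ whose Fourier coefficients satisfy $\hat F_k=0$ for all $k=(0,k_2,k_3)$. (This is the system for the perturbation $v-\Omega\hat e_1$ of a constant background flow $\Omega\hat e_1$, after the Galilean change of variables.) (B) $F_\Omega(x,t)=f(x)\sin\Omega t$, where $f:\mathbb{T}^3\to\mathbb{R}^3$ is a divergence-free vector field with $\int_{\mathbb{T}^3}f\,dx=0$. ''Sufficiently smooth'' means: there is an absolute integer $m$ such that the result holds for all $F$ (respectively $f$) of class $C^m$. The equations are understood in the sense of distributions on $\mathbb{T}^3\times T_{per}\mathbb{S}^1$, for some pressure $p$. *)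

(* Defs.v *)
From HB Require Import structures.
From mathcomp Require Export all_boot all_order all_algebra.
From mathcomp Require Export complex.
From mathcomp Require Export all_classical all_reals all_analysis.

Set Implicit Arguments.
Unset Strict Implicit.
Unset Printing Implicit Defensive.

Export Order.TTheory GRing.Theory Num.Theory.
Export numFieldNormedType.Exports.

#[global] Open Scope classical_set_scope.
#[global] Open Scope ring_scope.

(* Functions on the torus are functions on the covering space that are periodic;
   integrals and norms over the torus are taken over one period cell. *)

Notation space R := (R * R * R)%type.
Notation spacetime R := (R * R * R * R)%type.

Definition coord (R : realType) (i : 'I_3) (x : space R) : R :=
  match val i with 0%N => x.1.1 | 1%N => x.1.2 | _ => x.2 end.

Definition dir (R : realType) (i : 'I_3) : space R :=
  ((i == 0 :> nat)%:R, (i == 1 :> nat)%:R, (i == 2 :> nat)%:R).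

(* [None] is the time direction. *)
Definition stdir (R : realType) (o : option 'I_3) : spacetime R :=
  if o is Some i then (dir R i, 0) else (0, 1).

(* [Ck d k g]: all iterated partial derivatives of [g] of order at most [k]
   along the directions [d] exist and are continuous. *)
Fixpoint Ck (R : realType) (E : normedModType R) (I : Type) (d : I -> E)
    (k : nat) (g : E -> R) : Prop :=
  continuous g /\
  if k is k'.+1 then
    forall i, (forall x, derivable g x (d i)) /\ Ck d k' (fun x => 'D_(d i) g x)
  else True.

Definition Dseq (R : realType) (E : normedModType R) (I : Type) (d : I -> E)
    (s : seq I) (g : E -> R) : E -> R :=
  foldr (fun i h => fun x => 'D_(d i) h x) g s.

Definition periodic (R : realType) (E : normedModType R) (w : E) (g : E -> R) :=
  forall x, g (x + w) = g x.

Definition on_torus (R : realType) (g : space R -> R) :=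
  forall i, periodic ((2 * pi) *: dir R i) g.

(* Functions on the product of the torus with the circle of length [T]. *)
Definition on_sttorus (R : realType) (T : R) (g : spacetime R -> R) :=
  (forall i, periodic ((2 * pi) *: stdir R (Some i)) g) /\
  periodic (T *: stdir R None) g.

Definition cube (R : realType) : set (space R) :=
  [set x | forall i, 0 <= coord i x <= 2 * pi].

Definition stcell (R : realType) (T : R) : set (spacetime R) :=
  [set z | cube z.1 /\ 0 <= z.2 <= T].

Definition leb3 (R : realType) :
    {measure set (measurableTypeR R * measurableTypeR R * measurableTypeR R)%type
             -> \bar R} :=
  (@lebesgue_measure R \x @lebesgue_measure R \x @lebesgue_measure R)%E.

Definition leb4 (R : realType) :
    {measure set (measurableTypeR R * measurableTypeR R * measurableTypeR R *
                  measurableTypeR R)%type -> \bar R} :=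
  (leb3 R \x @lebesgue_measure R)%E.

Definition field (R : realType) := 'I_3 -> space R -> R.
Definition stfield (R : realType) := 'I_3 -> spacetime R -> R.

Definition Cm_field (R : realType) (m : nat) (u : field R) :=
  forall j, on_torus (u j) /\ Ck (dir R) m (u j).

Definition div_free (R : realType) (u : field R) :=
  forall x, \sum_i 'D_(dir R i) (u i) x = 0.

Definition mean_zero (R : realType) (u : field R) :=
  forall j, \int[leb3 R]_(x in @cube R) u j x = 0.

(* (2 pi)^-3 times the integral of g(x) exp(-i k.x). *)
Definition fourier (R : realType) (g : space R -> R) (k : 'I_3 -> int) : R[i] :=
  let phase x := \sum_i (k i)%:~R * coord i x in
  let c := (2 * pi) ^- 3 in
  Complex (c * \int[leb3 R]_(x in @cube R) (g x * cos (phase x)))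
          (- (c * \int[leb3 R]_(x in @cube R) (g x * sin (phase x)))).

Definition C1norm (R : realType) (u : field R) : \bar R :=
  (ereal_sup [set (Num.sqrt (\sum_j u j x ^+ 2))%:E | x in [set: space R]] +
   ereal_sup [set (Num.sqrt (\sum_j \sum_i ('D_(dir R i) (u j) x) ^+ 2))%:E
               | x in [set: space R]])%E.

Definition Linfty_norm (R : realType) (T : R) (v : stfield R) : \bar R :=
  ('N[leb4 R]_+oo[ (fun z => (Num.sqrt (\sum_j v j z ^+ 2))%:E)
                   \_ (stcell T) ])%E.

Definition test_function (R : realType) (T : R) (phi : spacetime R -> R) :=
  on_sttorus T phi /\ forall k, Ck (stdir R) k phi.

(* A linear functional on test functions bounded by a C^N norm; its values
   elsewhere are irrelevant. *)
Definition distribution_on (R : realType) (T : R)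
    (p : (spacetime R -> R) -> R) :=
  (forall a phi psi, test_function T phi -> test_function T psi ->
     p (fun z => a * phi z + psi z) = a * p phi + p psi) /\
  (exists (K : R) (N : nat), forall phi, test_function T phi -> forall M : R,
     (forall s : seq (option 'I_3), (size s <= N)%N ->
        forall z, `|Dseq (stdir R) s phi z| <= M) ->
     `|p phi| <= K * M).

Definition dx (R : realType) (i : 'I_3) (phi : spacetime R -> R) z :=
  'D_(stdir R (Some i)) phi z.
Definition dt (R : realType) (phi : spacetime R -> R) z :=
  'D_(stdir R None) phi z.
Definition laplacian (R : realType) (phi : spacetime R -> R) z :=
  \sum_i dx i (dx i phi) z.

(* [Phi t x j] is the [j]-th component of the force.  As [v] is divergence
   free, the convective term is the distribution sum_i d_i (v_i v_j). *)
Definition periodic_NS_solution (R : realType) (nu T : R)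
    (Phi : R -> space R -> 'I_3 -> R) (v : stfield R) :=
  [/\ forall j, measurable_fun setT (v j) /\ on_sttorus T (v j),
      (Linfty_norm T v < +oo)%E,
      forall phi, test_function T phi ->
        \int[leb4 R]_(z in stcell T) (\sum_i v i z * dx i phi z) = 0,
      {ae @lebesgue_measure R, forall t,
        forall j, \int[leb3 R]_(x in @cube R) v j (x, t) = 0} &
      exists2 p, distribution_on T p &
        forall phi j, test_function T phi ->
          \int[leb4 R]_(z in stcell T)
             (- (v j z * dt phi z) - (\sum_i v i z * v j z * dx i phi z)
              - nu * v j z * laplacian phi z)
          - p (dx j phi)
          = \int[leb4 R]_(z in stcell T) (Phi z.2 z.1 j * phi z)].

(* [Phi Omega t x j] is the [j]-th component of F_Omega(x, t). *)
Definition force_A (R : realType) (m : nat) (G : R)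
    (Phi : R -> R -> space R -> 'I_3 -> R) :=
  exists F : field R,
  [/\ Cm_field m F /\ div_free F,
      mean_zero F,
      forall k : 'I_3 -> int, k ord0 = 0 -> forall j, fourier (F j) k = 0,
      exists H : R -> field R,
      [/\ forall s, Cm_field 1 (H s) /\ div_free (H s),
          forall (Omega : R) x (t : R) j, 0 < Omega ->
            is_derive t (1 : R) (fun t' => Omega^-1 * H (Omega * t') j x)
                      (F j (x + (Omega * t) *: dir R ord0)) &
          forall Omega : R, 0 < Omega ->
            (ereal_sup [set C1norm (H (Omega * t)%R) | t in [set: R]]
               <= G%:E)%E] &
      forall (Omega t : R) x j, 0 < Omega ->
        Phi Omega t x j = F j (x + (Omega * t) *: dir R ord0)].

Definition force_B (R : realType) (m : nat) (G : R)
    (Phi : R -> R -> space R -> 'I_3 -> R) :=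
  exists f : field R,
  [/\ Cm_field m f /\ div_free f,
      mean_zero f,
      (C1norm f <= G%:E)%E &
      forall (Omega t : R) x j, 0 < Omega ->
        Phi Omega t x j = f j x * sin (Omega * t)].

(* Main.v *)
(* Write the force as d_t K / Omega, where K stays bounded as Omega grows:
   K = - f cos(Omega t) in case (B), and K is the x_1-antiderivative of F at
   (x_1 + Omega t, x') in case (A).  Let L = d_t - nu Laplacian.  The linear
   response w = L^-1 d_t K / Omega satisfies
     w = K / Omega + (nu / Omega) sum_j d_j L^-1 d_j K,
   and a two-point maximum principle applied to z(x + r e_j) - z(x - r e_j)
   gives |d_j L^-1 g| <= pi sup|g| / (2 nu); hence sup|w| = O(sup_C1 K / Omega).
   The remainder u solves u = - L^-1 P div ((w + u) (x) (w + u)) with P the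
   Leray projection.  It is found by Picard iteration in the space of absolutely
   convergent Fourier series: the l1 norm of the coefficients of w tends to 0 as
   Omega grows, at a rate depending on nu and G only (low modes gain 1 / Omega,
   high modes gain 1 / (nu |k|)), while by Cauchy-Schwarz, Parseval and
   sum_k (1 + |k - l|)^-4 <= 64 the quadratic term in w is a small multiple of
   G / Omega.
   Each iterate is built from partial Fourier sums of K, as a list of terms that
   grows both with the iteration and with the cut-off, so bounded sums of
   amplitudes over the lists give convergence.  Partial Fourier sums of a smooth
   function converge to that function because the difference is orthogonal to
   all trigonometric polynomials and hence vanishes, as one sees by testing
   against the approximate identity prod_i (1 + cos (x_i - y_i))^M. *)

From HB Require Import structures.
Require Import Defs.
From mathcomp Require Import measurable_realfun ess_sup_inf ring lra zify.

Set Implicit Arguments.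
Unset Strict Implicit.
Unset Printing Implicit Defensive.

(** * Integration over the period cell *)

(** The number G controls only first space derivatives of K, so Parseval yields a bound on
    [sum |k|^2 |K_k|^2] and nothing better. In three dimensions this does not control the l1 norm of
    the coefficients, since [sum |k|^-2] diverges. Hence the l1 norm of w is small without being O(G
    / Om), and two different tools are needed. The size of w is measured pointwise, by the maximum
    principle. The quadratic term in w is measured in l1 only after L^-1 P div has gained a factor
    [1 / |k|]: the sum over k of [|w_k| / (1 + |k - l|)] is O(G / Om) uniformly in l, because
    [sum |k|^-2 |k - l|^-2] converges. One factor w thus costs O(G / Om) and the other a small
    multiple of nu. Lists of terms are never simplified. Without cancellation every operation of the
    scheme is monotone, and convergence holds at one rate for all functionals dominated by the
    amplitude, hence uniformly in space and time. In form (A) the field H is only C^1 and only its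
    derivative in s is prescribed, so K is compared with H along lines in direction [x_1], and its
    gradient through difference quotients. *)

Lemma caratheodory_measurable (R : realType) d (T : measurableType d)
    (f : T * measurableTypeR R -> R) :
  (forall t, measurable_fun setT (fun y => f (y, t))) ->
  (forall y, continuous (fun t : R => f (y, t))) ->
  measurable_fun setT f.
Proof.
move=> fm fc.
(* Freezing the last variable at the grid point below it, with mesh [1 / (n + 1)], turns preimages
   into countable unions of rectangles. Continuity in that variable gives pointwise convergence to
   [f]. *)
pose h n (z : T * measurableTypeR R) : R :=
  f (z.1, (Num.floor (z.2 * n.+1%:R))%:~R / n.+1%:R).
apply: (@measurable_fun_cvg _ _ _ _ h) => //.
- move=> n _ B mB; rewrite setTI.
  have -> : h n @^-1` B = \bigcup_(m in [set: int])
    (((fun y => f (y, m%:~R / n.+1%:R)) @^-1` B) `*`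
     ((fun t : measurableTypeR R => (t : R) * n.+1%:R) @^-1` `[m%:~R, (m + 1)%:~R[%classic)).
    apply/seteqP; split => [[y t] /= hB|[y t] [m _ []]] /=.
      exists (Num.floor (t * n.+1%:R)) => //; split => //=.
      by rewrite in_itv/= floor_itv.
    rewrite in_itv/= => yB mt.
    by rewrite /h/= (_ : Num.floor _ = m)//; apply/floor_def.
  apply: countable_bigcupT_measurable; first exact: countableP.
  move=> m; apply: measurableX.
    by rewrite -[X in measurable X]setTI; apply: fm.
  rewrite -[X in measurable X]setTI; apply: measurable_funM => //.
- move=> [y t] _; apply: (@continuous_cvg _ _ _ _ _ _ (fun t : R => f (y, t))); first exact: fc.
  apply/cvgrPdist_le => /= e e0.
  near=> n.
  have n0 : 0 < n.+1%:R :> R by [].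
  have /andP[h1 h2] := floor_itv (t * n.+1%:R : R).
  rewrite ger0_norm ?subr_ge0 ?ler_pdivrMr//.
  rewrite lerBlDr -lerBlDl ler_pdivlMr// mulrBl.
  have : 1 <= e * n.+1%:R.
    rewrite -ler_pdivrMr// mul1r ltW//.
    by near: n; exact: (near_infty_natSinv_lt (PosNum e0)).
  by move: h2; rewrite intrD; lra.
Unshelve. all: end_near. Qed.

Section fubini_zero.
Local Open Scope ereal_scope.
Context d1 d2 (T1 : measurableType d1) (T2 : measurableType d2) (R : realType).
Variable m1 : {sigma_finite_measure set T1 -> \bar R}.
Variable m2 : {sigma_finite_measure set T2 -> \bar R}.
Variables (A : set T1) (B : set T2) (mA : measurable A) (mB : measurable B).
Variable f : T1 * T2 -> R.
Hypothesis fi : (m1 \x m2).-integrable (A `*` B) (EFin \o f).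

Let mAB : measurable (A `*` B). Proof. exact: measurableX. Qed.

Let g := (EFin \o f) \_ (A `*` B).

Let gi : (m1 \x m2).-integrable setT g.
Proof. by apply/integrable_restrict => //; rewrite setTI. Qed.

(** Fubini in the shape needed for integration by parts: a total derivative already integrates to
    zero in its own variable, whatever the other variables are. *)
Lemma integral_prod_zero_r :
  (forall x, A x -> \int[m2]_(y in B) (f (x, y))%:E = 0) ->
  \int[m1 \x m2]_(z in A `*` B) (f z)%:E = 0.
Proof.
move=> h; rewrite integral_mkcond -[LHS]/(\int[_]_z g z).
rewrite -(integral12_prod_meas1 gi); apply: integral0_eq => x _.
rewrite /fubini_F.
have [Ax|nAx] := pselect (A x).
  rewrite -(h x Ax) [RHS]integral_mkcond; apply: eq_integral => y _.
  rewrite /g !patchE; congr (if _ then _ else _).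
  by apply/asbool_equiv_eq; split => [[]|].
apply: integral0_eq => y _; rewrite /g patchE memNset//.
by move=> [].
Qed.

Lemma integral_prod_zero_l :
  (forall y, B y -> \int[m1]_(x in A) (f (x, y))%:E = 0) ->
  \int[m1 \x m2]_(z in A `*` B) (f z)%:E = 0.
Proof.
move=> h; rewrite integral_mkcond -[LHS]/(\int[_]_z g z).
rewrite -(integral21_prod_meas1 gi); apply: integral0_eq => y _.
rewrite /fubini_G.
have [By|nBy] := pselect (B y).
  rewrite -(h y By) [RHS]integral_mkcond; apply: eq_integral => x _.
  rewrite /g !patchE; congr (if _ then _ else _).
  by apply/asbool_equiv_eq; split => [[]|].
apply: integral0_eq => x _; rewrite /g patchE memNset//.
by move=> [].
Qed.

End fubini_zero.

Lemma continuous_pair2 (T U V : topologicalType) (f : T * U -> V) (x : T) :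
  continuous f -> continuous (fun y => f (x, y)).
Proof.
move=> fc y; apply: (@continuous_comp _ _ _ (pair x) f); last exact: fc.
by apply: cvg_pair; [exact: cvg_cst|exact: cvg_id].
Qed.

Lemma continuous_pair1 (T U V : topologicalType) (f : T * U -> V) (y : U) :
  continuous f -> continuous (fun x => f (x, y)).
Proof.
move=> fc x; apply: (@continuous_comp _ _ _ (fun x => (x, y)) f); last exact: fc.
by apply: cvg_pair; [exact: cvg_id|exact: cvg_cst].
Qed.

Section cells.
Variable R : realType.
Notation mR := (measurableTypeR R).
Notation leb := (@lebesgue_measure R).

Lemma continuous_measurable2 (f : R * R -> R) :
  continuous f -> measurable_fun [set: mR * mR] f.
Proof.
move=> fc; apply: caratheodory_measurable => [t|y].
  apply: continuous_measurable_fun; exact: continuous_pair1.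
exact: continuous_pair2.
Qed.

Lemma continuous_measurable3 (f : space R -> R) :
  continuous f -> measurable_fun [set: mR * mR * mR] f.
Proof.
move=> fc; apply: caratheodory_measurable => [t|y].
  apply: continuous_measurable2; exact: continuous_pair1.
exact: continuous_pair2.
Qed.

Lemma continuous_measurable4 (f : spacetime R -> R) :
  continuous f -> measurable_fun [set: mR * mR * mR * mR] f.
Proof.
move=> fc; apply: caratheodory_measurable => [t|y].
  apply: continuous_measurable3; exact: continuous_pair1.
exact: continuous_pair2.
Qed.

Definition seg (L : R) : set R := `[0, L]%classic.

Lemma cubeE : @cube R = seg (2 * pi) `*` seg (2 * pi) `*` seg (2 * pi).
Proof.
apply/seteqP; split => [[[x y] z] /= h|[[x y] z] /= [[]]].
  have := h (inord 0); have := h (inord 1); have := h (inord 2).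
  by rewrite /coord/= !inordK//= /seg/= !in_itv/=.
rewrite /seg/= !in_itv/= => hx hy hz i; rewrite /coord/=.
by case: i => -[|[|[|]]].
Qed.

Lemma stcellE T : @stcell R T =
  seg (2 * pi) `*` seg (2 * pi) `*` seg (2 * pi) `*` seg T.
Proof.
rewrite -cubeE; apply/seteqP; split => [z [h1 h2]|z [h1 h2]];
 by split => //; move: h2; rewrite /seg/= in_itv.
Qed.

Lemma measurable_seg L : measurable (seg L : set mR).
Proof. exact: measurable_itv. Qed.
Hint Resolve measurable_seg : core.

Lemma measurable_cube : measurable (@cube R : set (mR * mR * mR)).
Proof. by rewrite cubeE; do 2 apply: measurableX => //. Qed.

Lemma measurable_stcell T : measurable (@stcell R T : set (mR * mR * mR * mR)).
Proof. by rewrite stcellE; do 3 apply: measurableX => //. Qed.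

Lemma leb_seg L : 0 <= L -> leb (seg L) = L%:E.
Proof.
move=> L0; rewrite lebesgue_measure_itv/= lte_fin sube0.
by case: ltgtP L0 => // <-.
Qed.

Let tpi : 0 <= 2 * pi :> R. Proof. by rewrite mulr_ge0// pi_ge0. Qed.

Lemma leb3_cube : leb3 R (@cube R) = ((2 * pi) ^+ 3)%:E.
Proof.
rewrite cubeE [LHS]product_measure1E//; last exact: measurableX.
transitivity (((2 * pi)%:E * (2 * pi)%:E) * (2 * pi)%:E : \bar R)%E.
  congr (_ * _)%E; last exact: leb_seg.
  by rewrite [LHS]product_measure1E// /= !leb_seg.
by rewrite -!EFinM !exprS expr0 mulr1 mulrA.
Qed.

Lemma leb4_stcell T : 0 <= T -> leb4 R (@stcell R T) = ((2 * pi) ^+ 3 * T)%:E.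
Proof.
move=> T0; rewrite stcellE -cubeE [LHS]product_measure1E//; last first.
  exact: measurable_cube.
by rewrite leb3_cube /= leb_seg// -EFinM.
Qed.

Lemma compact_cube : compact (@cube R).
Proof.
by rewrite cubeE; do 2 ?apply: compact_setX; exact: segment_compact.
Qed.

Lemma compact_stcell T : compact (@stcell R T).
Proof.
by rewrite stcellE; do 3 ?apply: compact_setX; exact: segment_compact.
Qed.

Lemma compact_continuous_bounded (T : topologicalType) (A : set T) (f : T -> R) :
  compact A -> continuous f -> [bounded f x | x in A].
Proof.
move=> cA fc.
have /compact_bounded : compact (f @` A).
  by apply: continuous_compact => //; exact: continuous_subspaceT.
by move=> [M [Mr h]]; exists M; split => // x Mx y Ay; apply: h => //; exists y.
Qed.

Lemma integrable_cube (f : space R -> R) : continuous f ->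
  (leb3 R).-integrable (@cube R) (EFin \o f).
Proof.
move=> fc; apply: measurable_bounded_integrable => //.
- exact: measurable_cube.
- by rewrite [X in (X < _)%E]leb3_cube ltry.
- apply: measurable_funTS; exact: continuous_measurable3.
- by apply: compact_continuous_bounded => //; exact: compact_cube.
Qed.

Lemma integrable_stcell T (f : spacetime R -> R) : 0 <= T -> continuous f ->
  (leb4 R).-integrable (@stcell R T) (EFin \o f).
Proof.
move=> T0 fc; apply: measurable_bounded_integrable => //.
- exact: measurable_stcell.
- by rewrite [X in (X < _)%E]leb4_stcell// ltry.
- apply: measurable_funTS; exact: continuous_measurable4.
- by apply: compact_continuous_bounded => //; exact: compact_stcell.
Qed.

End cells.

(** Since [p] maps the line along [v] affinely to the line along [w], the two difference quotients
    are the same function. No differentiability of [g] outside the direction [w] enters. *)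
Lemma is_derive_pullback (R : realType) (E E' : normedModType R) (p : E -> E')
    (g : E' -> R) (x v : E) (w : E') d :
  (forall h, p (h *: v + x) = h *: w + p x) ->
  is_derive (p x) w g d -> is_derive x v (g \o p) d.
Proof.
move=> hp [gd gD].
have e : (fun h => h^-1 *: (((g \o p) \o shift x) (h *: v) - (g \o p) x)) =
    (fun h => h^-1 *: ((g \o shift (p x)) (h *: w) - g (p x))).
  by apply/funext => h /=; rewrite hp.
by split; [rewrite /derivable e|rewrite -gD /derive e].
Qed.

Section product_sigma_finite.
Local Open Scope ereal_scope.
Context d1 d2 (T1 : measurableType d1) (T2 : measurableType d2) (R : realType).
Variable m1 : {sigma_finite_measure set T1 -> \bar R}.
Variable m2 : {sigma_finite_measure set T2 -> \bar R}.

Lemma product_sigma_finite : sigma_finite setT (m1 \x m2).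
Proof.
have /sigma_finiteP[F [TF ndF Foo]] := sigma_finiteT m1.
have /sigma_finiteP[G [TG ndG Goo]] := sigma_finiteT m2.
exists (fun n => F n `*` G n); last first.
  move=> k; have [? ?] := Foo k; have [? ?] := Goo k.
  split; first exact: measurableX.
  by rewrite product_measure1E// lte_mul_pinfty// ge0_fin_numE.
apply/seteqP; split => // -[x y] _.
have [n _ Fn] : (\bigcup_i F i) x by rewrite -TF.
have [k _ Gk] : (\bigcup_i G i) y by rewrite -TG.
exists (maxn n k) => //; split => /=.
  by move: x Fn; exact/subsetPset/ndF/leq_maxl.
by move: y Gk; exact/subsetPset/ndG/leq_maxr.
Qed.

(** Packed so that a product can itself be a factor in Fubini: the measures on the cube and on the
    space-time cell are nested products. *)
Definition product_sigma_finite_measure :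
    {sigma_finite_measure set (T1 * T2)%type -> \bar R} :=
  HB.pack (m1 \x m2) (Measure_isSigmaFinite.Build _ _ _ (m1 \x m2)
    product_sigma_finite).

End product_sigma_finite.

Section ibp.
Variable R : realType.
Notation mR := (measurableTypeR R).
Notation leb := (@lebesgue_measure R).

Lemma integral_derive_seg (L : R) (h h' : R -> R) : 0 < L ->
  (forall x, is_derive x (1 : R) h (h' x)) -> continuous h' -> h L = h 0 ->
  (\int[leb]_(t in seg L) (h' t)%:E = 0)%E.
Proof.
move=> L0 hd h'c hL.
have hdv x : derivable h x 1 by have [] := hd x.
have hc x : {for x, continuous h}.
  exact/differentiable_continuous/derivable1_diffP.
rewrite (@continuous_FTC2 _ _ h)//.
- by rewrite hL subee.
- exact: continuous_subspaceT.
- split; first by move=> x _; exact: hdv.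
  + by apply: cvg_at_right_filter; exact: hc.
  + by apply: cvg_at_left_filter; exact: hc.
- by move=> x _; rewrite derive1E; have [] := hd x.
Qed.

Let tpi : 0 < 2 * pi :> R. Proof. by rewrite mulr_gt0// pi_gt0. Qed.

Lemma integrable_square (f : R * R -> R) : continuous f ->
  (leb \x leb)%E.-integrable (seg (2 * pi) `*` seg (2 * pi)) (EFin \o f).
Proof.
move=> fc; apply: measurable_bounded_integrable => //.
- by apply: measurableX; exact: measurable_seg.
- rewrite [X in (X < _)%E](@product_measure1E _ _ _ _ R leb leb); try exact: measurable_seg.
  by rewrite lte_mul_pinfty//= leb_seg ?ltry// ltW.
- by apply: measurable_funTS; exact: continuous_measurable2.
- apply: compact_continuous_bounded => //.
  by apply: compact_setX; exact: segment_compact.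
Qed.

Let leb2 : {sigma_finite_measure set (mR * mR)%type -> \bar R} :=
  product_sigma_finite_measure leb leb.
Let leb3s : {sigma_finite_measure set (mR * mR * mR)%type -> \bar R} :=
  product_sigma_finite_measure leb2 leb.

(** The fundamental theorem of calculus in the [i]-th variable gives the difference of two values
    that agree by periodicity; the position of that variable in the nested product decides which
    Fubini order is used. *)
Lemma integral_derive_cube i (g g' : space R -> R) :
  (forall x, is_derive x (dir R i) g (g' x)) -> continuous g' -> on_torus g ->
  (\int[leb3 R]_(x in @cube R) (g' x)%:E = 0)%E.
Proof.
move=> gd g'c gp.
have mS := @measurable_seg R (2 * pi).
have mSS := measurableX mS mS.
have gi := integrable_cube g'c.
have gT := gp i.
case: i gd {gp} gT => -[|[|[|//]]] ilt gd gT; rewrite cubeE in gi *.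
- apply: (integral_prod_zero_l (m1 := leb2) (m2 := leb) mSS mS gi) => z zB.
  have gzi := integrable_square (continuous_pair1 (y := z) g'c).
  apply: (integral_prod_zero_l (m1 := leb) (m2 := leb) mS mS gzi) => y yB.
  apply: (@integral_derive_seg _ (fun x => g (x, y, z))) => //.
  + move=> x; apply: (@is_derive_pullback _ _ _ (fun x => (x, y, z)) g _ _ (dir R (Ordinal ilt))).
    by move=> h; rewrite /dir/=; congr (_, _, _); rewrite /= ?scaler0 ?add0r.
  + exact: (continuous_pair1 (continuous_pair1 g'c)).
  + rewrite -[RHS]gT; congr g.
    by rewrite /dir/=; congr (_, _, _); rewrite /= ?scaler0 ?addr0 ?add0r// /GRing.scale/= mulr1.
- apply: (integral_prod_zero_l (m1 := leb2) (m2 := leb) mSS mS gi) => z zB.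
  have gzi := integrable_square (continuous_pair1 (y := z) g'c).
  apply: (integral_prod_zero_r (m1 := leb) (m2 := leb) mS mS gzi) => x xB.
  apply: (@integral_derive_seg _ (fun y => g (x, y, z))) => //.
  + move=> y; apply: (@is_derive_pullback _ _ _ (fun y => (x, y, z)) g _ _ (dir R (Ordinal ilt))).
    by move=> h; rewrite /dir/=; congr (_, _, _); rewrite /= ?scaler0 ?add0r.
  + exact: (continuous_pair2 (continuous_pair1 g'c)).
  + rewrite -[RHS]gT; congr g.
    by rewrite /dir/=; congr (_, _, _); rewrite /= ?scaler0 ?addr0 ?add0r// /GRing.scale/= mulr1.
- apply: (integral_prod_zero_r (m1 := leb2) (m2 := leb) mSS mS gi) => -[x y] xyB.
  apply: (@integral_derive_seg _ (fun z => g (x, y, z))) => //.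
  + move=> z; apply: (@is_derive_pullback _ _ _ (fun z => (x, y, z)) g _ _ (dir R (Ordinal ilt))).
    by move=> h; rewrite /dir/=; congr (_, _, _); rewrite /= ?scaler0 ?add0r.
  + exact: (continuous_pair2 g'c).
  + rewrite -[RHS]gT; congr g.
    by rewrite /dir/=; congr (_, _, _); rewrite /= ?scaler0 ?addr0 ?add0r// /GRing.scale/= mulr1.
Qed.

Lemma integral_derive_stcell T o (g g' : spacetime R -> R) : 0 < T ->
  (forall x, is_derive x (stdir R o) g (g' x)) -> continuous g' ->
  on_sttorus T g ->
  (\int[leb4 R]_(x in @stcell R T) (g' x)%:E = 0)%E.
Proof.
move=> T0 gd g'c [gpx gpt].
have mS := @measurable_seg R T.
have mC := @measurable_cube R.
have := integrable_stcell (ltW T0) g'c.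
rewrite stcellE -cubeE => gi.
case: o gd => [i|] gd.
- apply: (integral_prod_zero_l (m1 := leb3s) (m2 := leb) mC mS gi) => t tB.
  apply: (@integral_derive_cube i (fun x => g (x, t))).
  + move=> x; apply: (@is_derive_pullback _ _ _ (fun x => (x, t)) g _ _ (stdir R (Some i))).
    by move=> h; congr (_, _); rewrite /= scaler0 add0r.
  + exact: continuous_pair1.
  + move=> j x; rewrite -[RHS](gpx j); congr g.
    by congr (_, _); rewrite /= scaler0 addr0.
- apply: (integral_prod_zero_r (m1 := leb3s) (m2 := leb) mC mS gi) => x xB.
  apply: (@integral_derive_seg _ (fun t => g (x, t))) => //.
  + move=> t; apply: (@is_derive_pullback _ _ _ (fun t => (x, t)) g _ _ (stdir R None)).
    by move=> h; congr (_, _); rewrite /= scaler0 add0r.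
  + exact: continuous_pair2.
  + rewrite -[RHS]gpt; congr g.
    by congr (_, _); rewrite /= ?scaler0 ?addr0 ?add0r// /GRing.scale/= mulr1.
Qed.

End ibp.

(** * Trigonometric terms *)

Lemma is_derive_direction (R : realType) (f : R -> R) (x w d : R) :
  is_derive x (1 : R) f d -> is_derive x w f (w * d).
Proof.
move=> [fd fD].
have df : differentiable f x by exact/derivable1_diffP.
split; first exact: diff_derivable.
by rewrite deriveE// deriv1E// derive1E fD.
Qed.

Section continuous_real_functions.
Context (T : topologicalType) (R : realType).
Implicit Types f g : T -> R.

Lemma continuous_addf f g : continuous f -> continuous g ->
  continuous (fun x => f x + g x).
Proof. by move=> cf cg x; apply: cvgD; [exact: cf|exact: cg]. Qed.

Lemma continuous_subf f g : continuous f -> continuous g ->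
  continuous (fun x => f x - g x).
Proof. by move=> cf cg x; apply: cvgB; [exact: cf|exact: cg]. Qed.

Lemma continuous_oppf f : continuous f -> continuous (fun x => - f x).
Proof. by move=> cf x; apply: cvgN; exact: cf. Qed.

Lemma continuous_mulf f g : continuous f -> continuous g ->
  continuous (fun x => f x * g x).
Proof. by move=> cf cg x; apply: cvgM; [exact: cf|exact: cg]. Qed.

Lemma continuous_cstf (c : R) : continuous (fun _ : T => c).
Proof. by move=> x; exact: cvg_cst. Qed.

Lemma continuous_normf f : continuous f -> continuous (fun x => `|f x|).
Proof. by move=> cf x; apply: cvg_norm; exact: cf. Qed.

Lemma continuous_expf f n : continuous f -> continuous (fun x => f x ^+ n).
Proof.
move=> cf; elim: n => [|n IH].
  by rewrite [X in continuous X](_ : _ = fun=> 1)//; exact: continuous_cstf.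
rewrite [X in continuous X](_ : _ = fun x => f x * f x ^+ n).
  exact: continuous_mulf.
by apply/funext => x; rewrite exprS.
Qed.

Lemma continuous_sumf (I : Type) (r : seq I) (P : pred I) (F : I -> T -> R) :
  (forall i, continuous (F i)) ->
  continuous (fun x => \sum_(i <- r | P i) F i x).
Proof.
move=> cF; apply: (@continuous_big _ _ _ _ _ _ _ _ F) => [|i _].
  exact: add_continuous.
exact: cF.
Qed.

Lemma continuous_cosf f : continuous f -> continuous (fun x => cos (f x)).
Proof.
by move=> cf x; apply: continuous_comp; [exact: cf|exact: continuous_cos].
Qed.

Lemma continuous_sinf f : continuous f -> continuous (fun x => sin (f x)).
Proof.
by move=> cf x; apply: continuous_comp; [exact: cf|exact: continuous_sin].
Qed.

End continuous_real_functions.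

Lemma continuous_fst (T U : topologicalType) : continuous (@fst T U).
Proof. by move=> x; exact: cvg_fst. Qed.

Lemma continuous_snd (T U : topologicalType) : continuous (@snd T U).
Proof. by move=> x; exact: cvg_snd. Qed.

Lemma cosDint2pi (R : realType) (m : int) (x : R) :
  cos (x + m%:~R * (2 * pi)) = cos x.
Proof.
have nat_case n (y : R) : cos (y + n%:R * (2 * pi)) = cos y.
  elim: n => [|n IH]; first by rewrite mul0r addr0.
  rewrite -addn1 natrD mulrDl mul1r addrA.
  by rewrite [X in cos (_ + X)]mulr_natl cosD2pi IH.
case: m => n; first exact: nat_case.
rewrite NegzE mulrNz mulNr.
by have := nat_case n.+1 (x - n.+1%:R * (2 * pi)); rewrite subrK => <-.
Qed.

Lemma sinDint2pi (R : realType) (m : int) (x : R) :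
  sin (x + m%:~R * (2 * pi)) = sin x.
Proof.
by rewrite -[LHS]cosBpihalf -[RHS]cosBpihalf addrAC cosDint2pi.
Qed.

Section terms.
Variable R : realType.

(* [Term k n a b] stands for a cos(theta) + b sin(theta), theta = k.x + n Om t. *)
Record term := Term {
  frq : 'I_3 -> int; tfrq : int; cosc : R; sinc : R }.

Definition kr (t : term) (i : 'I_3) : R := (frq t i)%:~R.
Definition nr (t : term) : R := (tfrq t)%:~R.
Definition ksq (t : term) : R := \sum_i kr t i ^+ 2.
Definition amp (t : term) : R := `|cosc t| + `|sinc t|.

Variable Om : R.

Definition phase (t : term) (z : spacetime R) : R :=
  \sum_i kr t i * coord i z.1 + nr t * Om * z.2.

Definition ev (t : term) (z : spacetime R) : R :=
  cosc t * cos (phase t z) + sinc t * sin (phase t z).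

(* Multiplication of the amplitude [cosc - i sinc] by [p + i q]. *)
Definition mulc (p q : R) (t : term) : term :=
  Term (frq t) (tfrq t) (p * cosc t + q * sinc t) (p * sinc t - q * cosc t).

(** Product-to-sum formulas: a real term carries a frequency together with its opposite, so a
    product has a sum and a difference frequency. *)
Definition tprod (t u : term) : seq term :=
  [:: Term (fun i => frq t i + frq u i) (tfrq t + tfrq u)
        ((cosc t * cosc u - sinc t * sinc u) / 2)
        ((cosc t * sinc u + sinc t * cosc u) / 2);
      Term (fun i => frq t i - frq u i) (tfrq t - tfrq u)
        ((cosc t * cosc u + sinc t * sinc u) / 2)
        ((sinc t * cosc u - cosc t * sinc u) / 2)].

Lemma amp_ge0 t : 0 <= amp t. Proof. by rewrite addr_ge0. Qed.

Lemma normr_ev t z : `|ev t z| <= amp t.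
Proof.
rewrite (le_trans (ler_normD _ _))// !normrM lerD//;
 by rewrite ler_piMr// ler_norml ?cos_le1 ?cos_geN1 ?sin_le1 ?sin_geN1.
Qed.

Lemma amp_mulc p q t : amp (mulc p q t) <= (`|p| + `|q|) * amp t.
Proof.
rewrite /amp/=.
have h1 : `|p * cosc t + q * sinc t| <= `|p| * `|cosc t| + `|q| * `|sinc t|.
  by rewrite (le_trans (ler_normD _ _))// !normrM.
have h2 : `|p * sinc t - q * cosc t| <= `|p| * `|sinc t| + `|q| * `|cosc t|.
  by rewrite (le_trans (ler_normB _ _))// !normrM.
by rewrite (le_trans (lerD h1 h2))//; lra.
Qed.

(** At a fixed point every multiplier acts on two numbers only, the value of [t] and that of its
    quarter-period shift [mulc 0 1 t]. Identities between multipliers thereby become field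
    identities. *)
Lemma ev_mulc p q t z :
  ev (mulc p q t) z = p * ev t z + q * ev (mulc 0 1 t) z.
Proof. by rewrite /ev/= /phase/=; ring. Qed.

Lemma mulcM p q p' q' t :
  mulc p q (mulc p' q' t) = mulc (p * p' - q * q') (p * q' + q * p') t.
Proof. by rewrite /mulc/=; congr Term; ring. Qed.

Lemma amp_tprod t u : \sum_(x <- tprod t u) amp x <= amp t * amp u.
Proof.
rewrite !big_cons big_nil addr0 /amp/=.
rewrite !normrM (ger0_norm (_ : 0 <= 2^-1))//.
have h (x y x' y' : R) : `|x * y + x' * y'| <= `|x| * `|y| + `|x'| * `|y'|.
  by rewrite (le_trans (ler_normD _ _))// !normrM.
have h' (x y x' y' : R) : `|x * y - x' * y'| <= `|x| * `|y| + `|x'| * `|y'|.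
  by rewrite (le_trans (ler_normB _ _))// !normrM.
have := h' (cosc t) (cosc u) (sinc t) (sinc u).
have := h (cosc t) (sinc u) (sinc t) (cosc u).
have := h (cosc t) (cosc u) (sinc t) (sinc u).
have := h' (sinc t) (cosc u) (cosc t) (sinc u).
lra.
Qed.

Lemma phaseD t u z : \sum_i (frq t i + frq u i)%:~R * coord i z.1 +
   (tfrq t + tfrq u)%:~R * Om * z.2 = phase t z + phase u z.
Proof.
rewrite /phase intrD (eq_bigr (fun i => kr t i * coord i z.1 + kr u i * coord i z.1)).
  by rewrite big_split/= /nr; ring.
by move=> i _; rewrite intrD mulrDl.
Qed.

Lemma phaseB t u z : \sum_i (frq t i - frq u i)%:~R * coord i z.1 +
   (tfrq t - tfrq u)%:~R * Om * z.2 = phase t z - phase u z.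
Proof.
rewrite /phase intrB (eq_bigr (fun i => kr t i * coord i z.1 - kr u i * coord i z.1)).
  by rewrite sumrB /nr; ring.
by move=> i _; rewrite intrB mulrBl.
Qed.

Lemma ev_tprod t u z : \sum_(x <- tprod t u) ev x z = ev t z * ev u z.
Proof.
rewrite !big_cons big_nil addr0 /ev /phase/= -/(phase t z) -/(phase u z).
rewrite [X in cos X]phaseD [X in sin X]phaseD.
rewrite [X in _ + (_ * cos X + _)]phaseB [X in _ + (_ + _ * sin X)]phaseB.
by rewrite cosD sinD cosB sinB; field; rewrite ?pnatr_eq0.
Qed.

Lemma coord_continuous i : continuous (@coord R i).
Proof.
move=> x; rewrite /coord; case: i => -[|[|[|//]]] ilt /=.
- apply: (@continuous_comp _ _ _ fst fst); exact: cvg_fst.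
- apply: (@continuous_comp _ _ _ fst snd); [exact: cvg_fst|exact: cvg_snd].
- exact: cvg_snd.
Qed.

Lemma phase_continuous t : continuous (phase t).
Proof.
apply: continuous_addf.
  apply: continuous_sumf => i; apply: continuous_mulf; first exact: continuous_cstf.
  move=> z; apply: continuous_comp; first exact: continuous_fst.
  exact: coord_continuous.
apply: continuous_mulf; first exact: continuous_cstf.
exact: continuous_snd.
Qed.

Lemma ev_continuous t : continuous (ev t).
Proof.
have pc := @phase_continuous t.
apply: continuous_addf; apply: continuous_mulf; try exact: continuous_cstf.
  exact: continuous_cosf.
exact: continuous_sinf.
Qed.

Definition dfrq (t : term) (o : option 'I_3) : R :=
  if o is Some i then kr t i else nr t * Om.

Lemma coord_dir i j : coord i (dir R j) = (i == j)%:R.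
Proof. by case: i j => -[|[|[|//]]] ? [[|[|[|//]]] ?]. Qed.

Lemma coordD i (x y : space R) : coord i (x + y) = coord i x + coord i y.
Proof. by case: i => -[|[|[|//]]]. Qed.

Lemma coordZ i h (x : space R) : coord i (h *: x) = h * coord i x.
Proof. by case: i => -[|[|[|//]]]. Qed.

Lemma phase_shift t o h z : phase t (h *: stdir R o + z) = h *: dfrq t o + phase t z.
Proof.
rewrite /phase.
under eq_bigr do rewrite /= coordD coordZ mulrDr.
rewrite big_split/=; case: o => [i|]/=.
  rewrite (bigD1 i)//= big1.
    by rewrite coord_dir eqxx /GRing.scale/=; ring.
  by move=> j ji; rewrite coord_dir (negbTE ji) !mulr0.
rewrite big1 => [|j _]; first by rewrite /GRing.scale/=; ring.
by rewrite /coord; case: j => -[|[|[|//]]] ?/=; rewrite /GRing.scale/=; ring.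
Qed.

Lemma is_derive_ev t o z :
  is_derive z (stdir R o) (ev t) (ev (mulc 0 (dfrq t o) t) z).
Proof.
pose f (th : R) : R := cosc t * cos th + sinc t * sin th.
apply: (@is_derive_pullback _ _ _ (phase t) f _ _ (dfrq t o)) => [h|].
  exact: phase_shift.
have -> : ev (mulc 0 (dfrq t o) t) z = dfrq t o *
   (cosc t * (- sin (phase t z)) + sinc t * cos (phase t z)).
  by rewrite /ev/= /phase/=; ring.
apply: is_derive_direction; apply: is_derive_eq.
Qed.

Lemma ev_periodic t o (p : R) z (m : int) :
  p * dfrq t o = m%:~R * (2 * pi) -> ev t (z + p *: stdir R o) = ev t z.
Proof.
move=> h; rewrite /ev [z + _]addrC phase_shift /GRing.scale/= h.
by rewrite [_ + phase _ _]addrC cosDint2pi sinDint2pi.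
Qed.

End terms.

(** * Lists of terms *)

Section lists.
Variable R : realType.
Notation term := (term R).
Implicit Types (A B : seq term) (phi : term -> R).

Definition tsum phi A : R := \sum_(t <- A) phi t.

(** For lists this amounts to inclusion as multisets. Phrased through nonnegative functionals it
    needs no bookkeeping of positions and passes through concatenation, [map] and products. *)
Definition leL A B := forall phi, (forall t, 0 <= phi t) -> tsum phi A <= tsum phi B.

Lemma tsum_cat phi A B : tsum phi (A ++ B) = tsum phi A + tsum phi B.
Proof. exact: big_cat. Qed.

Lemma tsum_map phi f A : tsum phi (map f A) = tsum (phi \o f) A.
Proof. exact: big_map. Qed.

Lemma tsum_flatten phi (As : seq (seq term)) :
  tsum phi (flatten As) = \sum_(A <- As) tsum phi A.
Proof. exact: big_flatten. Qed.

Lemma tsum_ge0 phi A : (forall t, 0 <= phi t) -> 0 <= tsum phi A.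
Proof. by move=> h; apply: sumr_ge0. Qed.

Lemma ler_tsum phi psi A : (forall t, phi t <= psi t) -> tsum phi A <= tsum psi A.
Proof. by move=> h; apply: ler_sum. Qed.

Lemma tsumD phi psi A : tsum (fun t => phi t + psi t) A = tsum phi A + tsum psi A.
Proof. exact: big_split. Qed.

Lemma tsumZ c phi A : tsum (fun t => c * phi t) A = c * tsum phi A.
Proof. by rewrite /tsum mulr_sumr. Qed.

Lemma tsumN phi A : tsum (fun t => - phi t) A = - tsum phi A.
Proof. by rewrite /tsum sumrN. Qed.

Lemma tsum_sum (I : Type) (r : seq I) (F : I -> term -> R) A :
  tsum (fun t => \sum_(i <- r) F i t) A = \sum_(i <- r) tsum (F i) A.
Proof. exact: exchange_big. Qed.

Lemma ler_norm_tsum phi psi A : (forall t, `|phi t| <= psi t) ->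
  `|tsum phi A| <= tsum psi A.
Proof. by move=> h; rewrite (le_trans (ler_norm_sum _ _ _))//; apply: ler_sum. Qed.

Lemma leL_refl A : leL A A. Proof. by []. Qed.

Lemma leL_trans A B C : leL A B -> leL B C -> leL A C.
Proof. by move=> h1 h2 phi h; exact: le_trans (h1 _ h) (h2 _ h). Qed.

Lemma leL_nil A : leL [::] A.
Proof. by move=> phi h; rewrite /tsum big_nil sumr_ge0. Qed.

Lemma leL_cat A B A' B' : leL A A' -> leL B B' -> leL (A ++ B) (A' ++ B').
Proof. by move=> h1 h2 phi h; rewrite !tsum_cat lerD ?h1 ?h2. Qed.

Lemma leL_map f A B : leL A B -> leL (map f A) (map f B).
Proof. by move=> AB phi h; rewrite !tsum_map AB// => t; exact: h. Qed.

Lemma leL_flatten (I : Type) (r : seq I) (f g : I -> seq term) :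
  (forall i, leL (f i) (g i)) -> leL (flatten (map f r)) (flatten (map g r)).
Proof.
move=> fg phi h; rewrite !tsum_flatten !big_map; apply: ler_sum => i _.
exact: fg.
Qed.

(** Apply the comparison to the two nonnegative functionals [amp + phi] and [amp - phi]. *)
Lemma leL_dist A B phi : leL A B -> (forall t, `|phi t| <= amp t) ->
  `|tsum phi B - tsum phi A| <= tsum (@amp R) B - tsum (@amp R) A.
Proof.
move=> AB h.
have h1 : forall t, 0 <= amp t + phi t.
  by move=> t; have := h t; rewrite ler_norml => /andP[]; lra.
have h2 : forall t, 0 <= amp t + - phi t.
  by move=> t; have := h t; rewrite ler_norml => /andP[]; lra.
have := AB _ h1; have := AB _ h2; rewrite !tsumD !tsumN ler_norml; lra.
Qed.

Definition qlist A B : seq term := flatten [seq flatten [seq tprod t u | u <- B] | t <- A].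

Lemma tsum_qlist phi A B :
  tsum phi (qlist A B) = \sum_(t <- A) \sum_(u <- B) tsum phi (tprod t u).
Proof.
rewrite /qlist tsum_flatten big_map; apply: eq_bigr => t _.
by rewrite tsum_flatten big_map.
Qed.

Lemma leL_qlist A B A' B' : leL A A' -> leL B B' -> leL (qlist A B) (qlist A' B').
Proof.
move=> h1 h2 phi h; rewrite !tsum_qlist.
have := h1 (fun t => \sum_(u <- B) tsum phi (tprod t u)) => /(_ _)/le_trans; apply.
  by move=> t; apply: sumr_ge0 => u _; exact: tsum_ge0.
apply: ler_sum => t _; apply: (h2 (fun u => tsum phi (tprod t u))).
by move=> u; exact: tsum_ge0.
Qed.

Lemma tsum_qlist_catl phi A A' B :
  tsum phi (qlist (A ++ A') B) = tsum phi (qlist A B) + tsum phi (qlist A' B).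
Proof. by rewrite !tsum_qlist big_cat. Qed.

Lemma tsum_qlist_catr phi A B B' :
  tsum phi (qlist A (B ++ B')) = tsum phi (qlist A B) + tsum phi (qlist A B').
Proof.
rewrite !tsum_qlist -big_split; apply: eq_bigr => t _; exact: big_cat.
Qed.

Lemma tsum_amp_qlist A B :
  tsum (@amp R) (qlist A B) <= tsum (@amp R) A * tsum (@amp R) B.
Proof.
rewrite tsum_qlist /tsum mulr_suml; apply: ler_sum => t _.
by rewrite mulr_sumr; apply: ler_sum => u _; exact: amp_tprod.
Qed.

(** The amplitude sums increase and are bounded, hence converge, and by [leL_dist] their tails
    dominate the tails of every [phi]. The point is that [err] is chosen before [phi]: evaluation at
    different points then converges uniformly. *)
Lemma monotone_list_cvg (A : nat -> seq term) (M : R) :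
  (forall n, leL (A n) (A n.+1)) -> (forall n, tsum (@amp R) (A n) <= M) ->
  exists2 err : nat -> R, err @ \oo --> 0 &
    forall phi, (forall t, `|phi t| <= amp t) ->
    exists l, forall n, `|l - tsum phi (A n)| <= err n.
Proof.
move=> Amono AM.
have monomn m n : (m <= n)%N -> leL (A m) (A n).
  move=> /subnK <-; elim: (n - m)%N => [|k IH]; first exact: leL_refl.
  by rewrite addSn; apply: leL_trans IH _; exact: Amono.
pose a n := tsum (@amp R) (A n).
have cv phi (c : R) : (forall t, 0 <= phi t) -> (forall t, phi t <= 2 * amp t) ->
    cvgn (fun n => tsum phi (A n)).
  move=> h0 h2; apply: nondecreasing_is_cvgn.
    by move=> m n mn; exact: monomn.
  exists (2 * M) => _ [n _ <-]; rewrite (le_trans (ler_tsum _ h2))//.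
  by rewrite tsumZ ler_pM2l.
have amp0 : forall t : term, 0 <= amp t by exact: amp_ge0.
have ca : cvgn a by apply: (cv _ 0) => // t; have := amp0 t; lra.
exists (fun n => limn a - a n).
  by rewrite -(subrr (limn a)); apply: cvgB => //; exact: cvg_cst.
move=> phi hphi.
have cphi : cvgn (fun n => tsum phi (A n)).
  have -> : (fun n => tsum phi (A n)) =
            (fun n => tsum (fun t => amp t + phi t) (A n)) \- a.
    by apply/funext => n /=; rewrite tsumD /a; ring.
  apply: is_cvgB => //; apply: (cv _ 0) => t;
    by have := hphi t; rewrite ler_norml => /andP[]; lra.
exists (limn (fun n => tsum phi (A n))) => n.
have c1 : (fun k => `|tsum phi (A k) - tsum phi (A n)|) @ \oo -->
    `|limn (fun n => tsum phi (A n)) - tsum phi (A n)|.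
  by apply: cvg_norm; apply: cvgB => //; exact: cvg_cst.
have c2 : (fun k => a k - a n) @ \oo --> limn a - a n.
  by apply: cvgB => //; exact: cvg_cst.
rewrite -(cvg_lim (@Rhausdorff R) c1) -(cvg_lim (@Rhausdorff R) c2).
apply: ler_lim.
- by apply/cvg_ex; eexists; exact: c1.
- by apply/cvg_ex; eexists; exact: c2.
- near=> k; apply: leL_dist => //; apply: monomn; near: k; exact: nbhs_infty_ge.
Unshelve. all: end_near. Qed.

End lists.

(** * Fourier multipliers *)

Lemma normr_int_le_sqr (R : realType) (m : int) : `|m%:~R : R| <= m%:~R ^+ 2.
Proof.
rewrite -[X in _ <= X]real_normK ?num_real// -intr_norm expr2.
have [->|m0] := eqVneq m 0; first by rewrite normr0 mulr0.
rewrite ler_pMr ?ltr0z ?normr_gt0//.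
by rewrite (ler_int R 1) -gtz0_ge1 normr_gt0.
Qed.

Section multipliers.
Variable R : realType.
Notation term := (term R).
Variables (nu Om : R).
Hypothesis nu0 : 0 < nu.
Implicit Types (t u : term).

Definition sz t : R := 1 + \sum_i `|kr t i|.

Lemma sz_ge1 t : 1 <= sz t.
Proof. by rewrite lerDl sumr_ge0. Qed.

Lemma ksq_ge0 t : 0 <= ksq t.
Proof. by apply: sumr_ge0 => i _; exact: sqr_ge0. Qed.

Lemma kr_sqr_le t i : kr t i ^+ 2 <= ksq t.
Proof. by rewrite /ksq (bigD1 i)//= lerDl sumr_ge0// => j _; exact: sqr_ge0. Qed.

Lemma ksq_eq0 t i : ksq t = 0 -> kr t i = 0.
Proof.
move=> h; apply/eqP; rewrite -sqrf_eq0 eq_le sqr_ge0 andbT -h.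
exact: kr_sqr_le.
Qed.

Lemma kr_neq0 t : ksq t != 0 -> exists i, kr t i != 0.
Proof.
move=> k0; apply/existsP; apply: contraNT k0; rewrite negb_exists => /forallP h.
by rewrite /ksq big1// => i _; move: (h i); rewrite negbK => /eqP ->; rewrite expr0n.
Qed.

Lemma ksq_ge1 t : ksq t != 0 -> 1 <= ksq t.
Proof.
move=> /kr_neq0[i ki]; apply: le_trans (kr_sqr_le t i).
apply: le_trans (normr_int_le_sqr R (frq t i)).
rewrite -intr_norm (ler_int R 1) -gtz0_ge1 normr_gt0.
by move: ki; rewrite /kr intr_eq0.
Qed.

(** Integrality gives [|k_i| <= k_i^2], and the three products [|k_i k_j|] cost at most [2 ksq] by
    the arithmetic-geometric inequality. *)
Lemma kr_sz t i : `|kr t i| * sz t <= 3 * ksq t.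
Proof.
rewrite /sz mulrDr mulr1 mulr_sumr.
have h1 : `|kr t i| <= kr t i ^+ 2 by exact: normr_int_le_sqr.
have h2 j : `|kr t i| * `|kr t j| <= (kr t i ^+ 2 + kr t j ^+ 2) / 2.
  have := sqr_ge0 (`|kr t i| - `|kr t j|).
  rewrite sqrrB !real_normK ?num_real// mulr2n; lra.
have h3 := kr_sqr_le t i.
have h4 : \sum_(j < 3) `|kr t i| * `|kr t j| <=
    \sum_(j < 3) (kr t i ^+ 2 + kr t j ^+ 2) / 2.
  by apply: ler_sum => j _; exact: h2.
have h5 : \sum_(j < 3) (kr t i ^+ 2 + kr t j ^+ 2) / 2 =
    (3 * kr t i ^+ 2 + ksq t) / 2.
  by rewrite -mulr_suml big_split/= sumr_const card_ord mulr_natl.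
rewrite h5 in h4; lra.
Qed.

(** The symbol of d_t - nu Laplacian is [hX + sqrt(-1) hY], and [hD] is its squared modulus;
    [heat_inv] multiplies by the conjugate over [hD]. *)
Definition hX t := nu * ksq t.
Definition hY t := nr t * Om.
Definition hD t := hX t ^+ 2 + hY t ^+ 2.

Definition heat t := mulc (hX t) (hY t) t.
Definition heat_inv t := mulc (hX t / hD t) (- (hY t / hD t)) t.

Lemma hX_gt0 t : 0 < ksq t -> 0 < hX t. Proof. exact: mulr_gt0. Qed.

Lemma hD_gt0 t : 0 < ksq t -> 0 < hD t.
Proof. by move=> /hX_gt0 h; rewrite ltr_wpDr ?sqr_ge0// exprn_gt0. Qed.

Lemma ksq_gt0 t : ksq t != 0 -> 0 < ksq t.
Proof. by rewrite lt0r ksq_ge0 => ->. Qed.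

Lemma hXY_le t : 0 < ksq t -> (hX t + `|hY t|) / hD t <= 2 / hX t.
Proof.
move=> k0; rewrite ler_pdivrMr ?hD_gt0// mulrAC ler_pdivlMr ?hX_gt0// /hD.
have := sqr_ge0 (hX t - `|hY t|).
rewrite sqrrB !real_normK ?num_real// mulr2n; have := sqr_ge0 (hY t).
have := sqr_ge0 (hX t); lra.
Qed.

(** Symbol of the Leray projection. At zero frequency the quotient is 0 and the identity remains,
    which is harmless because [nonlin] carries a factor [kr t i]. *)
Definition leray (j l : 'I_3) t : R := (j == l)%:R - kr t j * kr t l / ksq t.

(** Component [j] of - L^-1 P d_i applied to the entry [(i, l)] of the tensor. The two coefficients
    come from [sqrt(-1) k_i / (hX + sqrt(-1) hY) = k_i (hY + sqrt(-1) hX) / hD]. *)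
Definition nonlin j i l t :=
  mulc (- (leray j l t * kr t i * (hY t / hD t)))
       (- (leray j l t * kr t i * (hX t / hD t))) t.

(** Solves - Laplacian p = d_i d_l of the tensor entry, mode by mode. *)
Definition press i l t := mulc (- (kr t i * kr t l / ksq t)) 0 t.

Lemma kk_le t i l : `|kr t i * kr t l / ksq t| <= 1.
Proof.
have [k0|k0] := eqVneq (ksq t) 0; first by rewrite k0 invr0 mulr0 normr0.
have kp := ksq_gt0 k0.
rewrite normrM [`|_^-1|]gtr0_norm ?invr_gt0// ler_pdivrMr// mul1r normrM.
have := sqr_ge0 (`|kr t i| - `|kr t l|).
rewrite sqrrB !real_normK ?num_real// mulr2n.
have := kr_sqr_le t i; have := kr_sqr_le t l; lra.
Qed.

Lemma amp_press i l t : amp (press i l t) <= amp t.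
Proof.
rewrite (le_trans (amp_mulc _ _ _))// normr0 addr0 ler_piMl ?amp_ge0//.
by rewrite normrN kk_le.
Qed.

Lemma leray_le j l t : `|leray j l t| <= 2.
Proof.
rewrite (le_trans (ler_normB _ _))// (_ : 2 = 1 + 1)// lerD ?kk_le//.
by case: eqP => _; rewrite ?normr1 ?normr0.
Qed.

(** The constant is 2 for the projection, 3 from [kr_sz] and 2 from [hXY_le]. The division by [sz]
    is what remains of two derivatives gained and one lost. *)
Lemma amp_nonlin j i l t : amp (nonlin j i l t) <= 12 / nu * (amp t / sz t).
Proof.
have s1 := sz_ge1 t; have s0 : 0 < sz t by exact: lt_le_trans s1.
rewrite (le_trans (amp_mulc _ _ _))//.
rewrite [X in _ <= X](_ : _ = (12 / nu / sz t) * amp t); last by ring.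
rewrite ler_wpM2r ?amp_ge0// !normrN.
have [k0|k0] := eqVneq (ksq t) 0.
  rewrite (ksq_eq0 _ k0) !(mulr0, mul0r) normr0 addr0.
  by rewrite !divr_ge0// ltW.
have kp := ksq_gt0 k0.
have dp := hD_gt0 kp; have xp := hX_gt0 kp.
rewrite ![`|_ * (_ / hD t)|]normrM -mulrDr.
rewrite !(normrM _ (hD t)^-1) (gtr0_norm (_ : 0 < (hD t)^-1)) ?invr_gt0//.
rewrite (gtr0_norm xp) -mulrDl addrC.
have h := hXY_le kp.
have := kr_sz t i; rewrite -ler_pdivlMr// => hk.
have := leray_le j l t => hl.
rewrite normrM.
have A0 : 0 <= `|leray j l t| * `|kr t i| by [].
rewrite (le_trans (ler_wpM2l A0 h))//.
have B0 : 0 <= 2 / hX t by rewrite divr_ge0// ltW.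
rewrite (le_trans (ler_wpM2r B0 (ler_pM _ _ hl hk)))//.
rewrite /hX le_eqVlt; apply/orP; left; apply/eqP; field.
by rewrite !gt_eqF.
Qed.

Lemma amp_nonlin_ksq0 j i l t : ksq t = 0 -> amp (nonlin j i l t) = 0.
Proof.
move=> k0; rewrite /amp/= (ksq_eq0 i k0) !(mulr0, mul0r, oppr0, normr0, addr0, subr0).
by [].
Qed.

Lemma nonlin_div i l t z :
  \sum_j ev Om (mulc 0 (kr t j) (nonlin j i l t)) z = 0.
Proof.
have [k0|k0] := eqVneq (ksq t) 0.
  apply: big1 => j _; rewrite (ksq_eq0 _ k0) /ev/= .
  by rewrite !(mul0r, oppr0, addr0, subr0).
have e : \sum_j kr t j * leray j l t = 0.
  rewrite /leray.
  under eq_bigr do rewrite mulrBr.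
  rewrite sumrB (bigD1 l)//= eqxx mulr1 big1 ?addr0; last first.
    by move=> j /negbTE->; rewrite mulr0.
  rewrite (eq_bigr (fun j => kr t j ^+ 2 * (kr t l / ksq t))) => [|j _]; last first.
    by rewrite expr2 !mulrA.
  by rewrite -mulr_suml mulrCA divff// mulr1 subrr.
pose c := kr t i * (hX t / hD t) * ev Om t z - kr t i * (hY t / hD t) * ev Om (mulc 0 1 t) z.
rewrite (eq_bigr (fun j => kr t j * leray j l t * c)).
  by rewrite -mulr_suml e mul0r.
move=> j _; rewrite mulcM ev_mulc /c; ring.
Qed.

(** The heat operator cancels its inverse, and the projection is the identity minus a gradient,
    whose potential is the pressure. At zero frequency every term vanishes. *)
Lemma heat_nonlin j i l t z :
  ev Om (heat (nonlin j i l t)) z =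
  - ((j == l)%:R * ev Om (mulc 0 (kr t i) t) z)
  - ev Om (mulc 0 (kr t j) (press i l t)) z.
Proof.
have [k0|k0] := eqVneq (ksq t) 0.
  rewrite /ev/= /press /kr/= -![(frq t _)%:~R]/(kr t _) !(ksq_eq0 _ k0).
  by rewrite !(mul0r, mulr0, addr0, subr0, oppr0).
have dp := hD_gt0 (ksq_gt0 k0).
rewrite /heat -[hX (nonlin _ _ _ _)]/(hX t) -[hY (nonlin _ _ _ _)]/(hY t).
have [J E] : exists J, forall p q, ev Om (mulc p q t) z = p * ev Om t z + q * J.
  by eexists => p q; exact: ev_mulc.
rewrite !mulcM !E /leray.
have {dp} : hX t ^+ 2 + hY t ^+ 2 != 0 by rewrite gt_eqF.
rewrite /hD => dp; field.
by rewrite k0 dp.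
Qed.

Lemma heat_heat_inv t z : ksq t != 0 -> ev Om (heat (heat_inv t)) z = ev Om t z.
Proof.
move=> k0; have dp := hD_gt0 (ksq_gt0 k0).
rewrite /heat -[hX (heat_inv _)]/(hX t) -[hY (heat_inv _)]/(hY t).
rewrite mulcM ev_mulc.
have {dp} : hX t ^+ 2 + hY t ^+ 2 != 0 by rewrite gt_eqF.
by rewrite /hD => dp; field.
Qed.

End multipliers.

(** * The Picard iteration *)

Section scheme.
Variable R : realType.
Notation term := (term R).
Variables (nu Om : R).
Hypothesis nu0 : 0 < nu.
Implicit Types (t u : term) (V : 'I_3 -> seq term).

Definition nonlinL V (j : 'I_3) : seq term :=
  flatten [seq map (nonlin nu Om j p.1 p.2) (qlist (V p.1) (V p.2))
          | p <- index_enum ('I_3 * 'I_3)%type].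

Definition pressL V : seq term :=
  flatten [seq map (press p.1 p.2) (qlist (V p.1) (V p.2))
          | p <- index_enum ('I_3 * 'I_3)%type].

Lemma tsum_nonlinL phi V j : tsum phi (nonlinL V j) =
  \sum_i \sum_l tsum (phi \o nonlin nu Om j i l) (qlist (V i) (V l)).
Proof.
rewrite /nonlinL tsum_flatten big_map pair_big; apply: eq_bigr => p _.
by rewrite tsum_map.
Qed.

Lemma tsum_pressL phi V : tsum phi (pressL V) =
  \sum_i \sum_l tsum (phi \o press i l) (qlist (V i) (V l)).
Proof.
rewrite /pressL tsum_flatten big_map pair_big; apply: eq_bigr => p _.
by rewrite tsum_map.
Qed.

Lemma leL_nonlinL V V' j : (forall i, leL (V i) (V' i)) ->
  leL (nonlinL V j) (nonlinL V' j).
Proof.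
by move=> h; apply: leL_flatten => p; apply: leL_map; exact: leL_qlist.
Qed.

Lemma leL_pressL V V' : (forall i, leL (V i) (V' i)) ->
  leL (pressL V) (pressL V').
Proof.
by move=> h; apply: leL_flatten => p; apply: leL_map; exact: leL_qlist.
Qed.

Definition evl (A : seq term) z : R := tsum (ev Om ^~ z) A.

Definition dlist o (A : seq term) := [seq mulc 0 (dfrq Om t o) t | t <- A].

Lemma heat_nonlinL V j z :
  evl (map (heat nu Om) (nonlinL V j)) z =
  - \sum_i evl (dlist (Some i) (qlist (V i) (V j))) z
  - evl (dlist (Some j) (pressL V)) z.
Proof.
rewrite /evl !tsum_map tsum_nonlinL tsum_pressL.
rewrite (eq_bigr (fun i => - tsum (ev Om ^~ z) (dlist (Some i) (qlist (V i) (V j)))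
   - \sum_l tsum ((ev Om ^~ z) \o (fun t => mulc 0 (kr t j) t) \o press i l) (qlist (V i) (V l)))).
  by rewrite sumrB sumrN.
move=> i _.
rewrite (eq_bigr (fun l => - ((j == l)%:R * tsum (ev Om ^~ z) (dlist (Some i) (qlist (V i) (V l))))
   - tsum ((ev Om ^~ z) \o (fun t => mulc 0 (kr t j) t) \o press i l) (qlist (V i) (V l)))).
  rewrite sumrB; congr (_ - _).
  rewrite sumrN (bigD1 j)//= eqxx mul1r big1 ?addr0//.
  by move=> l; rewrite eq_sym => /negbTE ->; rewrite mul0r.
move=> l _; rewrite tsum_map -tsumZ -!tsumN -tsumD.
by apply: eq_bigr => t _ /=; exact: heat_nonlin.
Qed.

Lemma nonlinL_div V z :
  \sum_j evl (dlist (Some j) (nonlinL V j)) z = 0.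
Proof.
rewrite /evl.
under eq_bigr do rewrite tsum_map tsum_nonlinL.
rewrite exchange_big big1//= => i _.
rewrite exchange_big big1//= => l _.
rewrite -tsum_sum /tsum big1// => t _.
exact: nonlin_div.
Qed.

Definition amps V : R := \sum_j tsum (@amp R) (V j).

(** The weight is the derivative gained by [nonlin]. For two drive responses it brings the sum down
    to order G / Om; products containing a perturbation are estimated without it, by [crossz_le]. *)
Definition crossz (A B : seq term) : R := tsum (fun t => amp t / sz t) (qlist A B).

Lemma crossz_le A B : crossz A B <= tsum (@amp R) A * tsum (@amp R) B.
Proof.
apply: le_trans (tsum_amp_qlist A B); apply: ler_tsum => t.
by rewrite ler_pdivrMr ?(lt_le_trans _ (sz_ge1 t))// ler_peMr ?amp_ge0// sz_ge1.
Qed.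

Lemma tsum_nonlinL_le V j :
  tsum (@amp R) (nonlinL V j) <=
  12 / nu * \sum_i \sum_l crossz (V i) (V l).
Proof.
rewrite tsum_nonlinL mulr_sumr; apply: ler_sum => i _.
rewrite mulr_sumr; apply: ler_sum => l _.
by rewrite /crossz -tsumZ; apply: ler_tsum => t; exact: amp_nonlin.
Qed.

Lemma tsum_pressL_le V : tsum (@amp R) (pressL V) <= amps V ^+ 2.
Proof.
rewrite tsum_pressL expr2 /amps mulr_suml; apply: ler_sum => i _.
rewrite mulr_sumr; apply: ler_sum => l _.
apply: le_trans (tsum_amp_qlist _ _); apply: ler_tsum => t; exact: amp_press.
Qed.

Variable W : nat -> 'I_3 -> seq term.

(** The index is at once the number of Picard steps and the cut-off of [W]. Along this diagonal the
    lists increase, because the start is empty and [nonlinL] is monotone. *)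
Fixpoint pert n : 'I_3 -> seq term :=
  if n is n'.+1 then nonlinL (fun i => W n' i ++ pert n' i) else fun=> [::].

Definition approx n i := W n i ++ pert n i.

Lemma pertS n : pert n.+1 = nonlinL (approx n). Proof. by []. Qed.

Hypothesis Wmono : forall n j, leL (W n j) (W n.+1 j).

Lemma pert_mono n j : leL (pert n j) (pert n.+1 j).
Proof.
elim: n j => [|n IH] j; first exact: leL_nil.
by apply: leL_nonlinL => i; apply: leL_cat; [exact: Wmono|exact: IH].
Qed.

Lemma approx_mono n j : leL (approx n j) (approx n.+1 j).
Proof. by apply: leL_cat; [exact: Wmono|exact: pert_mono]. Qed.

Variables (e d r : R).
Hypothesis We : forall n, amps (W n) <= e.
Hypothesis Wd : forall n i l, crossz (W n i) (W n l) <= d.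
Hypothesis rd : 36 / nu * (9 * d) <= r / 2.
Hypothesis re : 36 / nu * (2 * e + r) <= 2^-1.
Hypothesis r0 : 0 <= r.

Lemma amps_ge0 V : 0 <= amps V.
Proof. by apply: sumr_ge0 => j _; apply: tsum_ge0; exact: amp_ge0. Qed.

(** The ball of radius [r] is invariant. The nine products of drive with drive cost [9 * d], the
    products containing [pert] cost at most [(2 * e + r) * r], and three components turn [12 / nu]
    into [36 / nu]; [rd] and [re] each allow one half of [r]. *)
Lemma amps_pert n : amps (pert n) <= r.
Proof.
elim: n => [|n IH].
  by rewrite /amps big1// => j _; rewrite /tsum big_nil.
have e0 : 0 <= e := le_trans (amps_ge0 _) (We n).
have c0 : 0 <= 12 / nu by rewrite divr_ge0// ltW.
have key : \sum_i \sum_l crossz (approx n i) (approx n l) <=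
    9 * d + (2 * e + r) * r.
  have -> : 9 * d = \sum_(i < 3) \sum_(l < 3) d.
    by rewrite !sumr_const !card_ord -[d *+ 3]mulr_natl -mulr_natl; ring.
  apply: (@le_trans _ _ (\sum_(i < 3) \sum_(l < 3) d + (amps (W n) * amps (pert n) +
     (amps (pert n) * amps (W n) + amps (pert n) * amps (pert n))))).
    rewrite /amps !big_distrlr/= -!big_split/=; apply: ler_sum => i _.
    rewrite -!big_split/=; apply: ler_sum => l _.
    rewrite /crossz /approx tsum_qlist_catl !tsum_qlist_catr -addrA.
    by rewrite lerD ?Wd// lerD ?crossz_le// lerD ?crossz_le.
  rewrite lerD2l.
  have wn := We n; have p0 := amps_ge0 (pert n); have w0 := amps_ge0 (W n).
  have h1 : amps (W n) * amps (pert n) <= e * r by exact: ler_pM.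
  have h2 : amps (pert n) * amps (pert n) <= r * r by exact: ler_pM.
  by rewrite [amps (pert n) * amps (W n)]mulrC; lra.
have -> : r = r / 2 + r * 2^-1 by lra.
rewrite pertS /amps.
apply: (@le_trans _ _ (\sum_(j < 3) (12 / nu * (9 * d + (2 * e + r) * r)))).
  apply: ler_sum => j _; rewrite (le_trans (tsum_nonlinL_le _ _))//.
  exact: ler_wpM2l.
rewrite sumr_const card_ord -[X in X <= _]mulr_natl.
rewrite [X in X <= _](_ : _ = 36 / nu * (9 * d) + r * (36 / nu * (2 * e + r))).
  by rewrite lerD// ler_wpM2l.
by ring.
Qed.

Lemma amps_cat V V' : amps (fun i => V i ++ V' i) = amps V + amps V'.
Proof. by rewrite /amps -big_split; apply: eq_bigr => i _; exact: tsum_cat. Qed.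

Lemma amps_approx n : amps (approx n) <= e + r.
Proof. by rewrite amps_cat lerD ?amps_pert. Qed.

Lemma tsum_le_amps V j : tsum (@amp R) (V j) <= amps V.
Proof.
rewrite /amps (bigD1 j)//= lerDl sumr_ge0// => i _.
by apply: tsum_ge0; exact: amp_ge0.
Qed.

End scheme.

(** * Smoothness and weak form of finite sums *)

Lemma is_derive_addf (R : realType) (E : normedModType R) (f g : E -> R) (x v : E) (df dg : R) :
  is_derive x v f df -> is_derive x v g dg ->
  is_derive x v (fun y => f y + g y) (df + dg).
Proof. by move=> hf hg; exact: is_deriveD. Qed.

Lemma is_derive_mulf (R : realType) (E : normedModType R) (f g : E -> R) (x v : E) (df dg : R) :
  is_derive x v f df -> is_derive x v g dg ->
  is_derive x v (fun y => f y * g y) (df * g x + f x * dg).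
Proof.
move=> hf hg; apply: is_derive_eq.
by rewrite addrC /GRing.scale/= [g x * df]mulrC.
Qed.

Lemma derive_periodic (R : realType) (E : normedModType R) (v w : E) (g : E -> R) :
  periodic w g -> periodic w (fun z => 'D_v g z).
Proof.
move=> gp x; rewrite /derive.
have -> : (fun h : R => h^-1 *: ((g \o shift (x + w)) (h *: v) - g (x + w)))
    = (fun h : R => h^-1 *: ((g \o shift x) (h *: v) - g x)).
  by apply/funext => h /=; rewrite addrA !gp.
by [].
Qed.

Section smooth_lists.
Variable R : realType.
Notation term := (term R).
Variable Om : R.
Implicit Types (A : seq term).

Lemma evl_cons t A z : evl Om (t :: A) z = ev Om t z + evl Om A z.
Proof. exact: big_cons. Qed.

Lemma is_derive_evl o A z :
  is_derive z (stdir R o) (evl Om A) (evl Om (dlist Om o A) z).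
Proof.
elim: A => [|t A IH].
  have e : evl Om [::] = cst 0 by apply/funext => y; exact: big_nil.
  by rewrite [dlist _ _ _]/= e; exact: is_derive_cst.
have -> : evl Om (t :: A) = fun y => ev Om t y + evl Om A y.
  by apply/funext => y; exact: evl_cons.
rewrite [dlist _ _ _]/= evl_cons.
by apply: is_derive_addf => //; exact: is_derive_ev.
Qed.

Lemma evl_continuous A : continuous (evl Om A).
Proof. by apply: continuous_sumf => t; exact: ev_continuous. Qed.

Hypothesis Om0 : 0 < Om.
Definition per := 2 * pi / Om.

Lemma per_gt0 : 0 < per.
Proof. by rewrite divr_gt0// mulr_gt0// pi_gt0. Qed.

Lemma evl_periodic A : on_sttorus per (evl Om A).
Proof.
have Omn : Om != 0 by rewrite gt_eqF.
split => [i z|z]; apply: eq_bigr => t _.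
  by apply: (@ev_periodic _ _ _ _ _ _ (frq t i)); rewrite mulrC.
by apply: (@ev_periodic _ _ _ _ _ _ (tfrq t)); rewrite /per/= /nr; field.
Qed.

Notation J f := (\int[leb4 R]_(z in stcell per) f z).

(** Continuity is bundled because it supplies the integrability that the closure rules below
    require. *)
Definition null_int (f : spacetime R -> R) := continuous f /\ J f = 0.

Let per0 := ltW per_gt0.

Lemma null_intD f g : null_int f -> null_int g -> null_int (fun z => f z + g z).
Proof.
move=> [fc f0] [gc g0]; split; first exact: continuous_addf.
rewrite RintegralD ?f0 ?g0 ?addr0//; [exact: measurable_stcell|..];
 exact: integrable_stcell.
Qed.

Lemma null_intZ c f : null_int f -> null_int (fun z => c * f z).
Proof.
move=> [fc f0]; split.
  by apply: continuous_mulf => //; exact: continuous_cstf.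
rewrite RintegralZl ?f0 ?mulr0//; [exact: measurable_stcell|].
exact: integrable_stcell.
Qed.

Lemma null_int0 : null_int (fun=> 0).
Proof.
split; first exact: continuous_cstf.
by rewrite Rintegral_cst ?mul0r//; exact: measurable_stcell.
Qed.

Lemma null_int_sum (I : Type) (r : seq I) (F : I -> spacetime R -> R) :
  (forall i, null_int (F i)) -> null_int (fun z => \sum_(i <- r) F i z).
Proof.
move=> h; elim: r => [|i r IH].
  rewrite [X in null_int X](_ : _ = fun=> 0); first exact: null_int0.
  by apply/funext => z; rewrite big_nil.
rewrite [X in null_int X](_ : _ = fun z => F i z + \sum_(i <- r) F i z).
  exact: null_intD.
by apply/funext => z; rewrite big_cons.
Qed.

Lemma null_int_derive o (g g' : spacetime R -> R) :
  (forall x, is_derive x (stdir R o) g (g' x)) -> continuous g' ->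
  on_sttorus per g -> null_int g'.
Proof.
move=> gd g'c gp; split => //.
by rewrite /Rintegral (integral_derive_stcell per_gt0 gd g'c gp).
Qed.

Lemma on_sttorusM f g : on_sttorus per f -> on_sttorus per g ->
  on_sttorus per (fun z => f z * g z).
Proof.
by move=> [f1 f2] [g1 g2]; split => [i z|z]; rewrite ?f1 ?f2 ?g1 ?g2.
Qed.

Lemma null_int_deriveM o (f f' g g' : spacetime R -> R) :
  (forall x, is_derive x (stdir R o) f (f' x)) ->
  (forall x, is_derive x (stdir R o) g (g' x)) ->
  continuous f -> continuous g -> continuous f' -> continuous g' ->
  on_sttorus per f -> on_sttorus per g ->
  null_int (fun z => f' z * g z + f z * g' z).
Proof.
move=> fd gd fc gc f'c g'c fp gp.
apply: (@null_int_derive o (fun z => f z * g z)).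
- by move=> x; exact: is_derive_mulf.
- by apply: continuous_addf; exact: continuous_mulf.
- exact: on_sttorusM.
Qed.

Lemma null_int_lim (f : spacetime R -> R) (fn : nat -> spacetime R -> R) (err : nat -> R) :
  continuous f -> (forall n, null_int (fn n)) ->
  (forall n z, stcell per z -> `|f z - fn n z| <= err n) -> err @ \oo --> 0 -> null_int f.
Proof.
move=> fc hn he e0; split => //.
have mS := @measurable_stcell R per.
pose vol := fine (leb4 R (stcell per)).
have h n : `|J f| <= err n * vol.
  have [fnc fn0] := hn n.
  rewrite -[J f]subr0 -fn0 -RintegralB//; try exact: integrable_stcell.
  have dc : continuous (fun z => f z - fn n z) by exact: continuous_subf.
  rewrite (le_trans (le_normr_Rintegral _ _))//.
    exact: integrable_stcell.
  rewrite -Rintegral_cst//; apply: le_Rintegral => //.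
  - by apply: integrable_stcell => //; exact: continuous_normf.
  - by apply: integrable_stcell => //; exact: continuous_cstf.
  - by move=> z Sz; exact: he.
have c : (fun n => err n * vol) @ \oo --> 0 * vol.
  by apply: cvgM => //; exact: cvg_cst.
have : `|J f| <= 0 * vol.
  rewrite -(cvg_lim (@Rhausdorff R) c); apply: limr_ge.
    by apply/cvg_ex; eexists; exact: c.
  by near=> n; exact: h.
by rewrite mul0r normr_le0 => /eqP.
Unshelve. all: end_near. Qed.

Section test.
Variable phi : spacetime R -> R.
Hypothesis tphi : test_function per phi.

Lemma test_continuous : continuous phi.
Proof. by have [_ /(_ 0%N)[]] := tphi. Qed.

Lemma test_is_derive o x : is_derive x (stdir R o) phi ('D_(stdir R o) phi x).
Proof.
have [_ /(_ 1%N)[_ /(_ o)[h _]]] := tphi.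
by apply: DeriveDef => //; exact: h.
Qed.

Lemma test_derive o : test_function per (fun z => 'D_(stdir R o) phi z).
Proof.
have [[p1 p2] ck] := tphi; split.
  by split => [i|]; exact: derive_periodic.
by move=> k; have [_ /(_ o)[]] := ck k.+1.
Qed.

End test.
End smooth_lists.

Lemma uniform_limit_continuous (T : topologicalType) (R : realType)
    (f : T -> R) (fn : nat -> T -> R) (err : nat -> R) :
  (forall n, continuous (fn n)) -> (forall n z, `|f z - fn n z| <= err n) ->
  err @ \oo --> 0 -> continuous f.
Proof.
move=> fc he e0 x; apply/cvgrPdist_le => /= e ep.
have e3 : 0 < e / 3 by rewrite divr_gt0.
have /cvgrPdist_le/(_ _ e3)[N _ hN] := e0.
have hNN : err N <= e / 3.
  by have := hN N (leqnn N); rewrite /= sub0r normrN => /(le_trans (ler_norm _)).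
have /cvgrPdist_le/(_ _ e3) h := fc N x.
near=> y.
have h1 := he N x; have h2 := he N y.
have h3 : `|fn N x - fn N y| <= e / 3 by near: y.
have -> : f x - f y = (f x - fn N x) + (fn N x - fn N y) - (f y - fn N y) by ring.
rewrite (le_trans (ler_normB _ _))// (le_trans (lerD (ler_normD _ _) (lexx _)))//.
lra.
Unshelve. all: end_near. Qed.

Section weak_form.
Variable R : realType.
Notation term := (term R).
Variables (nu Om : R).
Hypothesis nu0 : 0 < nu.
Hypothesis Om0 : 0 < Om.
Implicit Types (A P : seq term).

Lemma evl_heat A z : evl Om (map (heat nu Om) A) z =
  evl Om (dlist Om None A) z
  - nu * \sum_i evl Om (dlist Om (Some i) (dlist Om (Some i) A)) z.
Proof.
rewrite /evl /dlist !tsum_map.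
under eq_bigr do rewrite !tsum_map.
rewrite -tsum_sum -tsumZ -tsumN -tsumD; apply: eq_bigr => t _ /=.
have [J E] : exists J, forall p q, ev Om (mulc p q t) z = p * ev Om t z + q * J.
  by eexists => p q; exact: ev_mulc.
rewrite (eq_bigr (fun i => - kr t i ^+ 2 * ev Om t z)).
  rewrite /heat !E -mulr_suml sumrN -/(ksq t) /hX /hY; ring.
move=> i _; rewrite -/(kr t i) mulcM E /=; ring.
Qed.

Lemma list_deriveM (B : seq term) o psi : test_function (per Om) psi ->
  null_int Om (fun z => evl Om (dlist Om o B) z * psi z +
    evl Om B z * 'D_(stdir R o) psi z).
Proof.
move=> tpsi; apply: (@null_int_deriveM _ _ Om0 o).
- by move=> x; exact: is_derive_evl.
- by move=> x; exact: test_is_derive tpsi _ _.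
- exact: evl_continuous.
- exact: test_continuous tpsi.
- exact: evl_continuous.
- exact: test_continuous (test_derive tpsi o).
- exact: evl_periodic.
- by case: tpsi.
Qed.

Lemma weak_list A (Q : 'I_3 -> seq term) P (F : spacetime R -> R) phi j :
  (forall z, evl Om (map (heat nu Om) A) z +
     \sum_i evl Om (dlist Om (Some i) (Q i)) z +
     evl Om (dlist Om (Some j) P) z = F z) ->
  test_function (per Om) phi ->
  null_int Om (fun z => - (evl Om A z * dt phi z)
    - (\sum_i evl Om (Q i) z * dx i phi z)
    - nu * evl Om A z * laplacian phi z - evl Om P z * dx j phi z - F z * phi z).
Proof.
move=> eqF tphi.
have base := list_deriveM.
have tc o : test_function (per Om) (fun z => 'D_(stdir R o) phi z).
  exact: test_derive.
(* Each derivative is moved onto the test function by one total derivative. The Laplacian takes two,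
   [N4] and [N5], whose mixed gradient products cancel; the terms containing [phi] itself assemble
   to [F * phi] by the equation. *)
have N1 := null_intZ Om0 (-1) (base A None _ tphi).
have N2 := null_intZ Om0 (-1) (null_int_sum Om0 (index_enum 'I_3)
   (fun i => base (Q i) (Some i) _ tphi)).
have N3 := null_intZ Om0 (-1) (base P (Some j) _ tphi).
have N4 := null_intZ Om0 (- nu) (null_int_sum Om0 (index_enum 'I_3)
   (fun i => base A (Some i) _ (tc (Some i)))).
have N5 := null_intZ Om0 nu (null_int_sum Om0 (index_enum 'I_3)
   (fun i => base (dlist Om (Some i) A) (Some i) _ tphi)).
have := null_intD Om0 (null_intD Om0 (null_intD Om0 (null_intD Om0 N1 N2) N3) N4) N5.
congr null_int; apply/funext => z.
rewrite -eqF evl_heat /laplacian /dx /dt !big_split/= -!mulr_suml -mulr_sumr.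
set s1 := \sum_i evl Om (dlist Om (Some i) (Q i)) z.
set s2 := \sum_i evl Om (Q i) z * _.
set s3 := \sum_i evl Om (dlist Om (Some i) A) z * _.
set s4 := \sum_i 'D_(dir R i, 0) _ z.
set s5 := \sum_i evl Om (dlist Om (Some i) (dlist Om (Some i) A)) z.
ring.
Qed.

End weak_form.

(** * Mean values over the spatial period cell *)

Section int3.
Variable R : realType.
Implicit Types (f g : space R -> R).

Definition int3 f : R := \int[leb3 R]_(x in @cube R) f x.

Let mC : measurable (@cube R : set (measurableTypeR R * measurableTypeR R * measurableTypeR R)).
Proof. exact: measurable_cube. Qed.

Lemma int3D f g : continuous f -> continuous g ->
  int3 (fun x => f x + g x) = int3 f + int3 g.
Proof. by move=> fc gc; rewrite /int3 RintegralD//; exact: integrable_cube. Qed.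

Lemma int3B f g : continuous f -> continuous g ->
  int3 (fun x => f x - g x) = int3 f - int3 g.
Proof. by move=> fc gc; rewrite /int3 RintegralB//; exact: integrable_cube. Qed.

Lemma int3Z c f : continuous f -> int3 (fun x => c * f x) = c * int3 f.
Proof. by move=> fc; rewrite /int3 RintegralZl//; exact: integrable_cube. Qed.

Lemma int3_cst c : int3 (fun=> c) = c * (2 * pi) ^+ 3.
Proof. by rewrite /int3 Rintegral_cst// leb3_cube. Qed.

Lemma le_int3 f g : continuous f -> continuous g ->
  (forall x, cube x -> f x <= g x) -> int3 f <= int3 g.
Proof. by move=> fc gc h; apply: le_Rintegral => //; exact: integrable_cube. Qed.

Lemma int3_norm f c : continuous f -> (forall x, cube x -> `|f x| <= c) ->
  `|int3 f| <= c * (2 * pi) ^+ 3.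
Proof.
move=> fc h; rewrite ler_norml -int3_cst -mulN1r -int3Z; last exact: continuous_cstf.
apply/andP; split; apply: le_int3 => //; try exact: continuous_cstf;
 by move=> x /h; rewrite ler_norml => /andP[]; lra.
Qed.

Lemma int3_sum (I : Type) (r : seq I) (F : I -> space R -> R) :
  (forall i, continuous (F i)) ->
  int3 (fun x => \sum_(i <- r) F i x) = \sum_(i <- r) int3 (F i).
Proof.
move=> Fc; elim: r => [|i r IH].
  rewrite big_nil (_ : (fun x => _) = fun=> 0); first by rewrite int3_cst mul0r.
  by apply/funext => x; rewrite big_nil.
rewrite big_cons -IH -int3D//; last exact: continuous_sumf.
by congr int3; apply/funext => x; rewrite big_cons.
Qed.

Lemma int3_derive i (g g' : space R -> R) :
  (forall x, is_derive x (dir R i) g (g' x)) -> continuous g' -> on_torus g ->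
  int3 g' = 0.
Proof. by move=> h1 h2 h3; rewrite /int3 /Rintegral (integral_derive_cube h1). Qed.

Lemma le0_of_cvg (a : R) (err : nat -> R) :
  (forall n, a <= err n) -> err @ \oo --> 0 -> a <= 0.
Proof.
move=> h e0; rewrite -(cvg_lim (@Rhausdorff R) e0); apply: limr_ge.
  by apply/cvg_ex; eexists; exact: e0.
by near=> n; exact: h.
Unshelve. all: end_near. Qed.

Lemma int3_lim0 f (fn : nat -> space R -> R) (err : nat -> R) :
  continuous f -> (forall n, continuous (fn n)) -> (forall n, int3 (fn n) = 0) ->
  (forall n x, cube x -> `|f x - fn n x| <= err n) -> err @ \oo --> 0 ->
  int3 f = 0.
Proof.
move=> fc fnc f0 he e0.
apply/eqP; rewrite -normr_le0.
apply: (@le0_of_cvg _ (fun n => err n * (2 * pi) ^+ 3)).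
  move=> n; rewrite -[int3 f]subr0 -(f0 n) -int3B//.
  by apply: int3_norm; [exact: continuous_subf|exact: he].
by rewrite -(mul0r ((2 * pi) ^+ 3)); apply: cvgM => //; exact: cvg_cst.
Qed.

End int3.

Section list_mean.
Variable R : realType.
Variable Om : R.

Lemma int3_ev (t : term R) tau : ksq t != 0 -> int3 (fun x => ev Om t (x, tau)) = 0.
Proof.
move=> /kr_neq0[i ki].
(* An antiderivative of [t] in a direction where its frequency is nonzero. *)
pose u := mulc 0 (- (kr t i)^-1) t.
have e z : ev Om (mulc 0 (dfrq Om u (Some i)) u) z = ev Om t z.
  by rewrite mulcM ev_mulc /= -[kr u i]/(kr t i); field.
apply: (@int3_derive _ i (fun x => ev Om u (x, tau))).
- move=> x; rewrite -e.
  apply: (@is_derive_pullback _ _ _ (fun x => (x, tau)) _ _ _ (stdir R (Some i))) => [h|].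
    by congr (_, _); rewrite /= scaler0 add0r.
  exact: is_derive_ev.
- apply: continuous_pair1; exact: ev_continuous.
- move=> l x.
  have := @ev_periodic _ Om u (Some l) (2 * pi) (x, tau) (frq t l).
  rewrite mulrC => /(_ erefl) <-; congr (ev _ _ (_, _)).
  by rewrite /= scaler0 addr0.
Qed.

Lemma int3_evl_nonlinL nu (V : 'I_3 -> seq (term R)) j tau :
  int3 (fun x => evl Om (nonlinL nu Om V j) (x, tau)) = 0.
Proof.
have -> : (fun x => evl Om (nonlinL nu Om V j) (x, tau)) = fun x =>
   \sum_i \sum_l \sum_(t <- qlist (V i) (V l)) ev Om (nonlin nu Om j i l t) (x, tau).
  by apply/funext => x; rewrite /evl tsum_nonlinL.
have c t : continuous (fun x : space R => ev Om t (x, tau)).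
  by apply: continuous_pair1; exact: ev_continuous.
rewrite int3_sum => [|i]; last by do 2 apply: continuous_sumf => ?.
rewrite big1// => i _; rewrite int3_sum => [|l]; last by apply: continuous_sumf => ?.
rewrite big1// => l _; rewrite int3_sum// big1// => t _.
have [k0|k0] := eqVneq (ksq t) 0; last exact: int3_ev.
rewrite (_ : (fun x => _) = fun=> 0); first by rewrite int3_cst mul0r.
apply/funext => x; apply/eqP; rewrite -normr_le0 (le_trans (normr_ev _ _ _))//.
by rewrite amp_nonlin_ksq0.
Qed.

End list_mean.

(** * Passage to the limit *)

Lemma evl_qlist (R : realType) (Om : R) (A B : seq (term R)) z :
  evl Om (qlist A B) z = evl Om A z * evl Om B z.
Proof.
rewrite /evl tsum_qlist /tsum mulr_suml; apply: eq_bigr => t _.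
rewrite mulr_sumr; apply: eq_bigr => u _; exact: ev_tprod.
Qed.

Lemma evl_cat (R : realType) (Om : R) (A B : seq (term R)) z :
  evl Om (A ++ B) z = evl Om A z + evl Om B z.
Proof. exact: tsum_cat. Qed.

Lemma cell_bound (R : realType) (T : R) (f : spacetime R -> R) : continuous f ->
  exists2 C, 0 <= C & forall z, stcell T z -> `|f z| <= C.
Proof.
move=> fc; have [M [_ h]] := compact_continuous_bounded (@compact_stcell R T) fc.
exists (`|M| + 1); first by rewrite addr_ge0.
by apply: h; rewrite ltr_pwDr// ler_norm.
Qed.

(** Three squares of size [c^2] add up to at most [(3 c)^2]. The crude 3 in place of the square root
    of 3 enters the final constant. *)
Lemma Linfty_norm_le (R : realType) (T : R) (v : stfield R) c :
  (forall j z, `|v j z| <= c) -> (Linfty_norm T v <= (3 * c)%:E)%E.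
Proof.
move=> h.
have c0 : 0 <= 3 * c by rewrite mulr_ge0// (le_trans (normr_ge0 _) (h ord0 0)).
rewrite /Linfty_norm unlock; case: ifPn => // _.
apply/ess_supP; apply: aeW => z /=.
rewrite patchE; case: ifPn => _; last by rewrite /= normr0 lee_fin.
rewrite /= lee_fin ger0_norm ?sqrtr_ge0//.
rewrite -(ler_sqr _ _) ?nnegrE ?sqrtr_ge0// sqr_sqrtr; last first.
  by apply: sumr_ge0 => j _; exact: sqr_ge0.
have le j : v j z ^+ 2 <= c ^+ 2.
  rewrite -real_normK ?num_real// lerXn2r// ?nnegrE ?h//.
  exact: le_trans (normr_ge0 _) (h j z).
rewrite (le_trans (ler_sum _ (fun j _ => le j)))//.
rewrite sumr_const card_ord -[X in X <= _]mulr_natl exprMn ler_wpM2r ?sqr_ge0//.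
by rewrite -natrX ler_nat.
Qed.

Lemma cvg_sum0 (R : realType) (I : Type) (s : seq I) (u : I -> nat -> R) :
  (forall i, u i @ \oo --> 0) -> (fun n => \sum_(i <- s) u i n) @ \oo --> 0.
Proof.
move=> h; elim: s => [|i s IH].
  rewrite (_ : (fun n => _) = fun=> 0); first exact: cvg_cst.
  by apply/funext => n; rewrite big_nil.
rewrite (_ : (fun n => _) = fun n => u i n + \sum_(j <- s) u j n).
  by rewrite -[X in _ --> X](addr0 (0 : R)); apply: cvgD.
by apply/funext => n; rewrite big_cons.
Qed.

Section assembly.
Variable R : realType.
Variables (nu Om : R).
Hypothesis nu0 : 0 < nu.
Hypothesis Om0 : 0 < Om.
Variable W : nat -> 'I_3 -> seq (term R).
Hypothesis Wmono : forall n j, leL (W n j) (W n.+1 j).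
Variables (e d r b : R) (bn fe : nat -> R).
Hypothesis We : forall n, amps (W n) <= e.
Hypothesis Wd : forall n i l, crossz (W n i) (W n l) <= d.
Hypothesis rd : 36 / nu * (9 * d) <= r / 2.
Hypothesis re : 36 / nu * (2 * e + r) <= 2^-1.
Hypothesis r0 : 0 <= r.
Hypothesis Wmean : forall n j tau, int3 (fun x => evl Om (W n j) (x, tau)) = 0.
Hypothesis Wdiv : forall n z, \sum_j evl Om (dlist Om (Some j) (W n j)) z = 0.
Hypothesis Wb : forall n j z, `|evl Om (W n j) z| <= bn n.
Hypothesis bnb : bn @ \oo --> b.
Variable Phi : R -> space R -> 'I_3 -> R.
Hypothesis WPhi : forall n j z,
  `|Phi z.2 z.1 j - evl Om (map (heat nu Om) (W n j)) z| <= fe n.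
Hypothesis fe0 : fe @ \oo --> 0.

Notation T := (per Om).
Notation cell := (@stcell R).

Let V n := approx nu Om W n.

Let ampsV n : amps (V n) <= e + r.
Proof. exact: (amps_approx Om nu0 We Wd rd re r0). Qed.

Let ampV n j : tsum (@amp R) (V n j) <= e + r.
Proof. exact: le_trans (tsum_le_amps _ _) (ampsV n). Qed.

Let list_limit (A : nat -> seq (term R)) M :
  (forall n, leL (A n) (A n.+1)) -> (forall n, tsum (@amp R) (A n) <= M) ->
  exists p : (nat -> R) * (spacetime R -> R), p.1 @ \oo --> 0 /\
   forall n z, `|p.2 z - evl Om (A n) z| <= p.1 n.
Proof.
move=> h1 h2; have [err e0 h] := monotone_list_cvg h1 h2.
have /choice[f hf] : forall z, exists l, forall n, `|l - evl Om (A n) z| <= err n.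
  by move=> z; apply: h => t; exact: normr_ev.
by exists (err, f).
Qed.

Lemma evl_le_amp A z : `|evl Om A z| <= tsum (@amp R) A.
Proof. by apply: ler_norm_tsum => t; exact: normr_ev. Qed.

Let tail_cvg (u : nat -> R) : u @ \oo --> 0 -> (fun n => u n.+1) @ \oo --> 0.
Proof. by move=> h; rewrite -(cvg_shiftS u) in h. Qed.

(** Bounded monotone amplitude sums make the approximations of velocity and pressure converge
    uniformly. The limits are continuous, so measurability and integrability are immediate, and
    every clause of the weak formulation is a limit of vanishing integrals. *)
Lemma ns_of_drive : exists2 v : stfield R,
  periodic_NS_solution nu T Phi v & forall j z, `|v j z| <= b + r.
Proof.
have /choice[pv hv] : forall j, exists p : (nat -> R) * (spacetime R -> R),
    p.1 @ \oo --> 0 /\ forall n z, `|p.2 z - evl Om (V n j) z| <= p.1 n.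
  move=> j; apply: (@list_limit _ (e + r)) => n; last exact: ampV.
  exact: approx_mono.
have [[perr p] /= [perr0 hp]] : exists p : (nat -> R) * (spacetime R -> R),
    p.1 @ \oo --> 0 /\ forall n z, `|p.2 z - evl Om (pressL (V n)) z| <= p.1 n.
  apply: (@list_limit _ ((e + r) ^+ 2)) => n.
    by apply: leL_pressL => i; exact: approx_mono.
  rewrite (le_trans (tsum_pressL_le _))//.
  by rewrite lerXn2r// ?nnegrE ?amps_ge0// (le_trans (amps_ge0 _) (ampsV 0)).
pose v j := (pv j).2.
pose eps n := \sum_j (pv j).1 n.
have pv_ge0 j n : 0 <= (pv j).1 n by exact: le_trans (normr_ge0 _) ((hv j).2 n 0).
have eps0 : eps @ \oo --> 0.
  by apply: cvg_sum0 => i; case: (hv i).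
have hveps j n z : `|v j z - evl Om (V n j) z| <= eps n.
  rewrite (le_trans ((hv j).2 n z))// /eps (bigD1 j)//= lerDl.
  by apply: sumr_ge0 => i _.
have vc j : continuous (v j).
  apply: (@uniform_limit_continuous _ _ _ (fun n => evl Om (V n j)) eps) => // n.
  exact: evl_continuous.
have pc : continuous p.
  apply: (@uniform_limit_continuous _ _ _ (fun n => evl Om (pressL (V n))) perr) => // n.
  exact: evl_continuous.
have Phic j : continuous (fun z : spacetime R => Phi z.2 z.1 j).
  apply: (@uniform_limit_continuous _ _ _ (fun n => evl Om (map (heat nu Om) (W n j))) fe) => // n.
  exact: evl_continuous.
have T0 : 0 < T by exact: per_gt0.
pose M := e + r.
have M0 : 0 <= M by exact: le_trans (amps_ge0 _) (ampsV 0).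
have VM n j z : `|evl Om (V n j) z| <= M.
  exact: le_trans (evl_le_amp _ _) (ampV n j).
(* The drive part enters through its pointwise bound [bn], because its amplitude sum [e] is not of
   order 1 / Om. Only the perturbation is bounded by amplitudes. *)
have vbound j z : `|v j z| <= b + r.
  rewrite -subr_le0; apply: (@le0_of_cvg _ _ (fun n => eps n + (bn n - b))).
    move=> n; have h1 := hveps j n z.
    have h2 : `|evl Om (V n j) z| <= bn n + r.
      rewrite /evl /V /approx tsum_cat (le_trans (ler_normD _ _))// lerD ?Wb//.
      rewrite (le_trans (evl_le_amp _ _))// (le_trans (tsum_le_amps _ _))//.
      exact: (amps_pert Om nu0 We Wd rd re r0).
    have : `|v j z| <= `|v j z - evl Om (V n j) z| + `|evl Om (V n j) z|.
      by rewrite -[X in `|X| <= _](subrK (evl Om (V n j) z)) ler_normD.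
    lra.
  rewrite -[X in _ --> X](addr0 (0 : R)); apply: cvgD => //.
  by rewrite -(subrr b); apply: cvgB => //; exact: cvg_cst.
have vper j : on_sttorus T (v j).
  have key (z w : spacetime R) : (forall n, evl Om (V n j) (z + w) = evl Om (V n j) z) ->
      v j (z + w) = v j z.
    move=> h; apply/eqP; rewrite -subr_eq0 -normr_le0.
    apply: (@le0_of_cvg _ _ (fun n => eps n + eps n)).
      move=> n; have h1 := hveps j n (z + w); have h2 := hveps j n z.
      rewrite h in h1.
      rewrite (_ : v j (z + w) - v j z = (v j (z + w) - evl Om (V n j) z)
         - (v j z - evl Om (V n j) z)); last by ring.
      by rewrite (le_trans (ler_normB _ _))// lerD.
    by rewrite -[X in _ --> X](addr0 (0 : R)); exact: cvgD.
  split => [i z|z]; apply: key => n.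
    by have [h1 _] := evl_periodic Om0 (V n j); exact: h1.
  by have [_ h2] := evl_periodic Om0 (V n j); exact: h2.
have JZ f g : continuous f -> continuous g ->
    \int[leb4 R]_(z in cell T) (f z - g z) =
    \int[leb4 R]_(z in cell T) f z - \int[leb4 R]_(z in cell T) g z.
  move=> fc gc; rewrite RintegralB//; [exact: measurable_stcell|..];
   by apply: integrable_stcell => //; exact: ltW.
have Vdiv n z : \sum_j evl Om (dlist Om (Some j) (V n j)) z = 0.
  rewrite (eq_bigr (fun j => evl Om (dlist Om (Some j) (W n j)) z +
    evl Om (dlist Om (Some j) (pert nu Om W n j)) z)).
    rewrite big_split/= Wdiv add0r; case: n => [|n]; last exact: nonlinL_div.
    by rewrite big1// => j _; rewrite /evl /tsum big_nil.
  by move=> j _; rewrite /dlist map_cat evl_cat.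
exists v => //; split.
- by move=> j; split => //; apply: continuous_measurable4.
- by rewrite (le_lt_trans (Linfty_norm_le T vbound))// ltry.
- move=> phi tphi.
  have pd i : continuous (dx i phi) := test_continuous (test_derive tphi (Some i)).
  have /choice[C hC] : forall i, exists C, 0 <= C /\ forall z, cell T z -> `|dx i phi z| <= C.
    by move=> i; have [C C0 h] := @cell_bound _ T _ (pd i); exists C.
  suff [] : null_int Om (fun z => \sum_i v i z * dx i phi z) by [].
  apply: (@null_int_lim _ _ Om0 _ (fun n z => \sum_i evl Om (V n i) z * dx i phi z)
     (fun n => \sum_i (eps n * C i))).
  + by apply: continuous_sumf => i; exact: continuous_mulf.
  + move=> n.
    have := null_int_sum Om0 (index_enum 'I_3) (fun i => list_deriveM Om0 (V n i) (Some i) tphi).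
    congr null_int; apply/funext => z.
    by rewrite big_split/= -mulr_suml Vdiv mul0r add0r.
  + move=> n z Sz; rewrite -sumrB (le_trans (ler_norm_sum _ _ _))//.
    apply: ler_sum => i _; rewrite -mulrBl normrM ler_pM//.
    by have [_] := hC i; exact.
  + apply: cvg_sum0 => i.
    by rewrite -(mul0r (C i)); apply: cvgM => //; exact: cvg_cst.
- apply: aeW => tau j.
  apply: (@int3_lim0 _ (fun x => v j (x, tau)) (fun n x => evl Om (V n j) (x, tau)) eps) => //.
  + exact: continuous_pair1.
  + by move=> n; apply: continuous_pair1; exact: evl_continuous.
  + move=> n; rewrite (_ : (fun x => _) = fun x => evl Om (W n j) (x, tau) +
       evl Om (pert nu Om W n j) (x, tau)); last first.
      by apply/funext => x; rewrite /V /approx evl_cat.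
    rewrite int3D; try by apply: continuous_pair1; exact: evl_continuous.
    rewrite Wmean add0r; case: n => [|n]; last exact: int3_evl_nonlinL.
    rewrite (_ : (fun x => _) = fun=> 0); first by rewrite int3_cst mul0r.
    by apply/funext => x; rewrite /evl /tsum big_nil.
(* The pressure is integration against a continuous function, hence a distribution of order zero:
   [N] is 0 and [K] is a bound for the function times the volume of the cell. *)
- exists (fun phi => \int[leb4 R]_(z in cell T) (p z * phi z)).
    have pint phi : test_function T phi -> (leb4 R).-integrable (cell T)
        (EFin \o (fun z => p z * phi z)).
      move=> tphi; apply: integrable_stcell; first exact: ltW.
      by apply: continuous_mulf => //; exact: test_continuous tphi.
    have mS := @measurable_stcell R T.
    split.
      move=> a phi psi tphi tpsi.
      rewrite -RintegralZl//; last exact: pint.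
      rewrite -RintegralD//; last 2 first.
      + apply: integrable_stcell; first exact: ltW.
        apply: continuous_mulf; first exact: continuous_cstf.
        by apply: continuous_mulf => //; exact: test_continuous tphi.
      + exact: pint.
      by apply: eq_Rintegral => z _; ring.
    have [C C0 hC] := @cell_bound _ T _ pc.
    exists (C * fine (leb4 R (cell T))), 0%N => phi tphi N hN.
    have phc := test_continuous tphi.
    rewrite (le_trans (le_normr_Rintegral mS (pint _ tphi)))//.
    rewrite mulrAC -Rintegral_cst//; apply: le_Rintegral => //.
    + apply: integrable_stcell; first exact: ltW.
      by apply: continuous_normf; exact: continuous_mulf.
    + by apply: integrable_stcell; [exact: ltW|exact: continuous_cstf].
    + move=> z Sz; rewrite normrM ler_pM// ?hC//.
      by have := hN [::] isT z.
  move=> phi j tphi.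
  have phc := test_continuous tphi.
  have pd o : continuous (fun z => 'D_(stdir R o) phi z) := test_continuous (test_derive tphi o).
  have lc : continuous (laplacian phi).
    apply: continuous_sumf => i.
    exact: test_continuous (test_derive (test_derive tphi (Some i)) (Some i)).
  have [C1 C10 hC1] := @cell_bound _ T _ phc.
  have [C2 C20 hC2] := @cell_bound _ T _ lc.
  have [C3 C30 hC3] := @cell_bound _ T _ (pd None).
  have /choice[D hD] : forall i, exists D, 0 <= D /\ forall z, cell T z -> `|dx i phi z| <= D.
    by move=> i; have [D D0 h] := @cell_bound _ T _ (pd (Some i)); exists D.
  have eps_ge0 n : 0 <= eps n by apply: sumr_ge0.
  have vj := vc j.
  have contI : continuous (fun z => - (v j z * dt phi z)
      - (\sum_i v i z * v j z * dx i phi z) - nu * v j z * laplacian phi z).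
    apply: continuous_subf; first apply: continuous_subf.
    - by apply: continuous_oppf; apply: continuous_mulf => //; exact: pd.
    - apply: continuous_sumf => i; apply: continuous_mulf; last exact: (pd (Some i)).
      exact: continuous_mulf.
    - by do 2 apply: continuous_mulf => //; exact: continuous_cstf.
  have contP : continuous (fun z => p z * dx j phi z).
    by apply: continuous_mulf => //; exact: (pd (Some j)).
  have contF : continuous (fun z : spacetime R => Phi z.2 z.1 j * phi z).
    exact: continuous_mulf.
  suff [_] : null_int Om (fun z => - (v j z * dt phi z)
      - (\sum_i v i z * v j z * dx i phi z) - nu * v j z * laplacian phi z
      - p z * dx j phi z - Phi z.2 z.1 j * phi z).
    rewrite JZ//; last exact: continuous_subf.
    by rewrite JZ// => /eqP; rewrite subr_eq0 => /eqP.
  pose B := b + r + M.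
  (* The indices [n.+1] and [n] are mixed on purpose: [V n.+1] solves exactly the linear equation
     whose quadratic source and pressure are built from [V n]. *)
  apply: (@null_int_lim _ _ Om0 _ (fun n z => - (evl Om (V n.+1 j) z * dt phi z)
    - (\sum_i evl Om (qlist (V n i) (V n j)) z * dx i phi z)
    - nu * evl Om (V n.+1 j) z * laplacian phi z
    - evl Om (pressL (V n)) z * dx j phi z
    - evl Om (map (heat nu Om) (W n.+1 j)) z * phi z)
    (fun n => eps n.+1 * C3 + \sum_i (B * eps n) * D i + nu * eps n.+1 * C2
      + perr n * D j + fe n.+1 * C1)).
  + by apply: continuous_subf => //; exact: continuous_subf.
  + move=> n; apply: weak_list => // z.
    rewrite -[V n.+1 j]/(W n.+1 j ++ nonlinL nu Om (V n) j) map_cat evl_cat.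
    by rewrite heat_nonlinL//; ring.
  + move=> n z Sz.
    set a := evl Om (V n.+1 j) z; set s1 := \sum_i v i z * v j z * dx i phi z.
    set s2 := \sum_i evl Om (qlist (V n i) (V n j)) z * dx i phi z.
    rewrite [X in `|X| <= _](_ : _ = - ((v j z - a) * dt phi z) - (s1 - s2)
       - (nu * (v j z - a)) * laplacian phi z
       - (p z - evl Om (pressL (V n)) z) * dx j phi z
       - (Phi z.2 z.1 j - evl Om (map (heat nu Om) (W n.+1 j)) z) * phi z); last by ring.
    have va : `|v j z - a| <= eps n.+1 by exact: hveps.
    have tri (x y x' y' : R) : `|x| <= x' -> `|y| <= y' -> `|x - y| <= x' + y'.
      by move=> h1 h2; rewrite (le_trans (ler_normB _ _))// lerD.
    have mul (x y x' y' : R) : `|x| <= x' -> `|y| <= y' -> `|x * y| <= x' * y'.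
      by move=> h1 h2; rewrite normrM ler_pM.
    apply: (tri); first apply: (tri); first apply: (tri); first apply: (tri).
    - by rewrite normrN; apply: (mul) => //; exact: hC3.
    - rewrite /s1 /s2 -sumrB (le_trans (ler_norm_sum _ _ _))//.
      apply: ler_sum => i _; rewrite -mulrBl; apply: (mul); last first.
        by have [_] := hD i; exact.
      rewrite evl_qlist.
      rewrite (_ : _ - _ = v i z * (v j z - evl Om (V n j) z) -
        - ((v i z - evl Om (V n i) z) * evl Om (V n j) z)); last by ring.
      rewrite (_ : B * eps n = (b + r) * eps n + eps n * M); last by rewrite /B; ring.
      by apply: (tri); rewrite ?normrN; apply: (mul).
    - by apply: (mul); [apply: (mul) => //; rewrite gtr0_norm|exact: hC2].
    - by apply: (mul); [exact: hp|have [_] := hD j; exact].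
    - by apply: (mul); [exact: WPhi|exact: hC1].
  + have c0 (u : nat -> R) c : u @ \oo --> 0 -> (fun n => u n * c) @ \oo --> 0.
      by move=> u0; rewrite -(mul0r c); apply: cvgM => //; exact: cvg_cst.
    have d0 (u w : nat -> R) : u @ \oo --> 0 -> w @ \oo --> 0 ->
        (fun n => u n + w n) @ \oo --> 0.
      by move=> u0 w0; rewrite -[X in _ --> X](addr0 (0 : R)); exact: cvgD.
    have cl (u : nat -> R) c : u @ \oo --> 0 -> (fun n => c * u n) @ \oo --> 0.
      by move=> u0; rewrite -(mulr0 c); apply: cvgM => //; exact: cvg_cst.
    have epsS := tail_cvg eps0; have feS := tail_cvg fe0.
    apply: (d0); [apply: (d0); [apply: (d0); [apply: (d0)|]|]|]; try (by apply: (c0)).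
    + by apply: cvg_sum0 => i; apply: (c0); exact: cl.
    + by apply: (c0); exact: cl.
Qed.

End assembly.

(** * Maximum principle *)

Lemma derive_gt0_right (R : realType) (h : R -> R) (x d : R) :
  is_derive x (1 : R) h d -> 0 < d ->
  exists2 e, 0 < e & forall s, 0 < s < e -> h x < h (x + s).
Proof.
move=> [hd hD] d0.
have : (fun k => k^-1 *: ((h \o shift x) (k *: (1 : R)) - h x)) @ 0^' --> d.
  by rewrite -hD; exact: hd.
move=> /cvgrPdist_lt/(_ _ d0)[e /= e0 he].
exists e => // s /andP[s0 se].
have := he s; rewrite /ball_/= sub0r normrN gtr0_norm// => /(_ se).
rewrite gt_eqF// => /(_ isT).
rewrite /GRing.scale/= mulr1 [s + x]addrC => hs.
have : 0 < s^-1 * (h (x + s) - h x).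
  by move: hs; rewrite ltr_norml => /andP[_]; lra.
by rewrite pmulr_rgt0 ?invr_gt0// subr_gt0.
Qed.

(** If [h2] were positive, [h1] would be positive just to the right of 0, and the mean value theorem
    would lift [h] above its maximum. *)
Lemma second_derivative_at_max (R : realType) (h h1 : R -> R) (h2 e : R) : 0 < e ->
  (forall s, is_derive s (1 : R) h (h1 s)) -> is_derive (0 : R) (1 : R) h1 h2 ->
  (forall s, `|s| < e -> h s <= h 0) -> h1 0 = 0 /\ h2 <= 0.
Proof.
move=> e0 hd h1d hmax.
have h10 : h1 0 = 0.
  have hdv : is_derive (0 : R) (1 : R) h 0.
    apply: (@derive1_at_max _ h (- e) e 0).
    - lra.
    - by move=> t _; case: (hd t).
    - by rewrite in_itv/=; lra.
    - by move=> t; rewrite in_itv/= -ltr_norml; exact: hmax.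
  by have [_ <-] := hd 0; have [_ ->] := hdv.
split => //; rewrite leNgt; apply/negP => h20.
have [e' e'0 he'] := derive_gt0_right h1d h20.
pose s := Num.min e e' / 2.
have s0 : 0 < s by rewrite divr_gt0// lt_min e0.
have se : s < e by rewrite /s ltr_pdivrMr// (le_lt_trans (y := e))// ?ge_min ?lexx// ltr_pMr// ltr1n.
have se' : s < e' by rewrite /s ltr_pdivrMr// (le_lt_trans (y := e'))// ?ge_min ?lexx ?orbT// ltr_pMr// ltr1n.
have hc : {within `[0, s], continuous h}.
  apply: continuous_subspaceT => x.
  by apply/differentiable_continuous/derivable1_diffP; case: (hd x).
have [c] := MVT s0 (fun x _ => hd x) hc.
rewrite in_itv/= subr0 => /andP[c0 cs] hE.
have := hmax s; rewrite gtr0_norm// => /(_ se).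
rewrite -subr_le0 hE pmulr_lle0// leNgt => /negP; apply.
by rewrite -h10 -[c]add0r; apply: he'; rewrite c0 (lt_trans cs).
Qed.

Lemma periodic_int (R : realType) (E : normedModType R) (w : E) (g : E -> R) :
  periodic w g -> forall (m : int) x, g (x + m%:~R *: w) = g x.
Proof.
move=> gp.
have nat_case n x : g (x + n%:R *: w) = g x.
  elim: n => [|n IH]; first by rewrite scale0r addr0.
  by rewrite -addn1 natrD scalerDl scale1r addrA gp IH.
case=> n x; first exact: nat_case.
rewrite NegzE mulrNz scaleNr.
by have := nat_case n.+1 (x - n.+1%:R *: w); rewrite subrK => <-.
Qed.

Lemma floor_reduce (R : realType) (p x : R) : 0 < p ->
  0 <= x - (Num.floor (x / p))%:~R * p <= p.
Proof.
move=> p0; have /andP[h1 h2] := floor_itv (x / p).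
move: h1; rewrite ler_pdivlMr// => h1.
move: h2; rewrite ltr_pdivrMr// intrD mulrDl mul1r => h2.
by apply/andP; split; lra.
Qed.

Lemma sttorus_reduce (R : realType) (T : R) (z : spacetime R) : 0 < T ->
  exists2 z', stcell T z' & forall f, on_sttorus T f -> f z' = f z.
Proof.
move=> T0; have tp : 0 < 2 * pi :> R by rewrite mulr_gt0// pi_gt0.
pose m i : int := - Num.floor (coord i z.1 / (2 * pi)).
pose mt : int := - Num.floor (z.2 / T).
exists (z + (m ord0)%:~R *: ((2 * pi) *: stdir R (Some ord0))
          + (m (inord 1))%:~R *: ((2 * pi) *: stdir R (Some (inord 1)))
          + (m (inord 2))%:~R *: ((2 * pi) *: stdir R (Some (inord 2)))
          + mt%:~R *: (T *: stdir R None)).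
  split => [i|] /=.
    rewrite !coordD !coordZ !coord_dir.
    have red := floor_reduce (coord i z.1) tp.
    have c0 : coord i (0 : space R) = 0 by rewrite /coord; case: i {red} => -[|[|[|//]]].
    rewrite c0 !mulr0 addr0.
    have h k : (m k)%:~R * (2 * pi * (i == k)%:R) =
       - ((Num.floor (coord i z.1 / (2 * pi)))%:~R * (2 * pi)) *+ (i == k).
      have [->|_] := eqVneq i k; last by rewrite !mulr0.
      by rewrite /m mulrNz mulr1 mulNr.
    rewrite !h -!addrA -!mulrnDr.
    have -> : ((i == ord0) + ((i == inord 1) + (i == inord 2)))%N = 1%N.
      by case: i {red c0 h} => -[|[|[|//]]] ? /=; rewrite -!val_eqE/= !inordK.
    by rewrite mulr1n.
  have red := floor_reduce z.2 T0.
  by rewrite !scaler0 !addr0 /GRing.scale/= mulr1 /mt mulrNz mulNr.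
move=> f [f1 f2].
by rewrite (periodic_int f2) !(periodic_int (f1 _)).
Qed.

Lemma subr_scale_double (R : realType) (E : lmodType R) (z v : E) (q : R) :
  z - q *: v + (2 * q) *: v = z + q *: v.
Proof. by rewrite mulr_natl mulr2n scalerDl addrA subrK. Qed.

(** * Gradient estimate for the periodic heat equation by doubling the point *)

Section gradient_bound.
Variable R : realType.
Variables (nu Om : R).
Hypothesis nu0 : 0 < nu.
Hypothesis Om0 : 0 < Om.
Notation T := (per Om).

Lemma is_derive_line (A : seq (term R)) o (z : spacetime R) (s : R) :
  is_derive s (1 : R) (fun s => evl Om A (z + s *: stdir R o))
    (evl Om (dlist Om o A) (z + s *: stdir R o)).
Proof.
have := @is_derive_pullback R R^o _ (fun s : R => z + s *: stdir R o) (evl Om A) s 1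
  (stdir R o) _ _ (is_derive_evl Om o A (z + s *: stdir R o)).
apply => h.
by rewrite scalerDl /GRing.scale/= mulr1 addrCA.
Qed.

Lemma is_derive_line_scaled (A : seq (term R)) o (z : spacetime R) (c s : R) :
  is_derive s (1 : R) (fun s => evl Om A (z + (c * s) *: stdir R o))
    (c * evl Om (dlist Om o A) (z + (c * s) *: stdir R o)).
Proof.
have := @is_derive_pullback R R^o R^o (fun s : R => c * s)
  (fun s => evl Om A (z + s *: stdir R o)) s 1 c _ _
  (is_derive_direction c (is_derive_line A o z (c * s))).
by apply => h; rewrite mulrDr /GRing.scale/= mulr1 [c * h]mulrC.
Qed.

(** Both points are translated by the same vector, so the barrier, which depends on their distance
    alone, drops out. With the time direction this yields equal time derivatives, with a space
    direction ordered second derivatives. *)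
Lemma two_point_line (A : seq (term R)) o (y y' : spacetime R) :
  (forall s, evl Om A (y + s *: stdir R o) - evl Om A (y' + s *: stdir R o) <=
     evl Om A y - evl Om A y') ->
  evl Om (dlist Om o A) y = evl Om (dlist Om o A) y' /\
  evl Om (dlist Om o (dlist Om o A)) y <= evl Om (dlist Om o (dlist Om o A)) y'.
Proof.
move=> hm.
pose h s := evl Om A (y + s *: stdir R o) - evl Om A (y' + s *: stdir R o).
pose h1 s := evl Om (dlist Om o A) (y + s *: stdir R o) -
  evl Om (dlist Om o A) (y' + s *: stdir R o).
have hd s : is_derive s (1 : R) h (h1 s).
  by apply: is_deriveB; exact: is_derive_line.
pose h2 := evl Om (dlist Om o (dlist Om o A)) y - evl Om (dlist Om o (dlist Om o A)) y'.
have h1d : is_derive (0 : R) (1 : R) h1 h2.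
  have -> : h2 = evl Om (dlist Om o (dlist Om o A)) (y + 0 *: stdir R o) -
     evl Om (dlist Om o (dlist Om o A)) (y' + 0 *: stdir R o).
    by rewrite scale0r !addr0.
  by apply: is_deriveB; exact: is_derive_line.
have [] := @second_derivative_at_max _ h h1 h2 1 ltr01 hd h1d.
  by move=> s _; rewrite {2}/h scale0r !addr0; exact: hm.
rewrite /h1 /h2 scale0r !addr0 => /eqP; rewrite subr_eq0 => /eqP ->.
by rewrite subr_le0.
Qed.

Lemma is_derive_parabola (k r0 s : R) :
  is_derive s (1 : R) (fun s => k * ((r0 + s) * (pi - r0 - s)))
    (k * (pi - 2 * (r0 + s))).
Proof.
apply: is_derive_eq.
by rewrite /GRing.scale/=; ring.
Qed.

Lemma is_derive_affine (k c s : R) :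
  is_derive s (1 : R) (fun s => k * (c - 2 * s)) (- (2 * k)).
Proof.
apply: is_derive_eq.
by rewrite /GRing.scale/=; ring.
Qed.

(** Here the points move apart. The reflected motion of the second point squares to a plus sign in
    its second derivative, and the barrier [k r (pi - r)] contributes the strict gain [2 * k]. *)
Lemma two_point_radial (A : seq (term R)) o (z : spacetime R) (k r0 : R) :
  0 < r0 -> r0 < pi ->
  let e := stdir R o in
  (forall r, 0 <= r <= pi -> evl Om A (z + r *: e) - evl Om A (z - r *: e)
      - k * (r * (pi - r)) <=
    evl Om A (z + r0 *: e) - evl Om A (z - r0 *: e) - k * (r0 * (pi - r0))) ->
  evl Om (dlist Om o (dlist Om o A)) (z + r0 *: e) -
  evl Om (dlist Om o (dlist Om o A)) (z - r0 *: e) <= - (2 * k).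
Proof.
move=> r00 r0pi e hm.
pose y := z + r0 *: e; pose y' := z - r0 *: e.
pose h s := (evl Om A (y + s *: e) - evl Om A (y' + (-1 * s) *: e)) -
  k * ((r0 + s) * (pi - r0 - s)).
pose h1 s := (evl Om (dlist Om o A) (y + s *: e) -
    -1 * evl Om (dlist Om o A) (y' + (-1 * s) *: e)) - k * (pi - 2 * (r0 + s)).
have hd s : is_derive s (1 : R) h (h1 s).
  apply: is_deriveB; last exact: is_derive_parabola.
  by apply: is_deriveB; [exact: is_derive_line|exact: is_derive_line_scaled].
pose h2 := (evl Om (dlist Om o (dlist Om o A)) y
  - -1 * (-1 * evl Om (dlist Om o (dlist Om o A)) y')) - (- (2 * k)).
have h1d : is_derive (0 : R) (1 : R) h1 h2.
  have -> : h2 = (evl Om (dlist Om o (dlist Om o A)) (y + 0 *: e) -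
     -1 * (-1 * evl Om (dlist Om o (dlist Om o A)) (y' + (-1 * 0) *: e))) - (- (2 * k)).
    by rewrite mulr0 scale0r !addr0.
  have -> : h1 = (fun s => (evl Om (dlist Om o A) (y + s *: e) -
     -1 * evl Om (dlist Om o A) (y' + (-1 * s) *: e)) - k * ((pi - 2 * r0) - 2 * s)).
    by apply/funext => s; rewrite /h1; congr (_ - _); ring.
  apply: is_deriveB; last exact: is_derive_affine.
  apply: is_deriveB; first exact: is_derive_line.
  apply: is_deriveZ; exact: is_derive_line_scaled.
have e0 : 0 < Num.min r0 (pi - r0) by rewrite lt_min r00 subr_gt0.
have [|_] := @second_derivative_at_max _ h h1 h2 _ e0 hd h1d.
  move=> s; rewrite ltr_norml lt_min => /andP[hs1 /andP[hs2 hs3]].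
  have hs4 : - r0 < s.
    by move: hs1; rewrite ltrNl lt_min => /andP[]; lra.
  have E s' : h s' = evl Om A (z + (r0 + s') *: e) - evl Om A (z - (r0 + s') *: e)
      - k * ((r0 + s') * (pi - (r0 + s'))).
    rewrite /h /y /y' mulN1r scaleNr !scalerDl opprD !addrA; congr (_ - _); ring.
  by rewrite !E addr0; apply: hm; lra.
rewrite /h2; lra.
Qed.

(** The difference minus the barrier vanishes at [r = 0] trivially and at [r = pi] because the two
    points then differ by a period. A positive maximum is therefore interior in [r]. There the time
    derivatives agree and the Laplacians differ by at most [- 2 k], so the two values of the heat
    operator differ by at least [2 nu k > 2 M], which is impossible. *)
Lemma two_point_bound (U : seq (term R)) (M k : R) j (z : spacetime R) (r : R) :
  (forall z, `|evl Om (map (heat nu Om) U) z| <= M) -> M / nu < k -> 0 <= r <= pi ->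
  evl Om U (z + r *: stdir R (Some j)) - evl Om U (z - r *: stdir R (Some j)) <=
  k * (r * (pi - r)).
Proof.
move=> hM Mk hr; pose e := stdir R (Some j).
pose Z (p : spacetime R * R) := evl Om U (p.1 + p.2 *: e) - evl Om U (p.1 - p.2 *: e)
  - k * (p.2 * (pi - p.2)).
have Zc : continuous Z.
  have uc := @evl_continuous R Om U.
  have sc : continuous (fun p : spacetime R * R => p.2 *: e).
    move=> p; apply: cvgZr_tmp; exact: cvg_snd.
  apply: continuous_subf; first apply: continuous_subf.
  - move=> p; apply: (@continuous_comp _ _ _ (fun p : spacetime R * R => p.1 + p.2 *: e)); last exact: uc.
    by apply: cvgD; [exact: cvg_fst|exact: sc].
  - move=> p; apply: (@continuous_comp _ _ _ (fun p : spacetime R * R => p.1 - p.2 *: e)); last exact: uc.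
    by apply: cvgB; [exact: cvg_fst|exact: sc].
  - apply: continuous_mulf; first exact: continuous_cstf.
    apply: continuous_mulf; first exact: continuous_snd.
    apply: continuous_subf; [exact: continuous_cstf|exact: continuous_snd].
have T0 : 0 < T by exact: per_gt0.
pose K : set (spacetime R * R) := stcell T `*` seg pi.
have Kc : compact K.
  by apply: compact_setX; [exact: compact_stcell|exact: segment_compact].
have [z' z'T z'E] := sttorus_reduce z T0.
have pe (s : R) : on_sttorus T (fun z => evl Om U (z + s *: e) - evl Om U (z - s *: e)).
  have [p1 p2] := evl_periodic Om0 U.
  by split => [i x|x];
    rewrite (addrAC x _ (s *: e)) (addrAC x _ (- (s *: e))) ?(p1, p2) ?(p1, p2).
have KZ x s : 0 <= s <= pi -> exists2 x', K (x', s) & Z (x', s) = Z (x, s).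
  move=> hs; have [x' x'T x'E] := sttorus_reduce x T0.
  exists x'; first by split => //; rewrite /seg/= in_itv.
  by rewrite /Z/= (x'E _ (pe s)).
have K0 : K !=set0 by have [x' Kx _] := KZ z r hr; exists (x', r).
have [[z0 r0] cK cmax] := compact_EVT_max K0 Kc (continuous_subspaceT Zc).
have gmax x s : 0 <= s <= pi -> Z (x, s) <= Z (z0, r0).
  by move=> hs; have [x' Kx <-] := KZ x s hs; apply: cmax; rewrite inE.
suff Z0 : Z (z0, r0) <= 0.
  by have := le_trans (gmax z r hr) Z0; rewrite /Z/= subr_le0.
rewrite leNgt; apply/negP => Zpos.
move: cK; rewrite inE => -[_ /=]; rewrite /seg/= in_itv/= => /andP[r0ge r0le].
have [p1 p2] := evl_periodic Om0 U.
have r0n : r0 != 0.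
  apply/eqP => r00; move: Zpos; rewrite r00 /Z/= scale0r addr0 subr0 subrr mul0r mulr0 subr0.
  by rewrite ltxx.
have r0pi : r0 != pi.
  apply/eqP => r00; move: Zpos; rewrite r00 /Z/= subrr !mulr0 subr0.
  have := p1 j (z0 - pi *: e).
  have -> : z0 - pi *: e + (2 * pi) *: stdir R (Some j) = z0 + pi *: e.
    exact: subr_scale_double.
  by move=> ->; rewrite subrr ltxx.
have r0gt : 0 < r0 by rewrite lt_def r0n.
have r0lt : r0 < pi by rewrite lt_neqAle r0pi.
have hr0 : 0 <= r0 <= pi by rewrite r0ge.
pose y := z0 + r0 *: e; pose y' := z0 - r0 *: e.
have line o : evl Om (dlist Om o U) y = evl Om (dlist Om o U) y' /\
  evl Om (dlist Om o (dlist Om o U)) y <= evl Om (dlist Om o (dlist Om o U)) y'.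
  apply: two_point_line => s.
  have := gmax (z0 + s *: stdir R o) r0 hr0; rewrite /Z/= lerD2r.
  by rewrite (addrAC z0 _ (r0 *: e)) (addrAC z0 _ (- (r0 *: e))).
have rad : evl Om (dlist Om (Some j) (dlist Om (Some j) U)) y -
  evl Om (dlist Om (Some j) (dlist Om (Some j) U)) y' <= - (2 * k).
  by apply: two_point_radial => // s hs; exact: (gmax z0 s hs).
have lap : \sum_i evl Om (dlist Om (Some i) (dlist Om (Some i) U)) y -
  \sum_i evl Om (dlist Om (Some i) (dlist Om (Some i) U)) y' <= - (2 * k).
  rewrite -sumrB (bigD1 j)//= -[X in _ <= X]addr0 lerD//.
  by apply: sumr_le0 => i _; rewrite subr_le0; have [] := line (Some i).
have [ht _] := line None.
have := hM y; have := hM y'; rewrite !evl_heat ht !ler_norml.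
move=> /andP[m1 m2] /andP[m3 m4].
have : nu * (\sum_i evl Om (dlist Om (Some i) (dlist Om (Some i) U)) y -
  \sum_i evl Om (dlist Om (Some i) (dlist Om (Some i) U)) y') <= nu * (- (2 * k)).
  by rewrite ler_pM2l.
move: Mk; rewrite ltr_pdivrMr// mulrBr; lra.
Qed.

(** Divide [two_point_bound] by [2 r] and let [r] tend to 0: the barrier has slope [k pi] at 0. The
    slack [2 d / pi] in [k] provides the strict inequality [M / nu < k] and costs [d] in the
    result. *)
Lemma directional_bound (U : seq (term R)) (M : R) j z :
  (forall z, `|evl Om (map (heat nu Om) U) z| <= M) ->
  evl Om (dlist Om (Some j) U) z <= pi * M / (2 * nu).
Proof.
move=> hM; apply/ler_addgt0Pr => d d0.
have pi0 : 0 < pi :> R by exact: pi_gt0.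
pose k := M / nu + 2 * d / pi.
have Mk : M / nu < k by rewrite ltrDl !mulr_gt0// invr_gt0.
rewrite leNgt; apply/negP => hlt.
pose e := stdir R (Some j).
pose h s := (evl Om U (z + s *: e) - evl Om U (z + (-1 * s) *: e)) - k * ((0 + s) * (pi - 0 - s)).
have hd : is_derive (0 : R) (1 : R) h
   (evl Om (dlist Om (Some j) U) (z + 0 *: e) - -1 * evl Om (dlist Om (Some j) U) (z + (-1 * 0) *: e)
   - k * (pi - 2 * (0 + 0))).
  apply: is_deriveB; last exact: is_derive_parabola.
  by apply: is_deriveB; [exact: is_derive_line|exact: is_derive_line_scaled].
have [|eps eps0 he] := derive_gt0_right hd.
  rewrite mulr0 scale0r !addr0 mulr0 subr0 mulN1r opprK.
  have -> : k * pi = 2 * (pi * M / (2 * nu) + d).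
    have e' (q : R) : 0 < q -> (M / nu + 2 * d / q) * q = 2 * (q * M / (2 * nu) + d).
      by move=> q0; field; rewrite !gt_eqF.
    exact: e'.
  by move: hlt; lra.
pose s := Num.min eps pi / 2.
have m0 : 0 < Num.min eps pi by rewrite lt_min eps0.
have s0 : 0 < s by rewrite divr_gt0.
have sm : s < Num.min eps pi by rewrite /s ltr_pdivrMr// ltr_pMr// ltr1n.
have /andP[se sp] : (s < eps) && (s < pi) by rewrite -lt_min.
have := he s; rewrite s0 se => /(_ isT).
rewrite /h !add0r mulr0 scale0r addr0 mul0r mulr0 subr0 subrr mulN1r scaleNr subr0.
have := @two_point_bound U M k j z s hM Mk.
rewrite (ltW s0) (ltW sp) => /(_ isT); rewrite -/e; lra.
Qed.

End gradient_bound.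

(** * Lattice sums *)

Section sums.
Variable R : realType.

Lemma cauchy_schwarz_step (c a b C A B : R) : 0 <= c -> 0 <= C -> 0 <= a -> 0 <= b ->
  0 <= A -> 0 <= B -> c ^+ 2 <= a * b -> C ^+ 2 <= A * B ->
  (c + C) ^+ 2 <= (a + A) * (b + B).
Proof.
move=> c0 C0 a0 b0 A0 B0 h H.
suff : 2 * (c * C) <= a * B + A * b by rewrite sqrrD mulr2n; lra.
rewrite -ler_sqr ?nnegrE ?mulr_ge0// ?addr_ge0 ?mulr_ge0//.
have h1 : (c * C) ^+ 2 <= (a * b) * (A * B).
  by rewrite exprMn ler_pM ?sqr_ge0.
have h2 := sqr_ge0 (a * B - A * b).
rewrite exprMn; move: h2; rewrite sqrrB sqrrD -mulr_natl; nra.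
Qed.

(** Stated with [c^2 <= a b] in place of a product of square roots, so that only squared estimates
    have to be supplied. *)
Lemma cauchy_schwarz_seq (I : eqType) (s : seq I) (c a b : I -> R) :
  (forall i, 0 <= c i) -> (forall i, 0 <= a i) -> (forall i, 0 <= b i) ->
  {in s, forall i, c i ^+ 2 <= a i * b i} ->
  (\sum_(i <- s) c i) ^+ 2 <= (\sum_(i <- s) a i) * (\sum_(i <- s) b i).
Proof.
move=> c0 a0 b0; elim: s => [|i s IH] h.
  by rewrite !big_nil expr0n mulr0.
rewrite !big_cons cauchy_schwarz_step ?sumr_ge0//.
  by apply: h; rewrite mem_head.
by apply: IH => k ks; apply: h; rewrite in_cons ks orbT.
Qed.

(** A telescoping substitute for the integral comparison. The exponents 1, 2, 3 are those met when
    three coordinates are summed in turn starting from a fourth power. *)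
Lemma inv_pow_telescope p (x : R) : (0 < p < 4)%N -> 1 <= x ->
  (x ^+ p.+1)^-1 <= 2 * ((x ^+ p)^-1 - ((x + 1) ^+ p)^-1).
Proof.
move=> hp x1; have x0 : 0 < x by lra.
have y0 : 0 < x + 1 by lra.
have xn : x != 0 by rewrite gt_eqF.
have yn : x + 1 != 0 by rewrite gt_eqF.
rewrite -subr_ge0.
case: p hp => [|[|[|[|//]]]] // _.
- have -> : 2 * ((x ^+ 1)^-1 - ((x + 1) ^+ 1)^-1) - (x ^+ 2)^-1 =
    (x - 1) / (x ^+ 2 * (x + 1)) by field; rewrite xn yn.
  apply: divr_ge0; first lra.
  by apply: mulr_ge0; [exact: sqr_ge0|exact: ltW].
- have -> : 2 * ((x ^+ 2)^-1 - ((x + 1) ^+ 2)^-1) - (x ^+ 3)^-1 =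
    (3 * x ^+ 2 - 1) / (x ^+ 3 * (x + 1) ^+ 2) by field; rewrite xn yn.
  rewrite divr_ge0 ?mulr_ge0 ?exprn_ge0 ?ltW//; nra.
- have -> : 2 * ((x ^+ 3)^-1 - ((x + 1) ^+ 3)^-1) - (x ^+ 4)^-1 =
    (5 * x ^+ 3 + 3 * x ^+ 2 - x - 1) / (x ^+ 4 * (x + 1) ^+ 3) by field; rewrite xn yn.
  rewrite divr_ge0 ?mulr_ge0 ?exprn_ge0 ?ltW//; nra.
Qed.

Fixpoint zr (N : nat) : seq int :=
  if N is N'.+1 then [:: Posz N'.+1, Negz N' & zr N'] else [:: 0].

Lemma mem_zr N (m : int) : (m \in zr N) = (`|m| <= N)%N.
Proof.
elim: N => [|N IH] /=; first by rewrite inE; case: m => -[].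
rewrite !inE IH NegzE; lia.
Qed.

Lemma zr_uniq N : uniq (zr N).
Proof.
elim: N => [|N IH] //=; rewrite IH inE !mem_zr NegzE; lia.
Qed.

Lemma le_sum_subset (I : eqType) (s S : seq I) (f : I -> R) : uniq s -> uniq S ->
  {subset s <= S} -> (forall i, 0 <= f i) ->
  \sum_(i <- s) f i <= \sum_(i <- S) f i.
Proof.
move=> us uS sS f0.
have p : perm_eq s [seq x <- S | x \in s].
  apply: uniq_perm => //; first exact: filter_uniq.
  move=> i; rewrite mem_filter/=; apply/idP/idP => [is_|/andP[]//].
  by rewrite is_ sS.
rewrite (perm_big _ p) big_filter [leRHS](bigID (fun i => i \in s))/= lerDl.
by apply: sumr_ge0.
Qed.

(** Every step adds two opposite integers, which doubles the factor 2 of [inv_pow_telescope]. *)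
Lemma sum_zr_inv p (A : R) N : (0 < p < 4)%N -> 1 <= A ->
  \sum_(a <- zr N) ((A + `|a%:~R|) ^+ p.+1)^-1 <=
  4 * ((A ^+ p)^-1 - ((A + N.+1%:R) ^+ p)^-1).
Proof.
move=> hp A1; elim: N => [|N IH].
  rewrite /= big_seq1 normr0 addr0.
  have := inv_pow_telescope hp A1.
  have : 0 <= (A ^+ p.+1)^-1 by rewrite invr_ge0 exprn_ge0//; lra.
  lra.
rewrite [zr _]/= !big_cons.
rewrite NegzE mulrNz normrN normr_nat.
have A2 : 1 <= A + N.+1%:R by rewrite (le_trans A1)// lerDl.
have := inv_pow_telescope hp A2.
have -> : A + N.+1%:R + 1 = A + N.+2%:R by rewrite -addrA natr1.
move: IH; set a := (A ^+ p)^-1; set c := (_ ^+ p)^-1; lra.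
Qed.

(** The translated range lies in [zr (N + |l|)], and [sum_zr_inv] is uniform in the range. *)
Lemma sum_inv_shift p (A : R) N (l : int) : (0 < p < 4)%N -> 1 <= A ->
  \sum_(a <- zr N) ((A + `|a%:~R - l%:~R|) ^+ p.+1)^-1 <= 4 * (A ^+ p)^-1.
Proof.
move=> hp A1.
have A0 : 0 < A by lra.
have := @sum_zr_inv p A (N + `|l|)%N hp A1.
set M := (N + _)%N => h.
have h' : \sum_(a <- zr M) ((A + `|a%:~R|) ^+ p.+1)^-1 <= 4 * (A ^+ p)^-1.
  rewrite (le_trans h)// ler_pM2l// lerBlDr lerDl invr_ge0 exprn_ge0//.
  by rewrite addr_ge0// ltW.
apply: le_trans h'.
rewrite (eq_bigr (fun a : int => ((A + `|(a - l)%:~R|) ^+ p.+1)^-1)); last first.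
  by move=> a _; rewrite intrB.
rewrite -(big_map (fun a => a - l) xpredT (fun a : int => ((A + `|a%:~R|) ^+ p.+1)^-1)).
apply: le_sum_subset.
- by rewrite map_inj_uniq ?zr_uniq// => x y /addIr.
- exact: zr_uniq.
- move=> _ /mapP[a ha ->]; rewrite mem_zr in ha; rewrite mem_zr /M.
  by lia.
- by move=> a; rewrite invr_ge0 exprn_ge0// addr_ge0// ltW.
Qed.

Definition freq3 := (int * int * int)%type.
Definition kc (k : freq3) (i : 'I_3) : int :=
  match val i with 0%N => k.1.1 | 1%N => k.1.2 | _ => k.2 end.

Definition box N : seq freq3 :=
  [seq (p, c) | p <- [seq (a, b) | a <- zr N, b <- zr N], c <- zr N].

Lemma mem_box N k : (k \in box N) = [&& `|k.1.1| <= N, `|k.1.2| <= N & `|k.2| <= N]%N.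
Proof.
case: k => -[a b] c /=; rewrite /box -!mem_zr.
apply/idP/idP.
  by move=> /allpairsP[[p c'] /= [/allpairsP[[a' b'] /= [ha hb ->]] hc [-> -> ->]]]; rewrite ha hb hc.
move=> /and3P[ha hb hc]; apply: (allpairs_f (fun p c => (p, c))) => //.
exact: (allpairs_f (fun a b => (a, b))).
Qed.

Lemma box_uniq N : uniq (box N).
Proof.
rewrite /box allpairs_uniq ?zr_uniq//; last by move=> [? ?] [? ?].
by rewrite allpairs_uniq ?zr_uniq// => -[? ?] [? ?].
Qed.

Lemma box_subset M N : (M <= N)%N -> {subset box M <= box N}.
Proof.
move=> MN k; rewrite !mem_box => /and3P[h1 h2 h3].
by rewrite !(leq_trans _ MN).
Qed.

Lemma sum_box (f : freq3 -> R) N :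
  \sum_(k <- box N) f k = \sum_(a <- zr N) \sum_(b <- zr N) \sum_(c <- zr N) f (a, b, c).
Proof. by rewrite /box !big_allpairs_dep. Qed.

Definition l1 (k : freq3) : R := \sum_i `|(kc k i)%:~R|.

Definition l1d (k l : freq3) : R := \sum_i `|(kc k i)%:~R - (kc l i)%:~R|.

Lemma l1dE k l : l1d k l =
  `|k.1.1%:~R - l.1.1%:~R| + `|k.1.2%:~R - l.1.2%:~R| + `|k.2%:~R - l.2%:~R|.
Proof. by rewrite /l1d !big_ord_recl big_ord0 addr0 addrA. Qed.

(** Each coordinate summed lowers the exponent by one and costs a factor 4, hence [64 = 4^3]. The
    distances in the coordinates not yet summed are absorbed into the base. *)
Lemma sum_box_inv (A : R) N (l : freq3) : 1 <= A ->
  \sum_(k <- box N) ((A + l1d k l) ^+ 4)^-1 <= 64 * A^-1.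
Proof.
move=> A1; rewrite sum_box.
have -> : 64 * A^-1 = 16 * (4 * (A ^+ 1)^-1) by rewrite expr1; ring.
apply: le_trans (ler_wpM2l _ (sum_inv_shift N l.1.1 (isT : (0 < 1 < 4)%N) A1)) => //.
rewrite mulr_sumr; apply: ler_sum => a _.
set A2 := A + _; have A21 : 1 <= A2 by rewrite /A2 (le_trans A1)// lerDl.
have -> : 16 * (A2 ^+ 2)^-1 = 4 * (4 * (A2 ^+ 2)^-1) by ring.
apply: le_trans (ler_wpM2l _ (sum_inv_shift N l.1.2 (isT : (0 < 2 < 4)%N) A21)) => //.
rewrite mulr_sumr; apply: ler_sum => b _.
set A3 := A2 + _; have A31 : 1 <= A3 by rewrite /A3 (le_trans A21)// lerDl.
apply: le_trans (sum_inv_shift N l.2 (isT : (0 < 3 < 4)%N) A31) => //.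
by apply: ler_sum => c _; rewrite l1dE/= /A3 /A2 !addrA.
Qed.

End sums.

(** * Response to the driving term *)

Section terms_more.
Variable R : realType.
Notation term := (term R).

Lemma tsum_tprod_sz (t u : term) :
  tsum (fun x => amp x / sz x) (tprod t u) <=
  amp t * amp u / 2 * ((1 + \sum_i `|kr t i + kr u i|)^-1
                      + (1 + \sum_i `|kr t i - kr u i|)^-1).
Proof.
have h (x y x' y' : R) : `|x * y + x' * y'| <= `|x| * `|y| + `|x'| * `|y'|.
  by rewrite (le_trans (ler_normD _ _))// !normrM.
have h' (x y x' y' : R) : `|x * y - x' * y'| <= `|x| * `|y| + `|x'| * `|y'|.
  by rewrite (le_trans (ler_normB _ _))// !normrM.
rewrite /tsum !big_cons big_nil addr0 mulrDr.
have s1 (f : 'I_3 -> R) : 0 <= (1 + \sum_i `|f i|)^-1.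
  by rewrite invr_ge0 addr_ge0// sumr_ge0.
apply: lerD.
- rewrite /sz (eq_bigr (fun i => `|kr t i + kr u i|)); last first.
    by move=> i _; rewrite /kr/= intrD.
  apply: ler_wpM2r => //.
  rewrite /amp/= !normrM (ger0_norm (_ : 0 <= 2^-1))//.
  have := h' (cosc t) (cosc u) (sinc t) (sinc u).
  have := h (cosc t) (sinc u) (sinc t) (cosc u); lra.
- rewrite /sz (eq_bigr (fun i => `|kr t i - kr u i|)); last first.
    by move=> i _; rewrite /kr/= intrB.
  apply: ler_wpM2r => //.
  rewrite /amp/= !normrM (ger0_norm (_ : 0 <= 2^-1))//.
  have := h (cosc t) (cosc u) (sinc t) (sinc u).
  have := h' (sinc t) (cosc u) (cosc t) (sinc u); lra.
Qed.

(** Cauchy-Schwarz on the four summands of [sz] gives [4 (1 + ksq)], and a nonzero integer frequency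
    has [ksq >= 1]. *)
Lemma sz_sqr_le (t : term) : ksq t != 0 -> sz t ^+ 2 <= 8 * ksq t.
Proof.
move=> /ksq_ge1 k1.
have : sz t ^+ 2 <= 4 * (1 + ksq t).
  rewrite /sz /ksq !big_ord_recl !big_ord0 !addr0.
  set a := kr t _; set b := kr t _; set c := kr t _.
  have := sqr_ge0 (1 - `|a|); have := sqr_ge0 (1 - `|b|); have := sqr_ge0 (1 - `|c|).
  have := sqr_ge0 (`|a| - `|b|); have := sqr_ge0 (`|a| - `|c|); have := sqr_ge0 (`|b| - `|c|).
  have := real_normK (num_real a); have := real_normK (num_real b); have := real_normK (num_real c).
  move: `|a| `|b| `|c| => x y z; nra.
lra.
Qed.

Variables (nu Om : R).
Hypothesis nu0 : 0 < nu.
Hypothesis Om0 : 0 < Om.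

(** The factor is [nr t] and not [nr t * Om]: this is L^-1 applied to the time derivative divided by
    [Om]. *)
Definition drive_resp (t : term) := heat_inv nu Om (mulc 0 (nr t) t).

Let resp_coef (t : term) : amp (drive_resp t) <=
  `|nr t| * ((hX nu t + `|hY Om t|) / hD nu Om t) * amp t.
Proof.
have X0 : 0 <= hX nu t by rewrite mulr_ge0 ?ksq_ge0// ltW.
have D0 : 0 <= (hD nu Om t)^-1 by rewrite invr_ge0 addr_ge0// sqr_ge0.
rewrite (le_trans (amp_mulc _ _ _))//.
rewrite -[hX nu (mulc _ _ _)]/(hX nu t) -[hY Om (mulc _ _ _)]/(hY Om t)
  -[hD nu Om (mulc _ _ _)]/(hD nu Om t).
rewrite normrN (ger0_norm (mulr_ge0 X0 D0)) (normrM (hY Om t)) (ger0_norm D0) -mulrDl.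
rewrite [leRHS](_ : _ =
  (hX nu t + `|hY Om t|) / hD nu Om t * (`|nr t| * amp t)); last by ring.
apply: ler_wpM2l; first by rewrite mulr_ge0// addr_ge0.
by rewrite (le_trans (amp_mulc _ _ _))// normr0 add0r.
Qed.

Lemma amp_resp_Om t : ksq t != 0 -> amp (drive_resp t) <= 2 / Om * amp t.
Proof.
move=> k0; rewrite (le_trans (resp_coef t))//.
apply: ler_wpM2r; first exact: amp_ge0.
have D0 := hD_gt0 Om nu0 (ksq_gt0 k0).
rewrite mulrA ler_pdivrMr// mulrAC ler_pdivlMr//.
rewrite [X in X <= _](_ : _ = (hX nu t + `|hY Om t|) * `|hY Om t|); last first.
  by rewrite /hY normrM (gtr0_norm Om0); ring.
rewrite /hD; have := sqr_ge0 (hX nu t - `|hY Om t|).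
rewrite sqrrB !real_normK ?num_real// mulr2n.
have := real_normK (num_real (hY Om t)); have := sqr_ge0 (hX nu t).
have := sqr_ge0 (hY Om t); move: `|hY Om t| => y; nra.
Qed.

(** One power of [|k|] pays for the time frequency, and the other survives as the gain
    [2 / (nu |k|)]. The squared form avoids a root. *)
Lemma amp_resp_nu t : ksq t != 0 -> nr t ^+ 2 <= ksq t ->
  amp (drive_resp t) ^+ 2 <= 4 / (nu ^+ 2 * ksq t) * amp t ^+ 2.
Proof.
move=> k0 nk; have kp := ksq_gt0 k0.
have h : amp (drive_resp t) <= `|nr t| * (2 / hX nu t) * amp t.
  rewrite (le_trans (resp_coef t))// ler_wpM2r ?amp_ge0// ler_wpM2l//.
  exact: hXY_le.
have h2 : amp (drive_resp t) ^+ 2 <= (`|nr t| * (2 / hX nu t) * amp t) ^+ 2.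
  by rewrite lerXn2r// ?nnegrE ?amp_ge0// (le_trans (amp_ge0 _) h).
rewrite (le_trans h2)// !exprMn real_normK ?num_real// ler_wpM2r ?sqr_ge0//.
rewrite (_ : 4 / (nu ^+ 2 * ksq t) = ksq t * (2 ^+ 2 * (hX nu t)^-1 ^+ 2)).
  by rewrite ler_wpM2r// mulr_ge0// sqr_ge0.
by rewrite /hX; field; rewrite !gt_eqF.
Qed.

Lemma resp_identity t z : ksq t != 0 ->
  ev Om (drive_resp t) z = Om^-1 * ev Om t z +
    nu / Om * \sum_i ev Om (mulc 0 (kr t i) (heat_inv nu Om (mulc 0 (kr t i) t))) z.
Proof.
move=> k0; have D0 := hD_gt0 Om nu0 (ksq_gt0 k0).
have [J E] : exists J, forall p q, ev Om (mulc p q t) z = p * ev Om t z + q * J.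
  by eexists => p q; exact: ev_mulc.
have e (i : 'I_3) : ev Om (mulc 0 (kr t i) (heat_inv nu Om (mulc 0 (kr t i) t))) z =
    kr t i ^+ 2 * (- (hX nu t / hD nu Om t) * ev Om t z + hY Om t / hD nu Om t * J).
  rewrite /heat_inv -[hX nu (mulc _ _ _)]/(hX nu t) -[hY Om (mulc _ _ _)]/(hY Om t)
    -[hD nu Om (mulc _ _ _)]/(hD nu Om t) !mulcM E; ring.
under eq_bigr do rewrite e.
rewrite -mulr_suml -/(ksq t) /drive_resp /heat_inv.
rewrite -[hX nu (mulc _ _ _)]/(hX nu t) -[hY Om (mulc _ _ _)]/(hY Om t)
    -[hD nu Om (mulc _ _ _)]/(hD nu Om t) mulcM E.
have {D0} : hX nu t ^+ 2 + hY Om t ^+ 2 != 0 by rewrite gt_eqF.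
rewrite /hD /hX /hY => D0; field.
by rewrite D0 gt_eqF.
Qed.

End terms_more.

Section good_lists.
Variable R : realType.
Notation term := (term R).

Definition good (t : term) := (ksq t == 0) ==> (amp t == 0).

Lemma eq_tsum_all (P : pred term) (phi psi : term -> R) A :
  all P A -> (forall t, P t -> phi t = psi t) -> tsum phi A = tsum psi A.
Proof.
move=> + h; elim: A => [|t A IH] /=; first by rewrite /tsum !big_nil.
by move=> /andP[Pt PA]; rewrite /tsum !big_cons h// -/(tsum phi A) IH.
Qed.

Lemma ev_amp0 Om (t : term) z : amp t = 0 -> ev Om t z = 0.
Proof.
move=> a0; apply/eqP; rewrite -normr_le0 -a0; exact: normr_ev.
Qed.

Lemma amp_mulc0 p q (t : term) : amp t = 0 -> amp (mulc p q t) = 0.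
Proof.
move=> a0; apply/eqP; rewrite eq_le amp_ge0 andbT.
by rewrite (le_trans (amp_mulc _ _ _))// a0 mulr0.
Qed.

Variables (nu Om : R).
Hypothesis nu0 : 0 < nu.
Hypothesis Om0 : 0 < Om.

Lemma evl_mulcN A z : evl Om (map (mulc (-1) 0) A) z = - evl Om A z.
Proof.
rewrite /evl tsum_map -tsumN; apply: eq_bigr => t _ /=.
by rewrite ev_mulc mulN1r mul0r addr0.
Qed.

Lemma gradient_bound (U : seq term) (M : R) j z :
  (forall z, `|evl Om (map (heat nu Om) U) z| <= M) ->
  `|evl Om (dlist Om (Some j) U) z| <= pi * M / (2 * nu).
Proof.
move=> hM; rewrite ler_norml; apply/andP; split; last exact: directional_bound.
rewrite lerNl -evl_mulcN.
have -> : map (mulc (-1) 0) (dlist Om (Some j) U) =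
    dlist Om (Some j) (map (mulc (-1) 0) U).
  rewrite /dlist -!map_comp; apply: eq_map => t /=.
  rewrite !mulcM; congr mulc; rewrite -?[dfrq _ (mulc _ _ _) _]/(dfrq Om t (Some j)) /=; ring.
apply: directional_bound => // {}z.
have -> : map (heat nu Om) (map (mulc (-1) 0) U) = map (mulc (-1) 0) (map (heat nu Om) U).
  rewrite -!map_comp; apply: eq_map => t /=.
  rewrite /heat -[hX nu (mulc _ _ _)]/(hX nu t) -[hY Om (mulc _ _ _)]/(hY Om t) !mulcM.
  congr mulc; ring.
by rewrite evl_mulcN normrN.
Qed.

(** The term [K / Om] contributes 1. The three directions contribute [nu / Om] times [pi B / (2 nu)]
    each, in total [3 pi / 2 <= 6] with [pi <= 4]; the viscosity cancels. *)
Lemma resp_bound (A : seq term) (B : R) z : all good A ->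
  (forall z, `|evl Om A z| <= B) ->
  (forall i z, `|evl Om (dlist Om (Some i) A) z| <= B) ->
  `|evl Om (map (drive_resp nu Om) A) z| <= 7 * B / Om.
Proof.
move=> gA hB hdB.
have B0 : 0 <= B by exact: le_trans (normr_ge0 _) (hB z).
pose Ui i := map (heat_inv nu Om) (dlist Om (Some i) A).
have hU i : `|evl Om (dlist Om (Some i) (Ui i)) z| <= pi * B / (2 * nu).
  apply: gradient_bound => y.
  rewrite (_ : evl Om _ y = evl Om (dlist Om (Some i) A) y); first exact: hdB.
  rewrite /evl /Ui /dlist !tsum_map; apply: (eq_tsum_all gA) => t /implyP gt /=.
  have [k0|k0] := eqVneq (ksq t) 0; last first.
    by rewrite heat_heat_inv.
  have a0 := eqP (gt (introT eqP k0)).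
  by rewrite !ev_amp0//; do ?apply: amp_mulc0.
have -> : evl Om (map (drive_resp nu Om) A) z = Om^-1 * evl Om A z +
   nu / Om * \sum_i evl Om (dlist Om (Some i) (Ui i)) z.
  rewrite /evl tsum_map.
  under [in RHS]eq_bigr do rewrite /Ui /dlist !tsum_map.
  rewrite -tsum_sum -!tsumZ -tsumD; apply: (eq_tsum_all gA) => t /implyP gt /=.
  have [k0|k0] := eqVneq (ksq t) 0; last exact: resp_identity.
  have a0 := eqP (gt (introT eqP k0)).
  rewrite big1 => [|i _]; last by rewrite ev_amp0//; do ?apply: amp_mulc0.
  by rewrite !mulr0 addr0 !ev_amp0 ?mulr0//; do ?apply: amp_mulc0.
have Oi : 0 <= Om^-1 by rewrite invr_ge0 ltW.
have h1 : `|Om^-1 * evl Om A z| <= B / Om.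
  by rewrite normrM (ger0_norm Oi) mulrC ler_wpM2r.
have h2 : `|nu / Om * \sum_i evl Om (dlist Om (Some i) (Ui i)) z| <= 6 * (B / Om).
  have nO : 0 <= nu / Om by rewrite divr_ge0// ltW.
  rewrite normrM (ger0_norm nO).
  have h3 : `|\sum_i evl Om (dlist Om (Some i) (Ui i)) z| <= 3 * (pi * B / (2 * nu)).
    rewrite (le_trans (ler_norm_sum _ _ _))// (le_trans (ler_sum _ (fun i _ => hU i)))//.
    by rewrite sumr_const card_ord -[leLHS]mulr_natl.
  rewrite (le_trans (ler_wpM2l nO h3))//.
  rewrite (_ : _ * _ = (3 / 2 * (B / Om)) * pi).
    have p4 : pi <= 4 :> R.
      have [/andP[_]] := @pihalf_02_cos_pihalf R; lra.
    have BO : 0 <= 3 / 2 * (B / Om) by rewrite !mulr_ge0// invr_ge0.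
    rewrite (le_trans (ler_wpM2l BO p4))//; lra.
  have e (p : R) : nu / Om * (3 * (p * B / (2 * nu))) = 3 / 2 * (B / Om) * p.
    by field; rewrite !gt_eqF.
  exact: e.
rewrite (le_trans (ler_normD _ _))// (le_trans (lerD h1 h2))//; lra.
Qed.

End good_lists.

(** * Estimates for drives indexed by space-time modes *)

Section drive.
Variable R : realType.
Notation term := (term R).
Notation mode := (freq3 * int)%type.
Variables (nu Om : R).
Hypothesis nu0 : 0 < nu.
Hypothesis Om0 : 0 < Om.
Variable nl : freq3 -> seq int.
Variables (al be : 'I_3 -> mode -> R).

Definition mkt j (p : mode) : term := Term (kc p.1) p.2 (al j p) (be j p).

(** [nl k] lists the time frequencies attached to [k]: [1] and [-1] for form (B), and [k_1] for form
    (A). In both cases there are at most two, bounded by [|k|] when [k] is nonzero. *)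
Definition modes N : seq mode := [seq (k, n) | k <- box N, n <- nl k].

Definition driveL N j : seq term := map (mkt j) (modes N).
Definition respL N j : seq term := map (drive_resp nu Om) (driveL N j).

Definition k2 (k : freq3) : R := \sum_i (kc k i)%:~R ^+ 2.

Lemma k2_ge0 k : 0 <= k2 k.
Proof. by apply: sumr_ge0 => i _; exact: sqr_ge0. Qed.

Hypothesis nl2 : forall k, (size (nl k) <= 2)%N.
Hypothesis nlk : forall k n, n \in nl k -> k2 k != 0 -> (n%:~R : R) ^+ 2 <= k2 k.
Hypothesis coef0 : forall j k n, k2 k = 0 -> al j (k, n) = 0 /\ be j (k, n) = 0.
Hypothesis coef_div : forall p, \sum_j (kc p.1 j)%:~R * al j p = 0 /\
  \sum_j (kc p.1 j)%:~R * be j p = 0.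
Variable S : R.
Hypothesis parseval : forall N j,
  \sum_(p <- modes N) k2 p.1 * (al j p ^+ 2 + be j p ^+ 2) <= S.
Variables (Bn fe : nat -> R) (B : R).
Hypothesis drive_le : forall N j z, `|evl Om (driveL N j) z| <= Bn N.
Hypothesis ddrive_le : forall N i j z, `|evl Om (dlist Om (Some i) (driveL N j)) z| <= Bn N.
Hypothesis BnB : Bn @ \oo --> B.
Variable Phi : R -> space R -> 'I_3 -> R.
Hypothesis drivePhi : forall N j z,
  `|Phi z.2 z.1 j - Om^-1 * evl Om (dlist Om None (driveL N j)) z| <= fe N.
Hypothesis fe0 : fe @ \oo --> 0.

Lemma sum_modes (f : mode -> R) N :
  \sum_(p <- modes N) f p = \sum_(k <- box N) \sum_(n <- nl k) f (k, n).
Proof. by rewrite /modes big_allpairs_dep. Qed.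

Lemma mem_modes p N : p \in modes N -> p.2 \in nl p.1.
Proof. by move=> /allpairsPdep[k [n [_ kn ->]]]. Qed.

Lemma sum_modes_le (f : freq3 -> R) N : (forall k, 0 <= f k) ->
  \sum_(p <- modes N) f p.1 <= 2 * \sum_(k <- box N) f k.
Proof.
move=> f0; rewrite sum_modes mulr_sumr; apply: ler_sum => k _ /=.
rewrite big_const_seq count_predT iter_addr addr0 -[f k *+ _]mulr_natl.
by rewrite ler_wpM2r// ler_nat.
Qed.

Lemma tsum_driveL phi N j :
  tsum phi (driveL N j) = \sum_(p <- modes N) phi (mkt j p).
Proof. exact: big_map. Qed.

Lemma driveL_mono N j : leL (driveL N j) (driveL N.+1 j).
Proof.
move=> phi phi0; rewrite !tsum_driveL !sum_modes; apply: le_sum_subset.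
- exact: box_uniq.
- exact: box_uniq.
- exact: box_subset.
- by move=> k; apply: sumr_ge0 => n _; exact: phi0.
Qed.

Lemma good_mkt j p : good (mkt j p).
Proof.
apply/implyP => /eqP k0; case: p k0 => k n k0.
by have [a0 b0] := coef0 j n k0; rewrite /amp/= a0 b0 normr0 addr0.
Qed.

Lemma good_driveL N j : all (@good R) (driveL N j).
Proof. by rewrite all_map; apply/allP => p _ /=; exact: good_mkt. Qed.

Let W := respL.

Lemma resp_le N j z : `|evl Om (W N j) z| <= 7 * Bn N / Om.
Proof.
by apply: resp_bound => //; exact: good_driveL.
Qed.

Lemma heat_resp N j z : evl Om (map (heat nu Om) (W N j)) z =
  Om^-1 * evl Om (dlist Om None (driveL N j)) z.
Proof.
rewrite /W /respL /evl /dlist !tsum_map -tsumZ !tsum_driveL.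
apply: eq_bigr => p _ /=.
have /implyP gt := good_mkt j p; move: gt; set t := mkt j p => gt.
have [k0|k0] := eqVneq (ksq t) 0.
  have a0 := eqP (gt (introT eqP k0)).
  by rewrite !ev_amp0 ?mulr0//; do ?apply: amp_mulc0.
rewrite heat_heat_inv// [LHS]ev_mulc [in RHS]ev_mulc.
by rewrite !mul0r !add0r; field; rewrite gt_eqF.
Qed.

Lemma resp_div N z : \sum_j evl Om (dlist Om (Some j) (W N j)) z = 0.
Proof.
rewrite /evl.
under eq_bigr do rewrite /W /respL /dlist !tsum_map tsum_driveL.
rewrite exchange_big big1//= => p _.
have [c1 c2] := coef_div p.
pose X := hX nu (mkt ord0 p); pose Y := hY Om (mkt ord0 p); pose D := hD nu Om (mkt ord0 p).
pose n : R := nr (mkt ord0 p).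
pose C := cos (phase Om (mkt ord0 p) z); pose S' := sin (phase Om (mkt ord0 p) z).
rewrite (eq_bigr (fun j =>
   ((kc p.1 j)%:~R * al j p) * (n * (- (X / D) * C - (Y / D) * S')) +
   ((kc p.1 j)%:~R * be j p) * (n * ((Y / D) * C - (X / D) * S')))).
  by rewrite big_split/= -!mulr_suml c1 c2 !mul0r addr0.
move=> j _.
rewrite /drive_resp /heat_inv -[hX nu (mulc _ _ _)]/X -[hY Om (mulc _ _ _)]/Y
  -[hD nu Om (mulc _ _ _)]/D /ev -[phase _ _ _]/(phase Om (mkt ord0 p) z) /=.
rewrite -/C -/S' -[nr (mkt j p)]/n /kr /=; ring.
Qed.

Lemma resp_mean N j tau : int3 (fun x => evl Om (W N j) (x, tau)) = 0.
Proof.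
have c t : continuous (fun x : space R => ev Om t (x, tau)).
  by apply: continuous_pair1; exact: ev_continuous.
rewrite (_ : (fun x => _) = fun x =>
   \sum_(p <- modes N) ev Om (drive_resp nu Om (mkt j p)) (x, tau)); last first.
  by apply/funext => x; rewrite /evl /W /respL tsum_map tsum_driveL.
rewrite int3_sum// big1// => p _.
have [k0|k0] := eqVneq (ksq (mkt j p)) 0; last exact: int3_ev.
have /implyP gt := good_mkt j p.
have a0 := eqP (gt (introT eqP k0)).
rewrite (_ : (fun x => _) = fun=> 0); first by rewrite int3_cst mul0r.
by apply/funext => x; rewrite ev_amp0//; do ?apply: amp_mulc0.
Qed.

Lemma sz_mkt j p : sz (mkt j p) = 1 + l1 R p.1. Proof. by []. Qed.

Lemma l1_ge0 k : 0 <= l1 R k. Proof. exact: sumr_ge0. Qed.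
Lemma l1d_ge0 k l : 0 <= l1d R k l. Proof. exact: sumr_ge0. Qed.

Lemma amp_sqr_le j p : amp (mkt j p) ^+ 2 <= 2 * (al j p ^+ 2 + be j p ^+ 2).
Proof.
rewrite /amp/=; have := real_normK (num_real (al j p)).
have := real_normK (num_real (be j p)).
have := sqr_ge0 (`|al j p| - `|be j p|).
move: `|al j p| `|be j p| => a b; nra.
Qed.

Lemma resp_amp0 j p : ksq (mkt j p) = 0 -> amp (drive_resp nu Om (mkt j p)) = 0.
Proof.
move=> k0; have /implyP gt := good_mkt j p.
have a0 := eqP (gt (introT eqP k0)); by do 2 apply: amp_mulc0.
Qed.

Lemma sum_shift_le (c : R) N (l : freq3) : 1 <= c ->
  \sum_(p <- modes N) ((c + l1d R p.1 l) ^+ 4)^-1 <= 128 / c.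
Proof.
move=> c1; rewrite (le_trans (@sum_modes_le (fun k => ((c + l1d R k l) ^+ 4)^-1) N _))//.
  by move=> k; rewrite invr_ge0 exprn_ge0// addr_ge0 ?l1d_ge0//; lra.
by have := sum_box_inv N l c1; lra.
Qed.

Lemma l1d0 k : l1d R k (0, 0, 0) = l1 R k.
Proof.
by apply: eq_bigr => i _; rewrite (_ : kc (0,0,0) i = 0) ?subr0// /kc; case: i => -[|[|[|]]].
Qed.

(* Low modes are damped by [1 / Om], high modes by the Laplacian. *)
Lemma resp_l1 (L : nat) (E : R) N j : 0 <= E ->
  2 * S * (512 * (8 * L%:R ^+ 2 / Om ^+ 2 + 1024 / (nu ^+ 2 * L.+1%:R))) <= E ^+ 2 ->
  tsum (@amp R) (W N j) <= E.
Proof.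
move=> E0 hE; rewrite -ler_sqr ?nnegrE//; last by apply: tsum_ge0; exact: amp_ge0.
apply: le_trans hE.
rewrite /W /respL tsum_map tsum_driveL.
pose A p := k2 p.1 * (2 * (al j p ^+ 2 + be j p ^+ 2)).
have [c1 [c1E cO]] : exists c : R, c = 8 * L%:R ^+ 2 / Om ^+ 2 /\ 0 <= c.
  exists (8 * L%:R ^+ 2 / Om ^+ 2); split => //.
  by apply: divr_ge0; [apply: mulr_ge0 => //|]; exact: sqr_ge0.
have [c2 [c2E cn]] : exists c : R, c = 1024 / nu ^+ 2 /\ 0 <= c.
  exists (1024 / nu ^+ 2); split; first by [].
  by apply: divr_ge0; [exact: ler0n|exact: sqr_ge0].
(* One majorant for both regimes: the first summand serves modes with [sz <= L], where
   [sz^4 <= 8 ksq L^2], the second those with [sz > L], where [(L + sz)^4 <= 1024 ksq^2]. The base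
   [L + 1] of the second makes its lattice sum O(1 / L). *)
pose b (p : mode) := 4 * (c1 * ((1 + l1d R p.1 (0,0,0)) ^+ 4)^-1
   + c2 * ((L.+1%:R + l1d R p.1 (0,0,0)) ^+ 4)^-1).
have A0 p : 0 <= A p by rewrite !mulr_ge0 ?k2_ge0// addr_ge0// sqr_ge0.
have p1 (c : R) k l : 0 <= c -> 0 <= ((c + l1d R k l) ^+ 4)^-1.
  by move=> c0; rewrite invr_ge0 exprn_ge0// addr_ge0// l1d_ge0.
have b0 p : 0 <= b p.
  by rewrite mulr_ge0// addr_ge0// mulr_ge0// p1.
have key := @cauchy_schwarz_seq R _ (modes N) (fun p => amp (drive_resp nu Om (mkt j p))) A b.
apply: le_trans (key _ A0 b0 _) _ => [p|p /mem_modes hp|].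
- exact: amp_ge0.
- have [k0|k0] := eqVneq (ksq (mkt j p)) 0.
    by rewrite resp_amp0// expr0n mulr_ge0.
  have kp := ksq_gt0 k0.
  have hs := sz_sqr_le k0; have s1 := sz_ge1 (mkt j p).
  have s0 : 0 < sz (mkt j p) by lra.
  have ha := amp_sqr_le j p.
  have hk2 : k2 p.1 = ksq (mkt j p) by [].
  rewrite /A hk2 -mulrA mulrCA.
  apply: (@le_trans _ _ (amp (mkt j p) ^+ 2 * (ksq (mkt j p) * b p))); last first.
    by apply: ler_wpM2r => //; apply: mulr_ge0 => //; exact: ltW.
  have [sL|Ls] := leP (sz (mkt j p)) L%:R.
  + have h := amp_resp_Om nu0 Om0 k0.
    have h2 : amp (drive_resp nu Om (mkt j p)) ^+ 2 <= (2 / Om * amp (mkt j p)) ^+ 2.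
      by rewrite lerXn2r// ?nnegrE ?amp_ge0// (le_trans (amp_ge0 _) h).
    rewrite (le_trans h2)// exprMn mulrC ler_wpM2l ?sqr_ge0//.
    have s40 : 0 < sz (mkt j p) ^+ 4 by rewrite exprn_gt0.
    have h1 : sz (mkt j p) ^+ 4 <= 8 * ksq (mkt j p) * L%:R ^+ 2.
      rewrite (_ : _ ^+ 4 = sz (mkt j p) ^+ 2 * sz (mkt j p) ^+ 2); last by ring.
      by rewrite ler_pM ?sqr_ge0// lerXn2r ?nnegrE// ltW.
    have h3 : (2 / Om) ^+ 2 <= ksq (mkt j p) * (4 * (c1 * (sz (mkt j p) ^+ 4)^-1)).
      rewrite c1E [leRHS](_ : _ = (2 / Om) ^+ 2 * (8 * ksq (mkt j p) * L%:R ^+ 2 / sz (mkt j p) ^+ 4)).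
        by rewrite ler_peMr ?sqr_ge0// ler_pdivlMr// mul1r.
      by field; rewrite !gt_eqF.
    apply: le_trans h3 _; apply: ler_wpM2l; first exact: ltW.
    rewrite /b [in 1 + l1d R _ _]l1d0 -(sz_mkt j); apply: ler_wpM2l => //.
    by rewrite lerDl; apply: mulr_ge0 => //; exact: p1.
  + have h := amp_resp_nu Om nu0 k0 (nlk hp k0).
    rewrite (le_trans h)// mulrC ler_wpM2l ?sqr_ge0//.
    set s := sz (mkt j p) in Ls hs s1 s0 *.
    have Ls0 : 0 < L%:R + s by apply: ltr_wpDl => //; exact: ler0n.
    have h4 : (L%:R + s) ^+ 4 <= 1024 * ksq (mkt j p) ^+ 2.
      have h5 : (L%:R + s) ^+ 2 <= 32 * ksq (mkt j p).
        have : (L%:R + s) ^+ 2 <= (2 * s) ^+ 2.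
          by rewrite lerXn2r ?nnegrE ?ltW ?mulr_gt0//; lra.
        by rewrite exprMn; lra.
      rewrite (_ : _ ^+ 4 = (L%:R + s) ^+ 2 * (L%:R + s) ^+ 2); last by ring.
      rewrite (_ : 1024 * _ = (32 * ksq (mkt j p)) * (32 * ksq (mkt j p))); last by ring.
      by rewrite ler_pM ?sqr_ge0.
    have LsE : L.+1%:R + l1d R p.1 (0,0,0) = L%:R + s.
      by rewrite l1d0 /s sz_mkt -natr1 addrA.
    have h3 : 4 / (nu ^+ 2 * ksq (mkt j p)) <=
        ksq (mkt j p) * (4 * (c2 * ((L%:R + s) ^+ 4)^-1)).
      rewrite c2E [leRHS](_ : _ = 4 / (nu ^+ 2 * ksq (mkt j p)) *
         (1024 * ksq (mkt j p) ^+ 2 / (L%:R + s) ^+ 4)); last first.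
        by field; rewrite !gt_eqF.
      rewrite ler_peMr//; last by rewrite ler_pdivlMr ?mul1r// exprn_gt0.
      by rewrite divr_ge0// mulr_ge0 ?sqr_ge0// ltW.
    apply: le_trans h3 _; apply: ler_wpM2l; first exact: ltW.
    by rewrite /b LsE ler_wpM2l// lerDr mulr_ge0// p1.
- have hA : \sum_(p <- modes N) A p <= 2 * S.
    apply: le_trans (ler_wpM2l _ (parseval N j)) => //.
    rewrite mulr_sumr; apply: ler_sum => p _; rewrite /A; lra.
  have hb : \sum_(p <- modes N) b p <=
      512 * (c1 + c2 / L.+1%:R).
    rewrite -mulr_sumr big_split/= -!mulr_sumr.
    have g1 := sum_shift_le N (0,0,0) (lexx (1 : R)).
    have L1 : 1 <= L.+1%:R :> R by rewrite ler1n.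
    have g2 := sum_shift_le N (0,0,0) L1.
    have := lerD (ler_wpM2l cO g1) (ler_wpM2l cn g2).
    rewrite divr1 [c2 * (128 / _)]mulrCA; move: (c2 / _) (c1 * \sum_(i <- _) _) (c2 * \sum_(i <- _) _) => ? ? ?.
    lra.
  rewrite [1024 / _](_ : _ = c2 / L.+1%:R); last by rewrite c2E invfM mulrA.
  by rewrite -c1E; apply: ler_pM => //; apply: sumr_ge0.
Qed.

(** Cauchy-Schwarz against the gradient bound [S] leaves a lattice sum of [|k|^-2 |k - l|^-2]. The
    arithmetic-geometric inequality splits it into two inverse fourth powers, centred at 0 and at
    [l], so the bound is uniform in [l] and keeps the full factor 1 / Om. *)
Lemma resp_shift (D : R) N j (l : freq3) : 0 <= D ->
  8192 * S / Om ^+ 2 <= D ^+ 2 ->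
  \sum_(p <- modes N) amp (drive_resp nu Om (mkt j p)) / (1 + l1d R p.1 l) <= D.
Proof.
move=> D0 hD.
have d1 k l' : 1 <= 1 + l1d R k l' by rewrite lerDl l1d_ge0.
have d0 k l' : 0 < 1 + l1d R k l' by rewrite (lt_le_trans _ (d1 _ _)).
have f0 p : 0 <= amp (drive_resp nu Om (mkt j p)) / (1 + l1d R p.1 l).
  by rewrite divr_ge0 ?amp_ge0// ltW.
rewrite -ler_sqr ?nnegrE//; last exact: sumr_ge0.
apply: le_trans hD.
pose A p := k2 p.1 * (2 * (al j p ^+ 2 + be j p ^+ 2)).
pose b (p : mode) := 16 / Om ^+ 2 * (((1 + l1d R p.1 (0,0,0)) ^+ 4)^-1
   + ((1 + l1d R p.1 l) ^+ 4)^-1).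
have A0 p : 0 <= A p by rewrite !mulr_ge0 ?k2_ge0// addr_ge0// sqr_ge0.
have p1 k l' : 0 <= ((1 + l1d R k l') ^+ 4)^-1 by rewrite invr_ge0 exprn_ge0// ltW.
have cO : 0 <= 16 / Om ^+ 2 by apply: divr_ge0; [exact: ler0n|exact: sqr_ge0].
have b0 p : 0 <= b p by rewrite mulr_ge0// addr_ge0// p1.
have key := @cauchy_schwarz_seq R _ (modes N) _ A b f0 A0 b0.
apply: le_trans (key _) _ => [p /mem_modes hp|].
- have [k0|k0] := eqVneq (ksq (mkt j p)) 0.
    by rewrite resp_amp0// mul0r expr0n mulr_ge0.
  have kp := ksq_gt0 k0.
  have hs := sz_sqr_le k0; have ha := amp_sqr_le j p.
  have hk2 : k2 p.1 = ksq (mkt j p) by [].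
  have h := amp_resp_Om nu0 Om0 k0.
  have h2 : amp (drive_resp nu Om (mkt j p)) ^+ 2 <= (2 / Om * amp (mkt j p)) ^+ 2.
    by rewrite lerXn2r// ?nnegrE ?amp_ge0// (le_trans (amp_ge0 _) h).
  rewrite exprMn.
  set s' := 1 + l1d R p.1 l.
  have s'0 : 0 < s' by exact: d0.
  have v0 : 0 <= s'^-1 ^+ 2 by exact: sqr_ge0.
  apply: le_trans (ler_wpM2r v0 h2) _.
  rewrite /A hk2 exprMn.
  have [s s0 hsE] : exists2 s : R, 0 < s & 1 + l1d R p.1 (0,0,0) = s.
    by exists (1 + l1d R p.1 (0,0,0)).
  have sE : sz (mkt j p) = s by rewrite -hsE l1d0.
  rewrite sE in hs.
  have ab : 4 / Om ^+ 2 * (s'^-1) ^+ 2 <= ksq (mkt j p) * b p.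
    rewrite /b hsE -/s'.
    have am : 2 * (s^-1 ^+ 2 * s'^-1 ^+ 2) <= (s ^+ 4)^-1 + (s' ^+ 4)^-1.
      have := sqr_ge0 (s^-1 ^+ 2 - s'^-1 ^+ 2).
      rewrite sqrrB -!exprM !exprVn mulr2n; lra.
    have am2 : s'^-1 ^+ 2 <= 4 * ksq (mkt j p) * ((s ^+ 4)^-1 + (s' ^+ 4)^-1).
      apply: le_trans (ler_wpM2l _ am); last by rewrite mulr_ge0// ltW.
      rewrite [leRHS](_ : _ = s'^-1 ^+ 2 * (8 * ksq (mkt j p) / s ^+ 2)).
        by rewrite ler_peMr// ler_pdivlMr ?exprn_gt0// mul1r.
      by field; rewrite !gt_eqF.
    have O4 : 0 <= 4 / Om ^+ 2 by rewrite mulr_ge0// ?invr_ge0 sqr_ge0.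
    apply: le_trans (ler_wpM2l O4 am2) _.
    by rewrite le_eqVlt; apply/orP; left; apply/eqP; field; rewrite !gt_eqF.
  have am := sqr_ge0 (amp (mkt j p)).
  rewrite [leLHS](_ : _ = amp (mkt j p) ^+ 2 * (4 / Om ^+ 2 * s'^-1 ^+ 2)); last first.
    by field; rewrite !gt_eqF.
  rewrite [leRHS](_ : _ = (2 * (al j p ^+ 2 + be j p ^+ 2)) * (ksq (mkt j p) * b p)); last by ring.
  by apply: ler_pM => //; rewrite mulr_ge0// ?mulr_ge0 ?invr_ge0 ?sqr_ge0.
- have hA : \sum_(p <- modes N) A p <= 2 * S.
    apply: le_trans (ler_wpM2l _ (parseval N j)) => //.
    rewrite mulr_sumr; apply: ler_sum => p _; rewrite /A; lra.
  have hb : \sum_(p <- modes N) b p <= 4096 / Om ^+ 2.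
    rewrite -mulr_sumr big_split/=.
    have g1 := sum_shift_le N (0,0,0) (lexx (1 : R)).
    have g2 := sum_shift_le N l (lexx (1 : R)).
    have := ler_wpM2l cO (lerD g1 g2); lra.
  apply: (@le_trans _ _ (2 * S * (4096 / Om ^+ 2))).
    by rewrite ler_pM// sumr_ge0.
  lra.
Qed.

(** For each term of the second factor, with frequency [q], the weight of a product is centred at
    [- q] or at [q] as seen from the first factor. Summing the first factor with that weight gives
    [D], and the second with plain amplitudes gives [E]. *)
Lemma crossz_resp (E D : R) N i l : 0 <= D ->
  8192 * S / Om ^+ 2 <= D ^+ 2 ->
  tsum (@amp R) (W N l) <= E ->
  crossz (W N i) (W N l) <= E * D.
Proof.
move=> D0 hD hE.
rewrite /crossz tsum_qlist exchange_big/=.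
apply: (@le_trans _ _ (\sum_(u <- W N l) amp u * D)); last first.
  by rewrite -mulr_suml ler_wpM2r.
rewrite /W /respL -!map_comp !big_map; apply: ler_sum => q _.
rewrite big_map /=.
set u := drive_resp nu Om (mkt l q).
pose mq : freq3 := (- q.1.1.1, - q.1.1.2, - q.1.2).
have mqE i' : (kc mq i')%:~R = - (kc q.1 i')%:~R :> R.
  by rewrite -mulrNz /kc; case: (val i') => [|[|]].
have u0 := amp_ge0 u.
apply: (@le_trans _ _ (\sum_(p <- modes N) amp u / 2 *
   (amp (drive_resp nu Om (mkt i p)) / (1 + l1d R p.1 mq) +
    amp (drive_resp nu Om (mkt i p)) / (1 + l1d R p.1 q.1)))).
  apply: ler_sum => p _; rewrite (le_trans (tsum_tprod_sz _ _))//.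
  rewrite le_eqVlt; apply/orP; left; apply/eqP.
  rewrite /l1d; under [in RHS]eq_bigr do rewrite mqE opprK.
  rewrite /u /kr/=; ring.
rewrite -mulr_sumr big_split/=.
have h1 := resp_shift N i mq D0 hD; have h2 := resp_shift N i q.1 D0 hD.
have u2 : 0 <= amp u / 2 by rewrite divr_ge0.
rewrite (le_trans (ler_wpM2l u2 (lerD h1 h2)))//; lra.
Qed.

Theorem ns_of_modes (L : nat) (E D r : R) :
  0 <= E -> 0 <= D -> 0 <= r ->
  2 * S * (512 * (8 * L%:R ^+ 2 / Om ^+ 2 + 1024 / (nu ^+ 2 * L.+1%:R))) <= E ^+ 2 ->
  8192 * S / Om ^+ 2 <= D ^+ 2 ->
  36 / nu * (9 * (E * D)) <= r / 2 ->
  36 / nu * (2 * (3 * E) + r) <= 2^-1 ->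
  exists2 v : stfield R, periodic_NS_solution nu (per Om) Phi v &
    forall j z, `|v j z| <= 7 * B / Om + r.
Proof.
move=> E0 D0 r0 hE hD rd re.
have WE N j := resp_l1 N j E0 hE.
apply: (@ns_of_drive R nu Om nu0 Om0 W _ (3 * E) (E * D) r (7 * B / Om)
   (fun n => 7 * Bn n / Om) fe) => //.
- by move=> n j; apply: leL_map; exact: driveL_mono.
- move=> n; rewrite /amps (le_trans (ler_sum _ (fun j _ => WE n j)))//.
  by rewrite sumr_const card_ord -[leLHS]mulr_natl.
- by move=> n i l; apply: crossz_resp.
- exact: resp_mean.
- exact: resp_div.
- exact: resp_le.
- by apply: cvgM; [apply: cvgM => //|]; exact: cvg_cst.
- by move=> n j z; rewrite heat_resp.
Qed.

End drive.

(** * Fourier coefficients on the torus *)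

Section spatial_terms.
Variable R : realType.
Notation term := (term R).
Implicit Types (t : term) (A : seq term) (g : space R -> R).

(** Purely spatial series are space-time lists read at time 0, so the rules for lists carry over. *)
Definition sev t (x : space R) : R := ev 1 t (x, 0).
Definition sevl A (x : space R) : R := evl 1 A (x, 0).

Lemma sev_continuous t : continuous (sev t).
Proof. apply: continuous_pair1; exact: ev_continuous. Qed.

Lemma sevl_continuous A : continuous (sevl A).
Proof. apply: continuous_pair1; exact: evl_continuous. Qed.

Lemma spatial_line i h (x : space R) :
  ((h *: dir R i + x, 0) : spacetime R) = h *: stdir R (Some i) + (x, 0).
Proof. by congr (_, _); rewrite /= scaler0 add0r. Qed.

Lemma is_derive_sev t i x :
  is_derive x (dir R i) (sev t) (sev (mulc 0 (kr t i) t) x).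
Proof.
apply: (@is_derive_pullback _ _ _ (fun x => (x, 0)) _ _ _ (stdir R (Some i))) => [h|].
  exact: spatial_line.
exact: is_derive_ev.
Qed.

Definition dlistx i A := dlist 1 (Some i) A.

Lemma is_derive_sevl A i x :
  is_derive x (dir R i) (sevl A) (sevl (dlistx i A) x).
Proof.
apply: (@is_derive_pullback _ _ _ (fun x => (x, 0)) _ _ _ (stdir R (Some i))) => [h|].
  exact: spatial_line.
exact: is_derive_evl.
Qed.

Lemma sev_torus t : on_torus (sev t).
Proof.
move=> i x.
have := @ev_periodic _ 1 t (Some i) (2 * pi) (x, 0) (frq t i).
rewrite /sev mulrC => /(_ erefl) <-; congr (ev _ _ (_, _)).
by rewrite /= scaler0 addr0.
Qed.

Lemma sevlE A x : sevl A x = \sum_(t <- A) sev t x.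
Proof. by []. Qed.

Lemma sevl_torus A : on_torus (sevl A).
Proof. by move=> i x; rewrite !sevlE; apply: eq_bigr => t _; exact: sev_torus. Qed.

Lemma int3_sev t : int3 (sev t) = if ksq t == 0 then cosc t * (2 * pi) ^+ 3 else 0.
Proof.
case: eqVneq => [k0|k0]; last exact: int3_ev.
rewrite -int3_cst; congr int3; apply/funext => x.
rewrite /sev /ev /phase big1 => [|i _]; last by rewrite ksq_eq0// mul0r.
by rewrite mulr0 addr0 cos0 sin0 mulr1 mulr0 addr0.
Qed.

Definition pairing g t : R := int3 (fun x => g x * sev t x).

Lemma pairing_derive i g g' t : continuous g -> continuous g' ->
  (forall x, is_derive x (dir R i) g (g' x)) -> on_torus g ->
  pairing g' t = - pairing g (mulc 0 (kr t i) t).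
Proof.
move=> gc g'c gd gp; apply/eqP; rewrite -addr_eq0 -int3D; last 2 first.
- by apply: continuous_mulf => //; exact: sev_continuous.
- by apply: continuous_mulf => //; exact: sev_continuous.
apply/eqP; apply: (@int3_derive _ i (fun x => g x * sev t x)).
- by move=> x; exact: is_derive_mulf (gd x) (is_derive_sev t i x).
- by apply: continuous_addf; apply: continuous_mulf => //; exact: sev_continuous.
- by move=> l x; rewrite gp sev_torus.
Qed.

Definition st (k : freq3) a b : term := Term (kc k) 0 a b.

Definition fc : R := (2 * pi) ^- 3.
(** Boxes contain [k] and its opposite, so summing [fa cos + fb sin] over a box reproduces the
    complex Fourier series without the usual factor 2. *)
Definition fa g k : R := fc * pairing g (st k 1 0).
Definition fb g k : R := fc * pairing g (st k 0 1).

Lemma twopi_gt0 : 0 < 2 * pi :> R. Proof. by rewrite mulr_gt0// pi_gt0. Qed.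
Lemma fcK : fc * (2 * pi) ^+ 3 = 1.
Proof. by rewrite mulVf// expf_neq0// gt_eqF// twopi_gt0. Qed.
Lemma fc_ge0 : 0 <= fc.
Proof. by rewrite invr_ge0 exprn_ge0// ltW// twopi_gt0. Qed.

Lemma pairing_st g k a b : continuous g ->
  pairing g (st k a b) = a * pairing g (st k 1 0) + b * pairing g (st k 0 1).
Proof.
move=> gc; have c t : continuous (fun x => g x * sev t x).
  by apply: continuous_mulf => //; exact: sev_continuous.
rewrite /pairing -!int3Z// -int3D; last 2 first.
- by apply: continuous_mulf => //; exact: continuous_cstf.
- by apply: continuous_mulf => //; exact: continuous_cstf.
by congr int3; apply/funext => x; rewrite /sev /ev /phase/=; ring.
Qed.

Lemma mulc_st q k a b : mulc 0 q (st k a b) = st k (q * b) (- (q * a)).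
Proof. by rewrite /mulc/= !mul0r !add0r. Qed.

Lemma fa_derive i g g' k : continuous g -> continuous g' ->
  (forall x, is_derive x (dir R i) g (g' x)) -> on_torus g ->
  fa g' k = (kc k i)%:~R * fb g k.
Proof.
move=> gc g'c gd gp; rewrite /fa (pairing_derive _ gc g'c gd gp) mulc_st.
by rewrite pairing_st// /fb /kr/=; ring.
Qed.

Lemma fb_derive i g g' k : continuous g -> continuous g' ->
  (forall x, is_derive x (dir R i) g (g' x)) -> on_torus g ->
  fb g' k = - ((kc k i)%:~R * fa g k).
Proof.
move=> gc g'c gd gp; rewrite /fb (pairing_derive _ gc g'c gd gp) mulc_st.
by rewrite pairing_st// /fa /kr/=; ring.
Qed.

Definition oppk (k : freq3) : freq3 := (- k.1.1, - k.1.2, - k.2).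

Lemma kc_oppk k i : kc (oppk k) i = - kc k i.
Proof. by rewrite /kc; case: (val i) => [|[|]]. Qed.

Lemma sev_oppk k a b x : sev (st (oppk k) a b) x = sev (st k a (- b)) x.
Proof.
rewrite /sev /ev /phase/= /kr/= !mul0r !addr0.
under eq_bigr do rewrite kc_oppk mulrNz mulNr.
by rewrite sumrN cosN sinN mulrN mulNr.
Qed.

Lemma fa_oppk g k : fa g (oppk k) = fa g k.
Proof.
by congr (_ * int3 _); apply/funext => x; rewrite sev_oppk oppr0.
Qed.

Lemma fb_oppk g k : continuous g -> fb g (oppk k) = - fb g k.
Proof.
move=> gc; rewrite /fb (_ : pairing g (st (oppk k) 0 1) = pairing g (st k 0 (-1))).
  by rewrite pairing_st//; ring.
by congr int3; apply/funext => x; rewrite sev_oppk.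
Qed.

End spatial_terms.

(** * Orthogonality relations and Bessel's inequality *)

Section orthogonality.
Variable R : realType.
Notation term := (term R).
Implicit Types (t : term) (k l : freq3).

Lemma ksq_eq0_frq t : (ksq t == 0) = [forall i, frq t i == 0].
Proof.
apply/idP/forallP => [/eqP k0 i|h].
  by have /eqP := ksq_eq0 i k0; rewrite /kr intr_eq0.
by rewrite /ksq big1// => i _; rewrite /kr (eqP (h i)) expr0n.
Qed.

Lemma eq_freqP k l : (k == l) = [forall i, kc k i == kc l i].
Proof.
apply/eqP/forallP => [->//|]; case: k l => [[a b] c] [[a' b'] c'] h.
have := h (inord 0); have := h (inord 1); have := h (inord 2).
by rewrite /kc/= !inordK//= => /eqP -> /eqP -> /eqP ->.
Qed.

Lemma oppk_box N k : (oppk k \in box N) = (k \in box N).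
Proof. by rewrite !mem_box /= !abszN. Qed.

Variables (A B : freq3 -> R).
Hypothesis Aeven : forall k, A (oppk k) = A k.
Hypothesis Bodd : forall k, B (oppk k) = - B k.

Definition spl N : seq term := [seq st k (A k) (B k) | k <- box N].

Lemma sevl_spl N x : sevl (spl N) x = \sum_(k <- box N) sev (st k (A k) (B k)) x.
Proof. exact: big_map. Qed.

Lemma sev_mul t u x : sev t x * sev u x = \sum_(v <- tprod t u) sev v x.
Proof. by rewrite -[LHS]ev_tprod. Qed.

Lemma int3_sev_mul k l (a b a' b' : R) :
  int3 (fun x => sev (st k a b) x * sev (st l a' b') x) =
  (2 * pi) ^+ 3 / 2 * ((k == oppk l)%:R * (a * a' - b * b') +
                       (k == l)%:R * (a * a' + b * b')).
Proof.
under [X in int3 X]eq_fun do rewrite sev_mul.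
rewrite int3_sum; last exact: sev_continuous.
rewrite !big_cons big_nil addr0 !int3_sev !ksq_eq0_frq /=.
have -> : [forall i, kc k i + kc l i == 0] = (k == oppk l).
  by rewrite eq_freqP; apply: eq_forallb => i; rewrite kc_oppk addr_eq0.
have -> : [forall i, kc k i - kc l i == 0] = (k == l).
  by rewrite eq_freqP; apply: eq_forallb => i; rewrite subr_eq0.
by do 2 case: ifP => _; rewrite /= ?mulr1n ?mulr0n; field.
Qed.

(** The test term meets both [l] and its opposite, each with weight one half; the parities of [A]
    and [B] make the two contributions equal. *)
Lemma pairing_spl N l a b : l \in box N ->
  pairing (sevl (spl N)) (st l a b) = (2 * pi) ^+ 3 * (a * A l + b * B l).
Proof.
move=> lN; rewrite /pairing.
under [X in int3 X]eq_fun do rewrite sevl_spl mulr_suml.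
rewrite int3_sum; last first.
  by move=> k; apply: continuous_mulf; exact: sev_continuous.
under eq_bigr do rewrite int3_sev_mul.
rewrite -mulr_sumr big_split/=.
have pick (m : freq3) (f : freq3 -> R) : m \in box N ->
    \sum_(k <- box N) (k == m)%:R * f k = f m.
  move=> mN; rewrite (bigD1_seq m)//=; last exact: box_uniq.
  rewrite eqxx mul1r big1 ?addr0// => k /negbTE ->; exact: mul0r.
rewrite (pick l (fun k => A k * a + B k * b))//.
rewrite (pick (oppk l) (fun k => A k * a - B k * b)) ?oppk_box//.
rewrite Aeven Bodd; lra.
Qed.

Lemma mean_square_spl N :
  int3 (fun x => sevl (spl N) x ^+ 2) =
  (2 * pi) ^+ 3 * \sum_(k <- box N) (A k ^+ 2 + B k ^+ 2).
Proof.
have -> : (fun x => sevl (spl N) x ^+ 2) =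
    fun x => \sum_(k <- box N) sevl (spl N) x * sev (st k (A k) (B k)) x.
  by apply/funext => x; rewrite expr2 {2}sevl_spl mulr_sumr.
rewrite int3_sum; last first.
  by move=> k; apply: continuous_mulf; [exact: sevl_continuous|exact: sev_continuous].
rewrite mulr_sumr [LHS]big_seq [RHS]big_seq; apply: eq_bigr => k kN.
by rewrite -[LHS]/(pairing _ _) pairing_spl// -!expr2.
Qed.

Lemma coefficients_square_le N M : (forall x, `|sevl (spl N) x| <= M) ->
  \sum_(k <- box N) (A k ^+ 2 + B k ^+ 2) <= M ^+ 2.
Proof.
move=> h; have p0 : 0 < (2 * pi) ^+ 3 :> R by rewrite exprn_gt0// twopi_gt0.
rewrite -(ler_pM2l p0) -mean_square_spl [leRHS]mulrC.
apply: le_trans (ler_norm _) _; apply: int3_norm.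
  by apply: continuous_expf; exact: sevl_continuous.
move=> x _; rewrite normrX lerXn2r// nnegrE//.
exact: le_trans (normr_ge0 _) (h x).
Qed.

End orthogonality.

Lemma dlistx_spl (R : realType) (A B : freq3 -> R) i N :
  dlistx i (spl A B N) =
  spl (fun k => (kc k i)%:~R * B k) (fun k => - ((kc k i)%:~R * A k)) N.
Proof. by rewrite /dlistx /dlist /spl -map_comp; apply: eq_map => k /=; rewrite mulc_st. Qed.

Lemma gradient_coefficients_le (R : realType) (A B : freq3 -> R) N M :
  (forall k, A (oppk k) = A k) -> (forall k, B (oppk k) = - B k) ->
  (forall i x, `|sevl (dlistx i (spl A B N)) x| <= M) ->
  \sum_(k <- box N) k2 R k * (A k ^+ 2 + B k ^+ 2) <= 3 * M ^+ 2.
Proof.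
move=> Ae Bo h.
under eq_bigr do rewrite /k2 mulr_suml.
rewrite exchange_big/=.
have hi i : \sum_(k <- box N) (kc k i)%:~R ^+ 2 * (A k ^+ 2 + B k ^+ 2) <= M ^+ 2.
  rewrite (eq_bigr (fun k => ((kc k i)%:~R * B k) ^+ 2 + (- ((kc k i)%:~R * A k)) ^+ 2)).
    apply: coefficients_square_le => [k|k|x].
    - by rewrite kc_oppk mulrNz Bo mulrNN.
    - by rewrite kc_oppk mulrNz Ae mulNr.
    - by rewrite -dlistx_spl.
  by move=> k _; ring.
by rewrite (le_trans (ler_sum _ (fun i _ => hi i)))// sumr_const card_ord -[leLHS]mulr_natl.
Qed.

(** * Decay of Fourier coefficients and convergence of partial sums *)

Section smooth.
Variable R : realType.
Implicit Types g : space R -> R.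

Definition smooth n g := on_torus g /\ Ck (dir R) n g.

Lemma smooth_continuous n g : smooth n g -> continuous g.
Proof. by case: n => [|n] [_ []]. Qed.

Lemma CkW n g : Ck (dir R) n.+1 g -> Ck (dir R) n g.
Proof.
elim: n g => [|n IH] g [gc h]; first by split.
by split => // i; have [d c] := h i; split => //; exact: IH.
Qed.

Lemma smoothW n g : smooth n.+1 g -> smooth n g.
Proof. by move=> [h1 /CkW]. Qed.

Lemma smooth_derive n i g : smooth n.+1 g -> smooth n (fun x => 'D_(dir R i) g x).
Proof.
move=> [gp [_ /(_ i)[_ h]]]; split => // l; exact: derive_periodic.
Qed.

Lemma smooth_is_derive n i g x : smooth n.+1 g -> is_derive x (dir R i) g ('D_(dir R i) g x).
Proof. by move=> [_ [_ /(_ i)[h _]]]; apply: DeriveDef => //; exact: h. Qed.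

Lemma torus_bound g : continuous g -> on_torus g ->
  exists2 C, 0 <= C & forall x, `|g x| <= C.
Proof.
move=> gc gp; pose f (z : spacetime R) := g z.1.
have fc : continuous f.
  by move=> z; apply: (@continuous_comp _ _ _ fst g); [exact: continuous_fst|exact: gc].
have fp : on_sttorus 1 f.
  split => [i z|z]; rewrite /f/=; first exact: gp.
  by congr g; rewrite scaler0 addr0.
have [C C0 hC] := cell_bound 1 fc.
exists C => // x; have [z' hz hf] := @sttorus_reduce R 1 (x, 0) ltr01.
by have := hC z' hz; rewrite hf.
Qed.

(** A derivative in direction [i] multiplies the coefficients by [k_i] up to sign and exchange, and
    the weight [1 + |k|] is the sum of 1 and the three [|k_i|]. *)
Lemma coefficient_decay n g : smooth n g ->
  exists2 C, 0 <= C & forall k, (1 + l1 R k) ^+ n * (`|fa g k| + `|fb g k|) <= C.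
Proof.
elim: n g => [|n IH] g sg.
  have [M M0 hM] := torus_bound (smooth_continuous sg) sg.1.
  exists (2 * M) => [|k]; first by rewrite mulr_ge0.
  have h a b : amp (st k a b) <= 1 -> `|fc R * pairing g (st k a b)| <= M.
    move=> h1; rewrite normrM (ger0_norm (fc_ge0 R)) -[leRHS]mul1r -(fcK R) -mulrA.
    apply: ler_wpM2l; first exact: fc_ge0.
    rewrite mulrC; apply: int3_norm => [|x _].
      by apply: continuous_mulf; [exact: smooth_continuous sg|exact: sev_continuous].
    rewrite normrM -[leRHS]mulr1; apply: ler_pM => //.
    exact: le_trans (normr_ev _ _ _) h1.
  have ha : `|fa g k| <= M by apply: h; rewrite /amp/= normr1 normr0 addr0.
  have hb : `|fb g k| <= M by apply: h; rewrite /amp/= normr1 normr0 add0r.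
  by rewrite expr0 mul1r; lra.
have [C0 C00 h0] := IH _ (smoothW sg).
have [C hC] : exists C : 'I_3 -> R, forall i, 0 <= C i /\ forall k,
   (1 + l1 R k) ^+ n * (`|fa (fun x => 'D_(dir R i) g x) k| + `|fb (fun x => 'D_(dir R i) g x) k|) <= C i.
  have /choice[C hC] : forall i, exists C, 0 <= C /\ forall k,
     (1 + l1 R k) ^+ n * (`|fa (fun x => 'D_(dir R i) g x) k| + `|fb (fun x => 'D_(dir R i) g x) k|) <= C.
    by move=> i; have [C ? ?] := IH _ (smooth_derive i sg); exists C.
  by exists C.
exists (C0 + \sum_i C i) => [|k]; first by rewrite addr_ge0// sumr_ge0// => i _; case: (hC i).
have hi i : (1 + l1 R k) ^+ n * (`|(kc k i)%:~R| * (`|fa g k| + `|fb g k|)) <= C i.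
  have [_ /(_ k)] := hC i; have sd := smooth_derive i sg.
  have gc := smooth_continuous sg; have gc' := smooth_continuous sd.
  have gd x := smooth_is_derive i x sg.
  rewrite (fa_derive _ gc gc' gd sg.1) (fb_derive _ gc gc' gd sg.1).
  by rewrite normrN !normrM [X in _ * X]addrC -mulrDr.
rewrite exprSr -mulrA mulrDl mul1r mulrDr; apply: lerD; first exact: h0.
by rewrite /l1 mulr_suml mulr_sumr; apply: ler_sum => i _; exact: hi.
Qed.

Definition psum g N : seq (term R) := spl (fa g) (fb g) N.

(** The fourth is the least integer power whose inverse is summable over the three-dimensional
    lattice. The limit [h] is not yet identified with [g]. *)
Lemma psum_cvg g : smooth 4 g ->
  exists2 err : nat -> R, err @ \oo --> 0 &
  exists h : space R -> R, forall N x, `|h x - sevl (psum g N) x| <= err N.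
Proof.
move=> sg; have [C C0 hC] := coefficient_decay sg.
have mono N : leL (psum g N) (psum g N.+1).
  move=> phi phi0; rewrite /tsum !big_map; apply: le_sum_subset => //.
  - exact: box_uniq.
  - exact: box_uniq.
  - exact: box_subset.
have bound N : tsum (@amp R) (psum g N) <= C * (64 * 1^-1).
  rewrite /tsum big_map.
  apply: le_trans (ler_wpM2l C0 (sum_box_inv N (0, 0, 0) (lexx (1 : R)))).
  rewrite mulr_sumr; apply: ler_sum => k _; rewrite l1d0.
  have s0 : 0 < (1 + l1 R k) ^+ 4 by rewrite exprn_gt0// ltr_pwDl// l1_ge0.
  by rewrite ler_pdivlMr// mulrC; exact: hC.
have [err e0 he] := monotone_list_cvg mono bound.
exists err => //.
have /choice[h hh] : forall x, exists l, forall N, `|l - sevl (psum g N) x| <= err N.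
  by move=> x; apply: (he (fun t => sev t x)) => t; exact: normr_ev.
by exists h => N x; exact: hh.
Qed.

Lemma pairing_psum g N l a b : continuous g -> l \in box N ->
  pairing (sevl (psum g N)) (st l a b) = pairing g (st l a b).
Proof.
move=> gc lN; rewrite pairing_spl//; first last.
- by move=> k; exact: fb_oppk.
- by move=> k; exact: fa_oppk.
rewrite [RHS]pairing_st// /fa /fb.
have := fcK R; move: (fc R) ((2 * pi) ^+ 3) (pairing _ _) (pairing _ _) => c p x y h.
have -> : p * (a * (c * y) + b * (c * x)) = (c * p) * (a * y + b * x) by ring.
by rewrite h mul1r.
Qed.

End smooth.

(** * Fourier inversion *)

Lemma mvt_line (R : realType) (f f' : R -> R) (a b : R) : a <= b ->
  (forall s, is_derive s (1 : R) f (f' s)) ->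
  exists2 c, a <= c <= b & f b - f a = f' c * (b - a).
Proof.
move=> ab fd.
have fc : {within `[a, b], continuous f}.
  apply: continuous_subspaceT => s; apply: differentiable_continuous.
  by apply/derivable1_diffP; have [] := fd s.
have [c] := MVT_segment ab (fun x _ => fd x) fc.
by rewrite in_itv; exists c.
Qed.

Lemma lipschitz_line (R : realType) (f f' : R -> R) (K a b : R) :
  (forall s, is_derive s (1 : R) f (f' s)) -> (forall s, `|f' s| <= K) ->
  `|f b - f a| <= K * `|b - a|.
Proof.
move=> fd fK; wlog ab : a b / a <= b.
  move=> h; have [/h//|/ltW/h] := leP a b.
  by rewrite distrC [`|a - b|]distrC.
have [c _ ->] := mvt_line ab fd; rewrite normrM ler_wpM2r//.
Qed.

Lemma cos_normr (R : realType) (s : R) : cos `|s| = cos s.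
Proof. by case: (ler0P s) => _ //; rewrite cosN. Qed.

(** Near a multiple of the period the Lipschitz bound stays below [e]; away from it [1 - cos s] is
    at least [1 - cos d > 0], so a large [C] covers the whole oscillation [K pi]. As [C] precedes
    [f], it serves all lines at once. *)
Lemma periodic_modulus (R : realType) (K e : R) : 0 <= K -> 0 < e ->
  exists2 C, 0 <= C & forall f f' : R -> R,
    (forall s, is_derive s (1 : R) f (f' s)) -> (forall s, `|f' s| <= K) ->
    periodic (2 * pi) f -> forall s, `|f s - f 0| <= e + C * (1 - cos s).
Proof.
move=> K0 e0; have tp := twopi_gt0 R.
pose d := Num.min (e / (K + 1)) 1.
have K1 : 0 < K + 1 by rewrite ltr_wpDl.
have d0 : 0 < d by rewrite lt_min ltr01 andbT divr_gt0.
have pi2 : 2 <= pi :> R by exact: pi_ge2.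
have d1 : d <= 1 by rewrite ge_min lexx orbT.
have cd : cos d < 1.
  rewrite -cos0 ltr_cos ?in_itv//= ?lexx ?ltW//=; lra.
exists (K * pi / (1 - cos d)).
  by rewrite divr_ge0 ?mulr_ge0 ?subr_ge0 ?(ltW cd)//; lra.
move=> f f' fd fK fp s.
pose m := Num.floor ((s + pi) / (2 * pi)).
pose s' := s + (- m)%:~R * (2 * pi).
have fs : f s' = f s by exact: (@periodic_int R R^o).
have cs : cos s' = cos s by rewrite /s' cosDint2pi.
rewrite -fs -cs.
have sp : `|s'| <= pi.
  have := floor_reduce (s + pi) tp; rewrite -/m => /andP[h1 h2].
  by rewrite ler_norml /s' mulrNz; apply/andP; split; lra.
have hl : `|f s' - f 0| <= K * `|s'| by have := lipschitz_line 0 s' fd fK; rewrite subr0.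
have c1 : 0 <= 1 - cos s' by rewrite subr_ge0 cos_le1.
have C0 : 0 <= K * pi / (1 - cos d).
  by rewrite divr_ge0 ?mulr_ge0 ?subr_ge0 ?(ltW cd)//; lra.
apply: le_trans hl _.
have [sd|ds] := leP `|s'| d.
  have : K * `|s'| <= e; last by have := mulr_ge0 C0 c1; lra.
  have : `|s'| <= e / (K + 1) by rewrite (le_trans sd)// ge_min lexx.
  rewrite ler_pdivlMr// => h; have := normr_ge0 s'; nra.
have : K * `|s'| <= K * pi / (1 - cos d) * (1 - cos s'); last by lra.
apply: (@le_trans _ _ (K * pi)); first by rewrite ler_wpM2l.
rewrite mulrAC ler_pdivlMr ?subr_gt0// ler_wpM2l ?mulr_ge0//; first lra.
rewrite lerD2l lerN2 -[cos s']cos_normr ltW// ltr_cos ?in_itv//= ?normr_ge0//.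
by rewrite ltW//=; lra.
Qed.

Section modulus.
Variable R : realType.
Implicit Types g : space R -> R.

(* Uniform continuity on the torus, with the distance measured by 1 - cos. *)
Definition torus_uc g := forall e : R, 0 < e -> exists2 C, 0 <= C &
  forall x y, `|g x - g y| <= e + C * \sum_i (1 - cos (coord i x - coord i y)).

Lemma is_derive_space_line g g' i (x : space R) s :
  (forall y, is_derive y (dir R i) g (g' y)) ->
  is_derive s (1 : R) (fun s => g (x + s *: dir R i)) (g' (x + s *: dir R i)).
Proof.
move=> gd.
have := @is_derive_pullback R R^o _ (fun s : R => x + s *: dir R i) g s 1
  (dir R i) _ _ (gd (x + s *: dir R i)).
apply => h.
by rewrite scalerDl /GRing.scale/= mulr1 addrCA.
Qed.

Lemma coord_ext (x y : space R) : (forall i, coord i x = coord i y) -> x = y.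
Proof.
case: x y => -[x1 x2] x3 [[y1 y2] y3] h.
have := h (inord 0); have := h (inord 1); have := h (inord 2).
by rewrite /coord/= !inordK//= => -> -> ->.
Qed.

Lemma coord_split (x y : space R) : x =
  y + (coord ord0 x - coord ord0 y) *: dir R ord0
    + (coord (inord 1) x - coord (inord 1) y) *: dir R (inord 1)
    + (coord (inord 2) x - coord (inord 2) y) *: dir R (inord 2).
Proof.
apply: coord_ext => i; rewrite !coordD !coordZ !coord_dir.
by case: i => -[|[|[|//]]] h; rewrite -!val_eqE/= !inordK//= /coord/= ?inordK//=; ring.
Qed.

Lemma sum3 (f : 'I_3 -> R) : \sum_i f i = f ord0 + f (inord 1) + f (inord 2).
Proof.
rewrite !big_ord_recl big_ord0 addr0 addrA; congr (_ + f _ + f _);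
 by apply: val_inj; rewrite /= inordK.
Qed.

(** Join the two points by three segments parallel to the axes, each costing [e / 3]. *)
Lemma smooth_torus_uc g : smooth 1 g -> torus_uc g.
Proof.
move=> sg e e0.
have [K K0 hK] : exists2 K, 0 <= K & forall i x, `|'D_(dir R i) g x| <= K.
  have /choice[K hK] : forall i, exists K, 0 <= K /\ forall x, `|'D_(dir R i) g x| <= K.
    move=> i; have sd := smooth_derive i sg.
    by have [K ? ?] := torus_bound (smooth_continuous sd) sd.1; exists K.
  exists (\sum_i K i); first by apply: sumr_ge0 => i _; case: (hK i).
  move=> i x; rewrite (le_trans ((hK i).2 x))// (bigD1 i)//= lerDl sumr_ge0// => j _.
  by case: (hK j).
have e3 : 0 < e / 3 by rewrite divr_gt0.
have [C C0 hC] := periodic_modulus K0 e3.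
have line i x s : `|g (x + s *: dir R i) - g x| <= e / 3 + C * (1 - cos s).
  have := hC (fun s => g (x + s *: dir R i)) _
    (fun s => is_derive_space_line x s (fun y => smooth_is_derive i y sg)).
  rewrite scale0r addr0; apply => [t|t]; first exact: hK.
  by rewrite scalerDl addrA sg.1.
exists C => // x y; rewrite sum3 {1}(coord_split x y).
set a := coord ord0 x - _; set b := coord (inord 1) x - _; set c := coord (inord 2) x - _.
have h1 := line ord0 y a; have h2 := line (inord 1) (y + a *: dir R ord0) b.
have h3 := line (inord 2) (y + a *: dir R ord0 + b *: dir R (inord 1)) c.
move: h1 h2 h3; rewrite !ler_norml => /andP[? ?] /andP[? ?] /andP[? ?].
by apply/andP; split; lra.
Qed.

(** Needed because the limit of the partial sums is known only as a uniform limit, with no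
    derivative at hand. *)
Lemma torus_uc_lim g (gn : nat -> space R -> R) (err : nat -> R) :
  (forall n, torus_uc (gn n)) -> (forall n x, `|g x - gn n x| <= err n) ->
  err @ \oo --> 0 -> torus_uc g.
Proof.
move=> hu he e0 e ep; have e3 : 0 < e / 3 by rewrite divr_gt0.
have /cvgrPdist_le/(_ _ e3)[N _ hN] := e0.
have hNN : err N <= e / 3.
  by have := hN N (leqnn N); rewrite /= sub0r normrN => /(le_trans (ler_norm _)).
have [C C0 hC] := hu N _ e3.
exists C => // x y; have h1 := he N x; have h2 := he N y; have := hC x y.
move: h1 h2; rewrite !ler_norml => /andP[? ?] /andP[? ?] /andP[? ?].
by apply/andP; split; lra.
Qed.

End modulus.

Lemma is_derive_expf (R : realType) (E : normedModType R) (f : E -> R) (x v : E) (df : R) n :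
  is_derive x v f df -> is_derive x v (fun y => f y ^+ n.+1) (n.+1%:R * (f x ^+ n * df)).
Proof.
move=> fd; elim: n => [|n IH]; first by rewrite expr0 !mul1r.
have -> : (fun y => f y ^+ n.+2) = fun y => f y * f y ^+ n.+1.
  by apply/funext => y; rewrite exprS.
have := is_derive_mulf fd IH.
suff -> : df * f x ^+ n.+1 + f x * (n.+1%:R * (f x ^+ n * df)) =
  n.+2%:R * (f x ^+ n.+1 * df) by [].
by rewrite -[n.+2%:R]natr1 exprS; ring.
Qed.

(** * A continuous function orthogonal to all trigonometric polynomials vanishes *)

Section korovkin.
Variable R : realType.
Notation term := (term R).
Implicit Types (t u : term).

Definition freq_of t : freq3 := (frq t ord0, frq t (inord 1), frq t (inord 2)).

Lemma kc_freq_of t i : kc (freq_of t) i = frq t i.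
Proof.
rewrite /kc/=; case: i => -[|[|[|//]]] h /=; congr (frq t _); apply: val_inj => //=;
 by rewrite inordK.
Qed.

Lemma sev_freq_of t : sev t = sev (st (freq_of t) (cosc t) (sinc t)).
Proof.
apply/funext => x; rewrite /sev /ev /phase/= /kr/= !mulr0 !addr0.
by under [in RHS]eq_bigr do rewrite kc_freq_of.
Qed.

Variable D : space R -> R.
Hypothesis Dc : continuous D.
Hypothesis D0 : forall k a b, pairing D (st k a b) = 0.

(** Testing against every further factor [sev t] makes the class stable under multiplication by a
    term, so powers of [bump1] are reached by induction without expanding them. *)
Definition orth (h : space R -> R) := continuous h /\
  forall t, int3 (fun x => D x * (h x * sev t x)) = 0.

Lemma orth1 : orth (fun=> 1).
Proof.
split; first exact: continuous_cstf.
move=> t; rewrite -[RHS](D0 (freq_of t) (cosc t) (sinc t)).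
by congr int3; apply/funext => x; rewrite mul1r sev_freq_of.
Qed.

Lemma orthD h h' : orth h -> orth h' -> orth (fun x => h x + h' x).
Proof.
move=> [hc h0] [h'c h'0]; split; first exact: continuous_addf.
have c (f : space R -> R) t : continuous f -> continuous (fun x => D x * (f x * sev t x)).
  move=> fc; apply: continuous_mulf => //; apply: continuous_mulf => //.
  exact: sev_continuous.
move=> t; have := congr2 +%R (h0 t) (h'0 t); rewrite addr0 -int3D; [|exact: c|exact: c].
by move=> <-; congr int3; apply/funext => x; ring.
Qed.

Lemma orth_mul h u : orth h -> orth (fun x => h x * sev u x).
Proof.
move=> [hc h0]; split; first by apply: continuous_mulf => //; exact: sev_continuous.
move=> t.
under [X in int3 X]eq_fun => x do rewrite -mulrA sev_mul !mulr_sumr.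
rewrite int3_sum; first by rewrite big1.
move=> v; apply: continuous_mulf => //; apply: continuous_mulf => //.
exact: sev_continuous.
Qed.

Variable x0 : space R.

Definition tau i (x : space R) : R := coord i x - coord i x0.
Definition bump1 i x : R := 1 + cos (tau i x).
Definition bump M x : R := \prod_i bump1 i x ^+ M.

Definition tau_term i : term :=
  Term (fun j => (i == j)%:R) 0 (cos (coord i x0)) (sin (coord i x0)).

Lemma sev_tau i x : sev (tau_term i) x = cos (tau i x).
Proof.
rewrite /sev /ev /phase (bigD1 i)//= big1 => [|j ji].
  by rewrite /kr/= eqxx mul1r !addr0 mulr0 addr0 /tau cosB; ring.
by rewrite /kr/= eq_sym (negbTE ji) mul0r.
Qed.

Lemma orth_bump1 h i M : orth h -> orth (fun x => h x * bump1 i x ^+ M).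
Proof.
move=> oh; elim: M => [|M IH]; first by under eq_fun do rewrite expr0 mulr1.
have := orthD IH (orth_mul (tau_term i) IH).
rewrite (_ : (fun x => _ + _) = fun x => h x * bump1 i x ^+ M.+1)//.
by apply/funext => x; rewrite sev_tau exprS /bump1; ring.
Qed.

Lemma orth_bump M : orth (bump M).
Proof.
rewrite /bump; elim: (index_enum _) => [|i s IH].
  by under eq_fun do rewrite big_nil; exact: orth1.
by under eq_fun do rewrite big_cons mulrC; exact: orth_bump1.
Qed.

Lemma int3_bump0 M : int3 (fun x => D x * bump M x) = 0.
Proof.
have [_ /(_ (st (0, 0, 0) 1 0)) h] := orth_bump M.
rewrite -[RHS]h; congr int3; apply/funext => x.
rewrite /sev /ev /phase big1 => [|i _]; last first.
  by rewrite /kr/= /kc; case: (val i) => [|[|]]; rewrite mul0r.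
by rewrite mulr0 addr0 cos0 /= mul0r addr0 !mulr1.
Qed.

Lemma tau_line i h x : tau i (h *: dir R i + x) = h *: (1 : R) + tau i x.
Proof.
rewrite /tau coordD coordZ coord_dir eqxx mulr1 -addrA; congr (_ + _).
by rewrite /GRing.scale/= mulr1.
Qed.

Lemma tau_continuous i : continuous (tau i).
Proof. by apply: continuous_subf; [exact: coord_continuous|exact: continuous_cstf]. Qed.

Lemma tau_periodic j i x : exists m : int, tau i (x + (2 * pi) *: dir R j) = tau i x + m%:~R * (2 * pi).
Proof.
exists ((i == j)%:R); rewrite /tau coordD coordZ coord_dir.
by case: eqP => _; rewrite /= ?mulr1 ?mul1r ?mulr0 ?mul0r; ring.
Qed.

Lemma bump1_periodic i : on_torus (bump1 i).
Proof. by move=> j x; rewrite /bump1; have [m ->] := tau_periodic j i x; rewrite cosDint2pi. Qed.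

Lemma bump1_continuous i : continuous (bump1 i).
Proof.
apply: continuous_addf; first exact: continuous_cstf.
by apply: continuous_cosf; exact: tau_continuous.
Qed.

Lemma bump1_ge0 i x : 0 <= bump1 i x.
Proof. by rewrite /bump1 -lerBlDl sub0r cos_geN1. Qed.

Lemma int3_tau_derive i (f f' : R -> R) (rest : space R -> R) :
  (forall s, is_derive s (1 : R) f (f' s)) -> continuous f' ->
  (forall s (m : int), f (s + m%:~R * (2 * pi)) = f s) ->
  continuous rest -> on_torus rest -> (forall h x, rest (h *: dir R i + x) = rest x) ->
  int3 (fun x => f' (tau i x) * rest x) = 0.
Proof.
move=> fd f'c fp rc rp ri; apply: (@int3_derive _ i (fun x => f (tau i x) * rest x)).
- move=> x.
  have d1 : is_derive x (dir R i) (f \o tau i) (f' (tau i x)).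
    apply: (@is_derive_pullback _ _ _ (tau i) f _ _ (1 : R)); first by move=> h; exact: tau_line.
  have d2 : is_derive x (dir R i) (id \o rest) 0.
    apply: (@is_derive_pullback _ _ _ rest id _ _ (0 : R)); first by move=> h; rewrite ri scaler0 add0r.
  have := is_derive_mulf d1 d2; rewrite mulr0 addr0; exact.
- apply: continuous_mulf => // x; apply: continuous_comp; [exact: tau_continuous|exact: f'c].
- by move=> j x; rewrite rp; have [m ->] := tau_periodic j i x; rewrite fp.
Qed.

Lemma bump1_line i j h x : j != i -> bump1 j (h *: dir R i + x) = bump1 j x.
Proof.
by move=> /negbTE ji; rewrite /bump1 /tau coordD coordZ coord_dir ji mulr0 add0r.
Qed.

Lemma continuous_prodf (I : Type) (s : seq I) (P : pred I) (F : I -> space R -> R) :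
  (forall i, continuous (F i)) -> continuous (fun x => \prod_(i <- s | P i) F i x).
Proof.
move=> Fc; elim: s => [|i s IH].
  by under eq_fun do rewrite big_nil; exact: continuous_cstf.
under eq_fun do rewrite big_cons; case: (P i) => //.
exact: continuous_mulf.
Qed.

Lemma bump_continuous M : continuous (bump M).
Proof. by apply: continuous_prodf => i; apply: continuous_expf; exact: bump1_continuous. Qed.

Lemma bump_ge0 M x : 0 <= bump M x.
Proof. by apply: prodr_ge0 => i _; rewrite exprn_ge0// bump1_ge0. Qed.

Lemma int3_bump1 : int3 (bump 1) = (2 * pi) ^+ 3.
Proof.
rewrite -[RHS]mul1r -int3_cst /bump.
have : uniq (index_enum 'I_3) by exact: index_enum_uniq.
elim: (index_enum _) => [_|i s IH /=/andP[si us]].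
  by congr int3; apply/funext => x; rewrite big_nil.
rewrite -(IH us).
pose rest x := \prod_(j <- s) bump1 j x ^+ 1.
have rc : continuous rest.
  by apply: continuous_prodf => j; apply: continuous_expf; exact: bump1_continuous.
have h0 : int3 (fun x => cos (tau i x) * rest x) = 0.
  apply: (@int3_tau_derive i sin cos) => //.
  - exact: continuous_cos.
  - by move=> t m; exact: sinDint2pi.
  - by move=> j x; apply: eq_bigr => l _; rewrite bump1_periodic.
  - move=> h x; apply: eq_big_seq => l ls; rewrite bump1_line//.
    by apply: contraNneq si => <-.
rewrite -[RHS]addr0 -h0 -int3D//; last first.
  by apply: continuous_mulf => //; apply: continuous_cosf; exact: tau_continuous.
by congr int3; apply/funext => x; rewrite big_cons -/(rest x) expr1 /bump1; ring.
Qed.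

Lemma bernoulli_le (u : R) M : 0 <= u -> 1 + M%:R * (u - 1) <= u ^+ M.
Proof.
move=> u0; elim: M => [|M IH]; first by rewrite mul0r addr0 expr0.
rewrite exprS; apply: le_trans (ler_wpM2l u0 IH).
rewrite -subr_ge0 -natr1 (_ : _ - _ = M%:R * (u - 1) ^+ 2); last by ring.
by rewrite mulr_ge0// sqr_ge0.
Qed.

(** Bernoulli's inequality for the powers of [bump 1], which has mean 1. It keeps the mass of the
    unnormalised kernel positive. *)
Lemma int3_bump_ge M : (2 * pi) ^+ 3 <= int3 (bump M).
Proof.
have e : int3 (fun x => 1 + M%:R * (bump 1 x - 1)) = (2 * pi) ^+ 3.
  have c1 := @continuous_cstf (space R) R 1; have b1 := @bump_continuous 1.
  rewrite int3D//; last by apply: continuous_mulf; [exact: continuous_cstf|exact: continuous_subf].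
  rewrite int3Z; last exact: continuous_subf.
  by rewrite int3B// int3_bump1 int3_cst mul1r subrr mulr0 addr0.
rewrite -e; apply: le_int3.
- apply: continuous_addf; first exact: continuous_cstf.
  apply: continuous_mulf; first exact: continuous_cstf.
  by apply: continuous_subf; [exact: bump_continuous|exact: continuous_cstf].
- exact: bump_continuous.
move=> x _; rewrite (le_trans (bernoulli_le M (bump_ge0 1 x)))//.
by rewrite /bump -prodrXl le_eqVlt; apply/orP; left; apply/eqP; apply: eq_bigr.
Qed.

(* Integration by parts: d_i (sin tau_i . bump) = (cos tau_i - (M+1)(1 - cos tau_i)) bump. *)
Lemma int3_bump_tail i M :
  M.+1%:R * int3 (fun x => (1 - cos (tau i x)) * bump M.+1 x) <= int3 (bump M.+1).
Proof.
have cc : continuous (fun x => cos (tau i x)) by apply: continuous_cosf; exact: tau_continuous.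
have bc := @bump_continuous M.+1.
have c1 : continuous (fun x => (1 - cos (tau i x)) * bump M.+1 x).
  apply: continuous_mulf => //; apply: continuous_subf => //; exact: continuous_cstf.
have c2 : continuous (fun x => cos (tau i x) * bump M.+1 x) by exact: continuous_mulf.
suff e : int3 (fun x => cos (tau i x) * bump M.+1 x -
    M.+1%:R * ((1 - cos (tau i x)) * bump M.+1 x)) = 0.
  move: e; rewrite int3B//; last by apply: continuous_mulf => //; exact: continuous_cstf.
  rewrite int3Z// => /eqP; rewrite subr_eq0 => /eqP <-.
  apply: le_int3 => // x _; rewrite ler_piMl ?bump_ge0// cos_le1//.
pose rest x := \prod_(j | j != i) bump1 j x ^+ M.+1.
have be x : bump M.+1 x = bump1 i x ^+ M.+1 * rest x by rewrite /bump (bigD1 i).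
pose f (s : R) := sin s * (1 + cos s) ^+ M.+1.
pose f' (s : R) := (cos s - M.+1%:R * (1 - cos s)) * (1 + cos s) ^+ M.+1.
rewrite (_ : (fun x => _) = fun x => f' (tau i x) * rest x); last first.
  by apply/funext => x; rewrite be /f' /bump1; ring.
apply: (@int3_tau_derive i f f').
- move=> s.
  have dc : is_derive s (1 : R) (fun s : R => 1 + cos s) (0 + - sin s).
    exact: is_derive_addf.
  have := is_derive_mulf (is_derive_sin s) (is_derive_expf M dc).
  suff -> : cos s * (1 + cos s) ^+ M.+1 +
      sin s * (M.+1%:R * ((1 + cos s) ^+ M * (0 + - sin s))) = f' s by [].
  rewrite /f' mulrBl; congr (_ + _); rewrite exprS.
  have e : sin s ^+ 2 = (1 - cos s) * (1 + cos s).
    by rewrite sin2cos2; ring.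
  have -> : forall m p : R, sin s * (m * (p * (0 + - sin s))) = - (m * p * sin s ^+ 2).
    by move=> m p; ring.
  by rewrite e; ring.
- apply: continuous_mulf; [|by apply: continuous_expf; apply: continuous_addf; [exact: continuous_cstf|exact: continuous_cos]].
  apply: continuous_subf; first exact: continuous_cos.
  apply: continuous_mulf; first exact: continuous_cstf.
  by apply: continuous_subf; [exact: continuous_cstf|exact: continuous_cos].
- by move=> s m; rewrite /f sinDint2pi cosDint2pi.
- by apply: continuous_prodf => j; apply: continuous_expf; exact: bump1_continuous.
- by move=> j x; apply: eq_bigr => l _; rewrite bump1_periodic.
- by move=> h x; apply: eq_bigr => l li; rewrite bump1_line.
Qed.

(** Let [m] be the mass of the bump. Orthogonality turns [D x0 * m] into the integral of
    [(D x0 - D x) * bump], which the modulus of continuity and [int3_bump_tail] in each of three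
    coordinates bound by [(e + 3 C / (M + 1)) m]. Dividing by [m > 0] leaves an arbitrarily small
    number. *)
Theorem korovkin : torus_uc D -> D x0 = 0.
Proof.
move=> uc; apply/eqP; rewrite -normr_le0; apply/ler_addgt0Pr => e e0; rewrite add0r.
have [C C0 hC] := uc e e0.
apply/ler_addgt0Pr => d d0.
have [M hM] : exists M : nat, 3 * C / d <= M.+1%:R.
  exists (Num.truncn (3 * C / d)); apply: ltW; apply: truncnS_gt.
pose m := int3 (bump M.+1).
have m0 : 0 < m by apply: lt_le_trans (int3_bump_ge _); rewrite exprn_gt0// twopi_gt0.
have bc := @bump_continuous M.+1.
have Dbc : continuous (fun x => D x * bump M.+1 x) by exact: continuous_mulf.
have c0 := @continuous_cstf (space R) R.
have tc i : continuous (fun x => (1 - cos (tau i x)) * bump M.+1 x).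
  apply: continuous_mulf => //; apply: continuous_subf; first exact: c0.
  by apply: continuous_cosf; exact: tau_continuous.
have up : int3 (fun x => e * bump M.+1 x + C * \sum_i (1 - cos (tau i x)) * bump M.+1 x)
    <= (e + d) * m.
  rewrite int3D; [|exact: continuous_mulf|]; last first.
    by apply: continuous_mulf => //; exact: continuous_sumf.
  rewrite !int3Z//; last exact: continuous_sumf.
  rewrite int3_sum// mulrDl lerD2l.
  have t i : int3 (fun x => (1 - cos (tau i x)) * bump M.+1 x) <= m / M.+1%:R.
    by rewrite ler_pdivlMr// mulrC int3_bump_tail.
  apply: le_trans (ler_wpM2l C0 (ler_sum _ (fun i _ => t i))) _.
  rewrite sumr_const card_ord -[_ *+ 3]mulr_natl.
  rewrite (_ : C * _ = (3 * C / M.+1%:R) * m); last by ring.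
  apply: ler_wpM2r; first exact: ltW.
  by rewrite ler_pdivrMr ?ltr0n// [d * _]mulrC -ler_pdivrMr.
have key x : `|(D x0 - D x) * bump M.+1 x| <=
    e * bump M.+1 x + C * \sum_i (1 - cos (tau i x)) * bump M.+1 x.
  rewrite -mulr_suml normrM (ger0_norm (bump_ge0 _ _)) mulrA -mulrDl.
  by rewrite ler_wpM2r ?bump_ge0// distrC; exact: hC.
rewrite -(ler_pM2r m0); apply: le_trans up.
rewrite -[X in _ * X](gtr0_norm m0) -normrM.
have -> : D x0 * m = int3 (fun x => (D x0 - D x) * bump M.+1 x).
  rewrite -[LHS]subr0 -(int3_bump0 M.+1) -int3Z// -int3B//; last exact: continuous_mulf.
  by congr int3; apply/funext => x; ring.
have kc : continuous (fun x => e * bump M.+1 x + C * \sum_i (1 - cos (tau i x)) * bump M.+1 x).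
  apply: continuous_addf; apply: continuous_mulf => //; exact: continuous_sumf.
have lc : continuous (fun x => (D x0 - D x) * bump M.+1 x).
  by apply: continuous_mulf => //; exact: continuous_subf.
rewrite ler_norml; apply/andP; split.
  rewrite lerNl -[X in X <= _]mulN1r -int3Z//; apply: le_int3 => //.
    exact: continuous_mulf.
  by move=> x _; have := key x; rewrite ler_norml => /andP[]; lra.
by apply: le_int3 => // x _; have := key x; rewrite ler_norml => /andP[].
Qed.

End korovkin.

Section inversion.
Variable R : realType.
Implicit Types g : space R -> R.

Lemma smooth_sevl (A : seq (term R)) n : smooth n (sevl A).
Proof.
split; first exact: sevl_torus.
elim: n A => [|n IH] A; first by split => //; exact: sevl_continuous.
split => [|i]; first exact: sevl_continuous.
have d x := is_derive_sevl A i x.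
split => [x|]; first by have [] := d x.
have -> : (fun x => 'D_(dir R i) (sevl A) x) = sevl (dlistx i A).
  by apply/funext => x; have [_ ->] := d x.
exact: IH.
Qed.

Lemma torus_ucB g h : torus_uc g -> torus_uc h -> torus_uc (fun x => g x - h x).
Proof.
move=> ug uh e e0; have e2 : 0 < e / 2 by rewrite divr_gt0.
have [C C0 hC] := ug _ e2; have [C' C'0 hC'] := uh _ e2.
exists (C + C') => [|x y]; first exact: addr_ge0.
have := hC x y; have := hC' x y; move: (\sum_i _) => s.
rewrite !ler_norml => /andP[? ?] /andP[? ?].
by apply/andP; split; lra.
Qed.

Lemma box_exhaust k : exists K, k \in box K.
Proof.
exists (`|k.1.1| + `|k.1.2| + `|k.2|)%N; rewrite mem_box.
by rewrite leq_addl -addnA leq_addr addnCA leq_addr.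
Qed.

(** The difference of [g] and the limit has zero coefficients: once a box contains [k], the partial
    sum and [g] have the same coefficient there, and uniform convergence preserves this. The index
    shift by [K] starts the sequence at such a box. *)
Theorem psum_uniform g : smooth 4 g ->
  exists2 err : nat -> R, err @ \oo --> 0 &
    forall N x, `|g x - sevl (psum g N) x| <= err N.
Proof.
move=> sg; have [err e0 [h hh]] := psum_cvg sg.
exists err => // N x.
suff -> : g x = h x by [].
have gc := smooth_continuous sg.
have hc : continuous h.
  by apply: (@uniform_limit_continuous _ _ h (fun N => sevl (psum g N)) err) => // n; exact: sevl_continuous.
apply/eqP; rewrite -subr_eq0; apply/eqP.
apply: (@korovkin R (fun x => g x - h x)) => [||]; first exact: continuous_subf.
- move=> k a b; have [K kK] := box_exhaust k.
  pose fn n x := (g x - sevl (psum g (n + K)) x) * sev (st k a b) x.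
  apply: (@int3_lim0 _ _ fn (fun n => err (n + K)%N * amp (st k a b))).
  + by apply: continuous_mulf; [exact: continuous_subf|exact: sev_continuous].
  + move=> n; apply: continuous_mulf; last exact: sev_continuous.
    by apply: continuous_subf => //; exact: sevl_continuous.
  + move=> n; rewrite /fn.
    under [X in int3 X]eq_fun do rewrite mulrBl.
    rewrite int3B; last 2 first.
    * by apply: continuous_mulf => //; exact: sev_continuous.
    * by apply: continuous_mulf; [exact: sevl_continuous|exact: sev_continuous].
    apply/eqP; rewrite subr_eq0; apply/eqP; rewrite -[RHS]/(pairing _ _).
    rewrite pairing_psum//; apply: box_subset kK; exact: leq_addl.
  + move=> n y _; rewrite -mulrBl normrM; apply: ler_pM => //; last exact: normr_ev.
    have -> : g y - h y - (g y - sevl (psum g (n + K)) y) =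
      - (h y - sevl (psum g (n + K)) y) by ring.
    by rewrite normrN.
  + rewrite -(mul0r (amp (st k a b))); apply: cvgM; last exact: cvg_cst.
    by rewrite cvg_shiftn.
- apply: (@torus_uc_lim _ _ (fun N x => g x - sevl (psum g N) x) err) => //.
    move=> n; apply: torus_ucB; apply: smooth_torus_uc; last exact: smooth_sevl.
    by do 3 apply: smoothW.
  move=> n y; rewrite (_ : _ - _ = - (h y - sevl (psum g n) y)); last by ring.
  by rewrite normrN.
Qed.

Lemma eq_spl (A A' B B' : freq3 -> R) N : A =1 A' -> B =1 B' -> spl A B N = spl A' B' N.
Proof. by move=> hA hB; apply: eq_map => k; rewrite hA hB. Qed.

Lemma dlistx_psum n g i N : smooth n.+1 g ->
  dlistx i (psum g N) = psum (fun x => 'D_(dir R i) g x) N.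
Proof.
move=> sg; have sd := smooth_derive i sg.
have gc := smooth_continuous sg; have gc' := smooth_continuous sd.
have gd x := smooth_is_derive i x sg.
rewrite /psum dlistx_spl; apply: eq_spl => k.
  by rewrite (fa_derive _ gc gc' gd sg.1).
by rewrite (fb_derive _ gc gc' gd sg.1).
Qed.

End inversion.

(** * Forces of forms (A) and (B) *)

Section drivable.
Variable R : realType.

(* The force is approximated by time derivatives of trigonometric polynomials
   [driveL nl al be N / Om] whose sup norms and gradients are at most 2 G + o(1). *)
Definition drivable (Om G : R) (Phi : R -> space R -> 'I_3 -> R) : Prop :=
  exists (nl : freq3 -> seq int) (al be : 'I_3 -> freq3 * int -> R) (Bn fe : nat -> R),
  [/\ 0 <= G,
      (forall k, (size (nl k) <= 2)%N) /\
      (forall k n, n \in nl k -> k2 R k != 0 -> (n%:~R : R) ^+ 2 <= k2 R k),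
      (forall j k n, k2 R k = 0 -> al j (k, n) = 0 /\ be j (k, n) = 0) /\
      (forall p, \sum_j (kc p.1 j)%:~R * al j p = 0 /\
                 \sum_j (kc p.1 j)%:~R * be j p = 0),
      (forall N j, \sum_(p <- modes nl N) k2 R p.1 * (al j p ^+ 2 + be j p ^+ 2)
         <= 12 * G ^+ 2) &
      [/\ forall N j z, `|evl Om (driveL nl al be N j) z| <= Bn N,
          forall N i j z, `|evl Om (dlist Om (Some i) (driveL nl al be N j)) z| <= Bn N,
          Bn @ \oo --> 2 * G,
          forall N j z,
            `|Phi z.2 z.1 j - Om^-1 * evl Om (dlist Om None (driveL nl al be N j)) z| <= fe N &
          fe @ \oo --> 0]].

(** The condition on [L] puts the high modes below one half of [E^2]; the condition on [Om] puts the
    low modes below [24 * 512 * 8 / 512^2 = 3 / 8] of it. *)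
Lemma low_high_split (nu G Om E : R) (L : nat) : 0 < nu -> 0 < Om -> 0 < E -> 0 <= G ->
  2 * (24 * 512 * 1024) * G ^+ 2 / (nu ^+ 2 * E ^+ 2) <= L.+1%:R -> 512 * L%:R * G / E <= Om ->
  2 * (12 * G ^+ 2) * (512 * (8 * L%:R ^+ 2 / Om ^+ 2 + 1024 / (nu ^+ 2 * L.+1%:R))) <= E ^+ 2.
Proof.
move=> nu0 Om0 E0 G0 hL hO.
have L1 : 0 < L.+1%:R :> R by rewrite ltr0n.
have nE : 0 < nu ^+ 2 * E ^+ 2 by rewrite mulr_gt0// exprn_gt0.
have h1 : (512 * 512) * (L%:R ^+ 2 * G ^+ 2 / Om ^+ 2) <= E ^+ 2.
  move: hO; rewrite ler_pdivrMr// => hO.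
  have p0 : 0 <= 512 * L%:R * G.
    by apply: mulr_ge0 => //; apply: mulr_ge0; exact: ler0n.
  have : (512 * L%:R * G) ^+ 2 <= (Om * E) ^+ 2.
    rewrite ler_sqr ?nnegrE//; exact: le_trans hO.
  rewrite (exprMn _ Om E) [Om ^+ 2 * _]mulrC -ler_pdivrMr ?exprn_gt0//.
  have -> : (512 * L%:R * G) ^+ 2 / Om ^+ 2 = 512 * 512 * (L%:R ^+ 2 * G ^+ 2 / Om ^+ 2).
    by field; rewrite gt_eqF.
  exact.
have h2 : 2 * (24 * 512 * 1024) * (G ^+ 2 / (nu ^+ 2 * L.+1%:R)) <= E ^+ 2.
  move: hL; rewrite ler_pdivrMr// => hL.
  have nL : 0 < nu ^+ 2 * L.+1%:R by rewrite mulr_gt0// exprn_gt0.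
  rewrite mulrA ler_pdivrMr//.
  by rewrite (_ : E ^+ 2 * _ = L.+1%:R * (nu ^+ 2 * E ^+ 2)); last by ring.
rewrite (_ : 2 * _ * _ = (24 * 512 * 8) * (L%:R ^+ 2 * G ^+ 2 / Om ^+ 2)
  + (24 * 512 * 1024) * (G ^+ 2 / (nu ^+ 2 * L.+1%:R))).
  have := sqr_ge0 E; move: h1 h2; move: (L%:R ^+ 2 * G ^+ 2 / Om ^+ 2) (G ^+ 2 / (nu ^+ 2 * L.+1%:R)) => X Y; lra.
move: (L.+1%:R : R) L1 => l l0.
by field; rewrite !gt_eqF.
Qed.

Theorem ns_of_drivable (nu G : R) : 0 < nu ->
  exists2 Om0, 0 < Om0 & forall Om Phi, Om0 <= Om -> drivable Om G Phi ->
    exists2 v : stfield R, periodic_NS_solution nu (2 * pi / Om) Phi v &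
      (Linfty_norm (2 * pi / Om) v <= (45 * (1 + nu) * G / Om)%:E)%E.
Proof.
move=> nu0.
(* With [D = 320 G / Om] the weighted quadratic term becomes [36 * 9 / 648 * G / Om], exactly
   [r / 2]. As [E] depends on [nu] alone, [L] and then the threshold depend on [nu] and [G]
   alone. *)
pose E := nu / (648 * 320).
have E0 : 0 < E by apply: divr_gt0 => //; rewrite ltr0n.
pose L := Num.truncn (2 * (24 * 512 * 1024) * G ^+ 2 / (nu ^+ 2 * E ^+ 2)).
have hL : 2 * (24 * 512 * 1024) * G ^+ 2 / (nu ^+ 2 * E ^+ 2) <= L.+1%:R by apply/ltW/truncnS_gt.
(* [a] makes [r] small enough for the contraction condition, [b] is the low-mode condition. The
   absolute value appears because the sign of [G] is known only once a drivable force is given. *)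
pose a := 144 * `|G| / nu; pose b := 512 * L%:R * `|G| / E.
have a0 : 0 <= a by apply: divr_ge0; [apply: mulr_ge0; [exact: ler0n|exact: normr_ge0]|exact: ltW].
have b0 : 0 <= b.
  apply: divr_ge0; last exact: ltW.
  by apply: mulr_ge0; [apply: mulr_ge0; exact: ler0n|exact: normr_ge0].
exists (1 + a + b) => [|Om Phi hO]; first lra.
move=> [nl [al [be [Bn [fe [G0 [s2 nk] [c0 cd] pars [d1 d2 BB dP f0]]]]]]].
have Om0 : 0 < Om by lra.
have hG : `|G| = G by rewrite ger0_norm.
rewrite /a /b hG in a0 b0 hO.
(* 320 is a round number whose square exceeds [8192 * 12], the bound [12 G^2] being the one on the
   gradient coefficients. *)
pose D := 320 * G / Om; pose r := G / Om.
have r0 : 0 <= r by rewrite divr_ge0// ltW.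
have rE : r * (144 / nu) <= 1.
  rewrite /r mulrAC ler_pdivrMr// mul1r (_ : G * _ = 144 * G / nu); last by ring.
  by lra.
have D0 : 0 <= D by apply: divr_ge0; [apply: mulr_ge0 => //; exact: ler0n|exact: ltW].
have hD : 8192 * (12 * G ^+ 2) / Om ^+ 2 <= D ^+ 2.
  rewrite /D expr_div_n; apply: ler_wpM2r; first by rewrite invr_ge0 sqr_ge0.
  by have := sqr_ge0 G; rewrite exprMn; lra.
have nn : nu / nu = 1 by rewrite divff// gt_eqF.
have h3 : 36 / nu * (9 * (E * D)) <= r / 2.
  rewrite (_ : 36 / nu * _ = (36 * 9 / 648) * (nu / nu) * r); last first.
    by rewrite /E /D /r; field; rewrite !gt_eqF.
  by rewrite nn mulr1 (_ : 36 * 9 / 648 = 2^-1 :> R) 1?mulrC//; field.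
have h4 : 36 / nu * (2 * (3 * E) + r) <= 2^-1.
  rewrite (_ : 36 / nu * _ = (36 * 6 / (648 * 320)) * (nu / nu) + r * (144 / nu) / 4); last first.
    by rewrite /E; field; rewrite gt_eqF.
  by rewrite nn mulr1; lra.
have hO' : 512 * L%:R * G / E <= Om by lra.
have [v vs vb] := ns_of_modes nu0 Om0 s2 nk c0 cd pars d1 d2 BB dP f0 (ltW E0) D0 r0
  (low_high_split nu0 Om0 E0 G0 hL hO') hD h3 h4.
(* [15 = 7 * 2 + 1] collects the pointwise bound of the response to a drive of size [2 G] and the
   radius [r]; the factor 3 is that of [Linfty_norm_le]. *)
exists v => //; have -> : 45 * (1 + nu) * G / Om = 3 * (15 * r + 15 * nu * r) by rewrite /r; ring.
apply: Linfty_norm_le => j z; apply: le_trans (vb j z) _.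
have -> : 7 * (2 * G) / Om + r = 15 * r by rewrite /r; ring.
by rewrite lerDl mulr_ge0// mulr_ge0// ltW.
Qed.

End drivable.

Section field_coefficients.
Variable R : realType.
Implicit Types (F : field R).

Lemma ereal_sup_ge0 (T : Type) (f : T -> R) (x : T) : (forall y, 0 <= f y) ->
  (0 <= ereal_sup [set (f y)%:E | y in [set: T]])%E.
Proof.
move=> f0; apply: le_trans (_ : (f x)%:E <= _)%E; first by rewrite lee_fin.
by apply: ereal_sup_ubound; exists x.
Qed.

Lemma C1norm_le F G : (C1norm F <= G%:E)%E ->
  (forall j x, `|F j x| <= G) /\ (forall i j x, `|'D_(dir R i) (F j) x| <= G).
Proof.
rewrite /C1norm.
set f := fun x => Num.sqrt (\sum_j F j x ^+ 2).
set f' := fun x => Num.sqrt (\sum_j \sum_i ('D_(dir R i) (F j) x) ^+ 2).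
move=> h.
have s0 : (0 <= ereal_sup [set (f y)%:E | y in [set: space R]])%E.
  by apply: (ereal_sup_ge0 0) => y; exact: sqrtr_ge0.
have s1 : (0 <= ereal_sup [set (f' y)%:E | y in [set: space R]])%E.
  by apply: (ereal_sup_ge0 0) => y; exact: sqrtr_ge0.
have le_sqrt (g : R) S : g ^+ 2 <= S -> `|g| <= Num.sqrt S.
  move=> gS; rewrite -ler_sqr ?nnegrE ?sqrtr_ge0// sqr_sqrtr ?real_normK ?num_real//.
  exact: le_trans (sqr_ge0 _) gS.
split => [j x|i j x].
  have : ((f x)%:E <= G%:E)%E.
    apply: le_trans h; apply: le_trans (leeDl _ s1).
    by apply: ereal_sup_ubound; exists x.
  rewrite lee_fin; apply: le_trans; apply: le_sqrt.
  by rewrite (bigD1 j)//= lerDl sumr_ge0// => l _; exact: sqr_ge0.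
have : ((f' x)%:E <= G%:E)%E.
  apply: le_trans h; apply: le_trans (leeDr _ s0).
  by apply: ereal_sup_ubound; exists x.
rewrite lee_fin; apply: le_trans; apply: le_sqrt.
rewrite (bigD1 j)//= (bigD1 i)//= -addrA lerDl addr_ge0//.
  by apply: sumr_ge0 => l _; exact: sqr_ge0.
by apply: sumr_ge0 => l _; apply: sumr_ge0 => l' _; exact: sqr_ge0.
Qed.

Lemma coefficients_mean F : mean_zero F -> forall j k, k2 R k = 0 ->
  fa (F j) k = 0 /\ fb (F j) k = 0.
Proof.
move=> mF j k k0.
have e (a b : R) (x : space R) : sev (st k a b) x = a.
  rewrite /sev /ev /phase big1 => [|i _]; last by rewrite ksq_eq0// mul0r.
  by rewrite mulr0 addr0 cos0 sin0 mulr1 mulr0 addr0.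
split.
  rewrite /fa /pairing; under [X in int3 X]eq_fun do rewrite e mulr1.
  by rewrite [int3 _]mF mulr0.
rewrite /fb /pairing; under [X in int3 X]eq_fun do rewrite e mulr0.
by rewrite int3_cst mul0r mulr0.
Qed.

Lemma coefficients_div n F : Cm_field n.+1 F -> div_free F -> forall k,
  \sum_j (kc k j)%:~R * fa (F j) k = 0 /\ \sum_j (kc k j)%:~R * fb (F j) k = 0.
Proof.
move=> cF dF k.
have sF j : smooth n.+1 (F j) by exact: cF.
have key t : \sum_j pairing (fun x => 'D_(dir R j) (F j) x) t = 0.
  rewrite -int3_sum; last first.
    move=> j; apply: continuous_mulf; last exact: sev_continuous.
    exact: smooth_continuous (smooth_derive j (sF j)).
  under [X in int3 X]eq_fun do rewrite -mulr_suml dF mul0r.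
  by rewrite int3_cst mul0r.
have d j := smooth_derive j (sF j).
split.
  have : \sum_j - ((kc k j)%:~R * fa (F j) k) = fc R * 0.
    rewrite -[X in _ * X](key (st k 0 1)) mulr_sumr; apply: eq_bigr => j _.
    by rewrite -(@fb_derive R j _ _ k (smooth_continuous (sF j)) (smooth_continuous (d j))
      (fun x => smooth_is_derive j x (sF j)) (sF j).1).
  by rewrite sumrN mulr0 => /eqP; rewrite oppr_eq0 => /eqP.
have : \sum_j (kc k j)%:~R * fb (F j) k = fc R * 0.
  rewrite -[X in _ * X](key (st k 1 0)) mulr_sumr; apply: eq_bigr => j _.
  by rewrite -(@fa_derive R j _ _ k (smooth_continuous (sF j)) (smooth_continuous (d j))
    (fun x => smooth_is_derive j x (sF j)) (sF j).1).
by rewrite mulr0.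
Qed.

(** Origin of the five derivatives: [psum_uniform] asks for four and is applied to the first
    derivatives as well. *)
Lemma field_approx F : Cm_field 5 F ->
  exists2 fe : nat -> R, fe @ \oo --> 0 & forall N,
   (forall j x, `|F j x - sevl (psum (F j) N) x| <= fe N) /\
   (forall i j x, `|'D_(dir R i) (F j) x - sevl (dlistx i (psum (F j) N)) x| <= fe N).
Proof.
move=> cF; have sF j : smooth 5 (F j) by exact: cF.
have /choice[e0 h0] : forall j, exists e : nat -> R, e @ \oo --> 0 /\
    forall N x, `|F j x - sevl (psum (F j) N) x| <= e N.
  by move=> j; have [e ? ?] := psum_uniform (smoothW (sF j)); exists e.
have /choice[e1 h1] : forall p : 'I_3 * 'I_3, exists e : nat -> R, e @ \oo --> 0 /\
    forall N x, `|'D_(dir R p.1) (F p.2) x - sevl (dlistx p.1 (psum (F p.2) N)) x| <= e N.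
  move=> p; have [e ? h] := psum_uniform (smooth_derive p.1 (sF p.2)); exists e; split => // N x.
  by rewrite (dlistx_psum p.1 N (sF p.2)).
have e0_ge0 j N : 0 <= e0 j N by apply: le_trans ((h0 j).2 N 0).
have e1_ge0 p N : 0 <= e1 p N by apply: le_trans ((h1 p).2 N 0).
exists (fun N => \sum_j e0 j N + \sum_p e1 p N).
  rewrite -[X in _ --> X](addr0 (0 : R)); apply: cvgD; apply: cvg_sum0.
    by move=> j; exact: (h0 j).1.
  by move=> p; exact: (h1 p).1.
move=> N; have s0 : 0 <= \sum_j e0 j N by exact: sumr_ge0.
have s1 : 0 <= \sum_p e1 p N by exact: sumr_ge0.
split => [j x|i j x].
  apply: le_trans ((h0 j).2 N x) _; rewrite (bigD1 j)//= -addrA lerDl addr_ge0//.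
  exact: sumr_ge0.
apply: le_trans ((h1 (i, j)).2 N x) _; rewrite [leRHS]addrC (bigD1 (i, j))//= -addrA lerDl.
by rewrite addr_ge0// sumr_ge0.
Qed.

Lemma monotone_bound (P Bn : nat -> R) (B : R) :
  (forall N M, (N <= M)%N -> P N <= P M) -> (forall N, P N <= 3 * Bn N ^+ 2) ->
  Bn @ \oo --> B -> forall N, P N <= 3 * B ^+ 2.
Proof.
move=> mono hP BB N; rewrite -subr_le0.
apply: (@le0_of_cvg _ _ (fun n => 3 * Bn (n + N)%N ^+ 2 - 3 * B ^+ 2)).
  move=> n; rewrite lerD2r; apply: le_trans (hP _); apply: mono; exact: leq_addl.
rewrite -(subrr (3 * B ^+ 2)); apply: cvgB; last exact: cvg_cst.
apply: cvgM; first exact: cvg_cst.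
have := BB; rewrite -(cvg_shiftn N) => c.
by rewrite expr2; under eq_fun do rewrite expr2; apply: cvgM.
Qed.

(** Bessel's inequality in three directions with bound [2 G] gives [12 = 3 * 2^2]. The error in [Bn]
    disappears because the sums increase with the cut-off. *)
Lemma gradient_coefficients_limit (A B : freq3 -> R) (Bn : nat -> R) (G : R) :
  (forall k, A (oppk k) = A k) -> (forall k, B (oppk k) = - B k) ->
  (forall N i x, `|sevl (dlistx i (spl A B N)) x| <= Bn N) -> Bn @ \oo --> 2 * G ->
  forall N, \sum_(k <- box N) k2 R k * (A k ^+ 2 + B k ^+ 2) <= 12 * G ^+ 2.
Proof.
move=> Ae Bo hB BB; have <- : 3 * (2 * G) ^+ 2 = 12 * G ^+ 2 by ring.
apply: monotone_bound BB => [M M' MM'|M].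
  apply: le_sum_subset => [|||k]; [exact: box_uniq|exact: box_uniq|exact: box_subset|].
  by rewrite mulr_ge0 ?k2_ge0// addr_ge0// sqr_ge0.
by apply: gradient_coefficients_le.
Qed.

End field_coefficients.

(** * Form (B): standing oscillations *)

Section oscillating.
Variable R : realType.
Variables (Om : R) (A B : freq3 -> R).

(** Represents [- g cos (Om t)]: each spatial mode is split evenly between the time frequencies 1
    and -1. *)
Definition oscL N : seq (term R) :=
  [seq Term (kc p.1) p.2 (- A p.1 / 2) (- B p.1 / 2)
  | p <- modes (fun=> [:: 1; -1]) N].

Lemma big_osc (phi : freq3 * int -> R) N :
  \sum_(p <- modes (fun=> [:: 1; -1]) N) phi p =
  \sum_(k <- box N) (phi (k, 1) + phi (k, -1)).
Proof. by rewrite sum_modes; apply: eq_bigr => k _; rewrite !big_cons big_nil addr0. Qed.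

Lemma phase_pm (k : freq3) (n : int) (a b : R) (x : space R) t :
  phase Om (Term (kc k) n a b) (x, t) = phase 1 (st k 0 0) (x, 0) + n%:~R * (Om * t).
Proof. by rewrite /phase /nr/= mulr0 addr0 mulrA. Qed.

Lemma evl_osc N x t : evl Om (oscL N) (x, t) = - (cos (Om * t) * sevl (spl A B N) x).
Proof.
rewrite /evl /tsum /oscL big_map big_osc sevl_spl mulr_sumr -sumrN.
apply: eq_bigr => k _.
rewrite /sev /ev -[phase 1 _ _]/(phase 1 (st k 0 0) (x, 0)) !phase_pm !mulrNz !mul1r !mulN1r !cosD !sinD cosN sinN /=.
move: (phase _ _ _) => th; by field.
Qed.

Lemma evl_osc_dt N x t : evl Om (dlist Om None (oscL N)) (x, t) =
  Om * (sin (Om * t) * sevl (spl A B N) x).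
Proof.
rewrite /dlist /evl tsum_map /tsum /oscL big_map big_osc sevl_spl !mulr_sumr.
apply: eq_bigr => k _.
have pm p q u z : phase Om (mulc p q u) z = phase Om u z by [].
have pp n a b := phase_pm k n a b x t.
rewrite /sev /ev -[phase 1 _ _]/(phase 1 (st k 0 0) (x, 0)) /dfrq /comp !pm.
move: (phase 1 (st k 0 0) (x, 0)) pp => th pp.
rewrite !pp !mulrNz !mul1r !mulN1r !cosD !sinD cosN sinN /= /nr /=.
by field.
Qed.

End oscillating.

Lemma dlist_osc (R : realType) (Om : R) (A B : freq3 -> R) i N :
  dlist Om (Some i) (oscL A B N) =
  oscL (fun k => (kc k i)%:~R * B k) (fun k => - ((kc k i)%:~R * A k)) N.
Proof.
rewrite /dlist /oscL -map_comp; apply: eq_map => p /=.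
by congr Term; rewrite /=; ring.
Qed.

Lemma drivable_B (R : realType) (G Om : R) Phi : 0 < Om -> force_B 5 G Phi ->
  drivable Om G (Phi Om).
Proof.
move=> Om0 [f [[cf df] mf hG hPhi]].
have [fG dfG] := C1norm_le hG.
have [fe fe0 hfe] := field_approx cf.
have G0 : 0 <= G := le_trans (normr_ge0 _) (fG ord0 0).
pose nl (k : freq3) : seq int := [:: 1; -1].
pose al j (p : freq3 * int) := - fa (f j) p.1 / 2.
pose be j (p : freq3 * int) := - fb (f j) p.1 / 2.
have dE N j : driveL nl al be N j = oscL (fa (f j)) (fb (f j)) N by [].
have dEx N i j : dlist Om (Some i) (driveL nl al be N j) =
    oscL (fun k => (kc k i)%:~R * fb (f j) k) (fun k => - ((kc k i)%:~R * fa (f j) k)) N.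
  by rewrite dE dlist_osc.
have sb N j x : `|sevl (psum (f j) N) x| <= 2 * G + fe N.
  have [/(_ j x) h1 _] := hfe N; have h2 := fG j x.
  move: h1 h2; rewrite !ler_norml => /andP[? ?] /andP[? ?]; apply/andP; split; lra.
have sdb N i j x : `|sevl (dlistx i (psum (f j) N)) x| <= 2 * G + fe N.
  have [_ /(_ i j x) h1] := hfe N; have h2 := dfG i j x.
  move: h1 h2; rewrite !ler_norml => /andP[? ?] /andP[? ?]; apply/andP; split; lra.
have trig_le (c s : R) : `|c| <= 1 -> `|c * s| <= `|s|.
  by move=> c1; rewrite normrM ler_piMl.
have cos1 (s : R) : `|cos s| <= 1 by rewrite ler_norml cos_geN1 cos_le1.
have sin1 (s : R) : `|sin s| <= 1 by rewrite ler_norml sin_geN1 sin_le1.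
have BB : (fun N => 2 * G + fe N) @ \oo --> 2 * G.
  by rewrite -[X in _ --> X]addr0; apply: cvgD => //; exact: cvg_cst.
exists nl, al, be, (fun N => 2 * G + fe N), fe; split => //.
- split => // k n; rewrite !inE => hn k0.
  have -> : (n%:~R : R) ^+ 2 = 1 by case/orP: hn => /eqP ->; rewrite ?mulrNz ?sqrrN expr1n.
  exact: (@ksq_ge1 R (st k 0 0)).
- split => [j k n k0|p].
    by have [a0 b0] := coefficients_mean mf j k0; rewrite /al /be /= a0 b0 oppr0 mul0r.
  have [ha hb] := coefficients_div cf df p.1.
  have half (c : 'I_3 -> R) : \sum_j (kc p.1 j)%:~R * c j = 0 ->
      \sum_j (kc p.1 j)%:~R * (- c j / 2) = 0.
    move=> h; rewrite (eq_bigr (fun j => - 2^-1 * ((kc p.1 j)%:~R * c j))).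
      by rewrite -mulr_sumr h mulr0.
    by move=> j _; ring.
  by split; exact: half.
- move=> N j; rewrite big_osc.
  have h : \sum_(k <- box N) k2 R k * (fa (f j) k ^+ 2 + fb (f j) k ^+ 2) <= 12 * G ^+ 2.
    apply: gradient_coefficients_limit BB N => [k|k|M i x]; [exact: fa_oppk| |exact: sdb].
    by apply: fb_oppk; exact: (smooth_continuous (cf j)).
  rewrite (eq_bigr (fun k => 2^-1 * (k2 R k * (fa (f j) k ^+ 2 + fb (f j) k ^+ 2)))).
    rewrite -mulr_sumr; have := sqr_ge0 G; lra.
  by move=> k _; rewrite /al /be /=; field.
- split => //.
  + move=> N j [x t]; rewrite dE evl_osc normrN.
    by apply: le_trans (sb N j x); exact: trig_le.
  + move=> N i j [x t]; rewrite dEx evl_osc normrN -dlistx_spl.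
    by apply: le_trans (sdb N i j x); exact: trig_le.
  + move=> N j [x t]; rewrite dE evl_osc_dt mulKf ?gt_eqF// hPhi// -[(x, t).2]/t -[(x, t).1]/x.
    rewrite [f j x * _]mulrC -mulrBr; have [h _] := hfe N.
    by apply: le_trans (h j x); exact: trig_le.
Qed.

Lemma is_derive_subf (R : realType) (E : normedModType R) (f g : E -> R) (x v : E) (df dg : R) :
  is_derive x v f df -> is_derive x v g dg ->
  is_derive x v (fun y => f y - g y) (df - dg).
Proof. by move=> hf hg; exact: is_deriveB. Qed.

(* As p is periodic, its derivative q vanishes somewhere on the period. *)
Lemma line_bound (R : realType) (p q u h v : R -> R) (M e : R) :
  (forall s, is_derive s (1 : R) p (q s)) -> p (2 * pi) = p 0 ->
  (forall s, is_derive s (1 : R) q (u s)) -> (forall s, is_derive s (1 : R) h (v s)) ->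
  (forall s, `|h s| <= M) -> (forall s, `|u s - v s| <= e) ->
  `|q 0| <= 2 * M + 2 * pi * e.
Proof.
move=> pd pp qd hd hM he; have tp := twopi_gt0 R.
have [c /andP[c0 c1]] := mvt_line (ltW tp) pd.
rewrite pp subrr subr0 => /esym/eqP; rewrite mulf_eq0 (gt_eqF tp) orbF => /eqP qc.
have e0 : 0 <= e := le_trans (normr_ge0 _) (he 0).
have gd s : is_derive s (1 : R) (fun s => q s - h s) (u s - v s).
  by exact: is_derive_subf (qd s) (hd s).
have l := lipschitz_line 0 c gd he.
rewrite subr0 (ger0_norm c0) qc in l.
have := hM 0; have := hM c.
have : e * c <= 2 * pi * e by rewrite mulrC ler_wpM2r.
move: l; rewrite !ler_norml => /andP[? ?] ? /andP[? ?] /andP[? ?].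
by apply/andP; split; lra.
Qed.

Lemma derive_le_lipschitz (R : realType) (f : R -> R) (d c : R) :
  is_derive (0 : R) (1 : R) f d -> (forall s, 0 < s -> `|f s - f 0| <= c * s) -> `|d| <= c.
Proof.
move=> fd hf.
have up (g : R -> R) (d' : R) : is_derive (0 : R) (1 : R) g d' ->
    (forall s, 0 < s -> g s - g 0 <= c * s) -> d' <= c.
  move=> gd hg; rewrite leNgt; apply/negP => cd.
  have kd : is_derive (0 : R) (1 : R) (fun s => g s - c * s) (d' - c).
    have e : is_derive (0 : R) (1 : R) (fun s : R => c * s) c.
      by apply: is_derive_eq; rewrite /GRing.scale/= mulr1.
    exact: is_derive_subf gd e.
  have [|e e0 he] := derive_gt0_right kd; first by rewrite subr_gt0.
  have s0 : 0 < e / 2 < e by rewrite divr_gt0//= ltr_pdivrMr// ltr_pMr// ltr1n.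
  have := he _ s0; have := hg (e / 2) _; rewrite add0r mulr0 subr0.
  by case/andP: s0 => s0 _ /(_ s0); lra.
rewrite ler_norml; apply/andP; split.
  rewrite lerNl; apply: (up (fun s => - f s)).
  by move=> s s0; have := hf s s0; rewrite ler_norml => /andP[]; lra.
by apply: (up f) => // s s0; have := hf s s0; rewrite ler_norml => /andP[].
Qed.

(** * Form (A): the antiderivative in the first variable and its bounds *)

Section antiderivative.
Variable R : realType.
Implicit Types (A B : freq3 -> R) (x : space R).

Definition k1 (k : freq3) : R := (kc k ord0)%:~R.

(* Coefficients of the antiderivative in the first variable; division by zero
   only occurs for modes with zero amplitude. *)
Definition antia B k : R := - (B k / k1 k).
Definition antib A k : R := A k / k1 k.

Lemma dlistx_anti A B N : (forall k, k1 k = 0 -> A k = 0 /\ B k = 0) ->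
  dlistx ord0 (spl (antia B) (antib A) N) = spl A B N.
Proof.
move=> h; rewrite dlistx_spl; apply: eq_spl => k; rewrite -/(k1 k) /antia /antib.
  have [k0|k0] := eqVneq (k1 k) 0; first by rewrite (h _ k0).1 k0 mul0r.
  by rewrite mulrC divfK.
have [k0|k0] := eqVneq (k1 k) 0; first by rewrite (h _ k0).2 k0 mul0r oppr0.
by rewrite mulrN opprK mulrC divfK.
Qed.

Lemma sevl_line_derive (L : seq (term R)) x i s :
  is_derive s (1 : R) (fun s => sevl L (x + s *: dir R i)) (sevl (dlistx i L) (x + s *: dir R i)).
Proof.
apply: (@is_derive_space_line R (sevl L) (sevl (dlistx i L))) => y; exact: is_derive_sevl.
Qed.

Variables (A B : freq3 -> R) (N : nat).
Hypothesis k10 : forall k, k1 k = 0 -> A k = 0 /\ B k = 0.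
Variables (F : space R -> R) (H : R -> space R -> R) (G e : R).
Hypothesis G0 : 0 <= G.
Hypothesis HF : forall x s, is_derive s (1 : R) (fun s => H s x) (F (x + s *: dir R ord0)).
Hypothesis HG : forall s x, `|H s x| <= G.
Hypothesis Fe : forall x, `|F x - sevl (spl A B N) x| <= e.

Let kap := spl (antia B) (antib A) N.
(** The second antiderivative: a periodic function whose derivative along [x_1] is [kap], which
    forces [kap] to vanish somewhere on each line. *)
Let prim := spl (antia (antib A)) (antib (antia B)) N.

Let kap0 k : k1 k = 0 -> antia B k = 0 /\ antib A k = 0.
Proof. by move=> h; have [a b] := k10 h; rewrite /antia /antib a b !mul0r oppr0. Qed.

Let kd x s : is_derive s (1 : R) (fun s => sevl kap (x + s *: dir R ord0))
   (sevl (spl A B N) (x + s *: dir R ord0)).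
Proof. by rewrite -(dlistx_anti N k10); exact: sevl_line_derive. Qed.

Let pd x s : is_derive s (1 : R) (fun s => sevl prim (x + s *: dir R ord0))
   (sevl kap (x + s *: dir R ord0)).
Proof. by rewrite /kap -(dlistx_anti N kap0); exact: sevl_line_derive. Qed.

Let pper x : sevl prim (x + (2 * pi) *: dir R ord0) = sevl prim (x + 0 *: dir R ord0).
Proof. by rewrite scale0r addr0 sevl_torus. Qed.

(** Along a line in direction [x_1], [kap] and [H] have derivatives that differ by at most [e].
    Measured from a zero of [kap], its size is then at most the oscillation [2 G] of [H] plus [e]
    times the period. *)
Lemma antiderivative_bound x : `|sevl kap x| <= 2 * G + 2 * pi * e.
Proof.
have := @line_bound R _ _ _ (fun s => H s x) _ G e (pd x) (pper x) (kd x) (HF x) (HG ^~ x).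
rewrite scale0r addr0; apply => s; rewrite distrC; exact: Fe.
Qed.

Variable i : 'I_3.
Variables (F' : space R -> R) (H' : R -> space R -> R).
Hypothesis Fd : forall x, is_derive x (dir R i) F (F' x).
Hypothesis Hd : forall s x, is_derive x (dir R i) (H s) (H' s x).
Hypothesis HG' : forall s x, `|H' s x| <= G.
Hypothesis Fe' : forall x, `|F' x - sevl (dlistx i (spl A B N)) x| <= e.

(** No derivative in [s] is available for the gradient of [H], so the previous argument cannot be
    differentiated. It is applied instead to differences along two parallel lines at distance [d],
    where the gradient bounds supply a factor [d]. *)
Lemma antiderivative_lipschitz x d : 0 < d ->
  `|sevl kap (x + d *: dir R i) - sevl kap x| <= (2 * G + 2 * pi * e) * d.
Proof.
move=> d0; set y := x + d *: dir R i.
have := @line_bound R (fun s => sevl prim (y + s *: dir R ord0) - sevl prim (x + s *: dir R ord0))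
  (fun s => sevl kap (y + s *: dir R ord0) - sevl kap (x + s *: dir R ord0))
  (fun s => sevl (spl A B N) (y + s *: dir R ord0) - sevl (spl A B N) (x + s *: dir R ord0))
  (fun s => H s y - H s x) (fun s => F (y + s *: dir R ord0) - F (x + s *: dir R ord0))
  (G * d) (e * d).
rewrite scale0r !addr0 (_ : _ + _ = (2 * G + 2 * pi * e) * d); last by ring.
apply.
- by move=> s; exact: is_derive_subf (pd y s) (pd x s).
- by rewrite !pper scale0r !addr0.
- by move=> s; exact: is_derive_subf (kd y s) (kd x s).
- move=> s; have := lipschitz_line 0 d (fun t => is_derive_space_line x t (Hd s)) (fun t => HG' s _).
  by rewrite scale0r addr0 subr0 (gtr0_norm d0).
- move=> s; set w := x + s *: dir R ord0.
  have -> : y + s *: dir R ord0 = w + d *: dir R i by rewrite /y /w addrAC.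
  have hd t : is_derive t (1 : R) (fun t => sevl (spl A B N) (w + t *: dir R i) - F (w + t *: dir R i))
     (sevl (dlistx i (spl A B N)) (w + t *: dir R i) - F' (w + t *: dir R i)).
    by exact: is_derive_subf (sevl_line_derive _ w i t) (is_derive_space_line w t Fd).
  have := lipschitz_line (K := e) 0 d hd.
  rewrite scale0r addr0 subr0 (gtr0_norm d0) => h.
  set a := sevl _ _ in h *; set b := sevl _ _ in h *.
  rewrite (_ : a - b - _ = a - F (w + d *: dir R i) - (b - F w)); last by ring.
  by apply: h => t; rewrite distrC; exact: Fe'.
Qed.

Lemma antiderivative_gradient_bound x : `|sevl (dlistx i kap) x| <= 2 * G + 2 * pi * e.
Proof.
have h := sevl_line_derive kap x i 0; rewrite scale0r addr0 in h.
apply: (derive_le_lipschitz h) => s s0; rewrite scale0r addr0.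
exact: antiderivative_lipschitz.
Qed.

End antiderivative.

(** * Form (A): travelling waves *)

Section travelling.
Variable R : realType.
Variables (Om : R) (a b : freq3 -> R).

Definition travL N : seq (term R) :=
  [seq Term (kc p.1) p.2 (a p.1) (b p.1) | p <- modes (fun k => [:: kc k ord0]) N].

Lemma big_trav (phi : freq3 * int -> R) N :
  \sum_(p <- modes (fun k => [:: kc k ord0]) N) phi p =
  \sum_(k <- box N) phi (k, kc k ord0).
Proof. by rewrite sum_modes; apply: eq_bigr => k _; rewrite big_seq1. Qed.

Lemma phase_trav (k : freq3) (u v : R) (x : space R) t :
  phase Om (Term (kc k) (kc k ord0) u v) (x, t) =
  phase 1 (st k u v) (x + (Om * t) *: dir R ord0, 0).
Proof.
rewrite /phase /= /kr /nr /=; under [in RHS]eq_bigr do rewrite coordD coordZ coord_dir mulrDr.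
rewrite big_split/= mulr0 addr0; congr (_ + _).
rewrite (bigD1 ord0)//= big1 => [|i i0]; last by rewrite (negbTE i0) !mulr0.
by rewrite /= mulr1 addr0 mulrA.
Qed.

Lemma evl_trav N x t : evl Om (travL N) (x, t) = sevl (spl a b N) (x + (Om * t) *: dir R ord0).
Proof.
rewrite /evl /tsum /travL big_map big_trav sevl_spl; apply: eq_bigr => k _.
by rewrite /sev /ev (phase_trav k (a k) (b k)).
Qed.

End travelling.

Lemma dlist_trav (R : realType) (Om : R) (a b : freq3 -> R) i N :
  dlist Om (Some i) (travL a b N) =
  travL (fun k => (kc k i)%:~R * b k) (fun k => - ((kc k i)%:~R * a k)) N.
Proof.
rewrite /dlist /travL -map_comp; apply: eq_map => p /=.
by congr Term; rewrite /=; ring.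
Qed.

Lemma evl_trav_dt (R : realType) (Om : R) (a b : freq3 -> R) N x t :
  evl Om (dlist Om None (travL a b N)) (x, t) =
  Om * sevl (dlistx ord0 (spl a b N)) (x + (Om * t) *: dir R ord0).
Proof.
rewrite dlistx_spl -evl_trav /evl /dlist tsum_map /tsum /travL !big_map !big_trav mulr_sumr.
apply: eq_bigr => k _.
have pm p q u z : phase Om (mulc p q u) z = phase Om u z by [].
have pp u v : phase Om (Term (kc k) (kc k ord0) u v) (x, t) =
  phase Om (Term (kc k) (kc k ord0) 0 0) (x, t) by [].
rewrite /comp /ev pm !(pp (_ : R)).
move: (phase Om _ _) => th; rewrite /= /nr /=; ring.
Qed.

Lemma fourier_coefficients (R : realType) (g : space R -> R) k :
  fourier g (kc k) = Complex (fa g k) (- fb g k).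
Proof.
have e (a b : R) (x : space R) : sev (st k a b) x =
    a * cos (\sum_i (kc k i)%:~R * coord i x) + b * sin (\sum_i (kc k i)%:~R * coord i x).
  by rewrite /sev /ev /phase /= mulr0 addr0.
rewrite /fourier /fa /fb /pairing /int3.
congr Complex; [|congr (- _)]; congr (_ * Rintegral _ _ _); apply/funext => x; rewrite e.
  by rewrite mul1r mul0r addr0.
by rewrite mul0r mul1r add0r.
Qed.

Lemma drivable_A (R : realType) (G Om : R) Phi : 0 < Om -> force_A 5 G Phi ->
  drivable Om G (Phi Om).
Proof.
move=> Om0 [F [[cF dF] mF zF [H [cH HF HG]] hPhi]].
have C1 s : (C1norm (H s) <= G%:E)%E.
  apply: le_trans (HG 1 ltr01).
  by apply: ereal_sup_ubound; exists s; rewrite ?mul1r.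
have hG s j x : `|H s j x| <= G by exact: (C1norm_le (C1 s)).1.
have hdG s i j x : `|'D_(dir R i) (H s j) x| <= G by exact: (C1norm_le (C1 s)).2.
have G0 : 0 <= G := le_trans (normr_ge0 _) (hG 0 ord0 0).
(* The relation between [H] and [F] at frequency 1 says that [F (x_1 + s, x')] is the derivative of
   [H] in [s]. *)
have hd j x s : is_derive s (1 : R) (fun s => H s j x) (F j (x + s *: dir R ord0)).
  have := HF 1 x s j ltr01; rewrite mul1r.
  have -> // : (fun t' => 1^-1 * H (1 * t') j x) = fun s => H s j x.
  by apply/funext => t; rewrite invr1 !mul1r.
have [fe fe0 hfe] := field_approx cF.
(* This is where the vanishing of the coefficients with [k_1 = 0] enters: it makes the division by
   [k_1] in [antia] and [antib] legitimate. *)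
have z j k : k1 R k = 0 -> fa (F j) k = 0 /\ fb (F j) k = 0.
  move=> /eqP; rewrite intr_eq0 => /eqP k0.
  have := zF (kc k) k0 j; rewrite fourier_coefficients => -[-> /eqP].
  by rewrite oppr_eq0 => /eqP.
pose nl (k : freq3) : seq int := [:: kc k ord0].
pose al j (p : freq3 * int) := antia (fb (F j)) p.1.
pose be j (p : freq3 * int) := antib (fa (F j)) p.1.
pose Bn N := 2 * G + 2 * pi * fe N.
have sF j : smooth 5 (F j) by exact: cF.
have sH s j : smooth 1 (H s j) by exact: (cH s).1.
have dE N j : driveL nl al be N j = travL (antia (fb (F j))) (antib (fa (F j))) N by [].
have kb N j x : `|sevl (spl (antia (fb (F j))) (antib (fa (F j))) N) x| <= Bn N.
  by apply: (antiderivative_bound (z j) (hd j) (fun s x => hG s j x) ((hfe N).1 j)).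
have dkb N i j x : `|sevl (dlistx i (spl (antia (fb (F j))) (antib (fa (F j))) N)) x| <= Bn N.
  apply: (@antiderivative_gradient_bound R (fa (F j)) (fb (F j)) N (z j) (F j)
    (fun s x => H s j x) G (fe N) (hd j) i _ (fun s x => 'D_(dir R i) (H s j) x)) => //.
  - by move=> y; exact: (smooth_is_derive i y (sF j)).
  - by move=> s y; exact: (smooth_is_derive i y (sH s j)).
  - by move=> y; exact: (hfe N).2.
have BB : Bn @ \oo --> 2 * G.
  rewrite -[X in _ --> X]addr0 -(mulr0 (2 * pi)).
  by apply: cvgD; [exact: cvg_cst|apply: cvgM => //; exact: cvg_cst].
exists nl, al, be, Bn, fe; split => //.
- split => // k n; rewrite inE => /eqP -> _.
  by rewrite /k2 (bigD1 ord0)//= lerDl sumr_ge0// => i _; exact: sqr_ge0.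
- split => [j k n k0|p].
    have [a0 b0] := coefficients_mean mF j k0.
    by rewrite /al /be /antia /antib/= a0 b0 !mul0r oppr0.
  have [ha hb] := coefficients_div cF dF p.1; split.
    rewrite (eq_bigr (fun j => - (k1 R p.1)^-1 * ((kc p.1 j)%:~R * fb (F j) p.1))).
      by rewrite -mulr_sumr hb mulr0.
    by move=> j _; rewrite /al /antia; ring.
  rewrite (eq_bigr (fun j => (k1 R p.1)^-1 * ((kc p.1 j)%:~R * fa (F j) p.1))).
    by rewrite -mulr_sumr ha mulr0.
  by move=> j _; rewrite /be /antib; ring.
- move=> N j; rewrite big_trav /al /be /=.
  have k1o k : k1 R (oppk k) = - k1 R k by rewrite /k1 kc_oppk mulrNz.
  apply: gradient_coefficients_limit BB N => [k|k|M i x]; last exact: dkb.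
    rewrite /antia k1o fb_oppk; last exact: (smooth_continuous (sF j)).
    by rewrite invrN mulrNN.
  by rewrite /antib k1o fa_oppk invrN mulrN.
- split => //.
  + by move=> N j [x t]; rewrite dE evl_trav.
  + by move=> N i j [x t]; rewrite dE dlist_trav evl_trav -dlistx_spl.
  + move=> N j [x t]; rewrite dE evl_trav_dt mulKf ?gt_eqF// hPhi// (dlistx_anti N (z j)).
    exact: (hfe N).1.
Qed.

Theorem theorem3 (R : realType) :
  exists m : nat, (0 < m)%N /\
  forall nu : R, 0 < nu ->
  exists C : R, forall G : R,
  exists Omega0 : R, 0 < Omega0 /\
  forall Phi : R -> R -> space R -> 'I_3 -> R,
  force_A m G Phi \/ force_B m G Phi ->
  forall Omega : R, Omega0 <= Omega ->
  exists2 v : stfield R,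
    periodic_NS_solution nu (2 * pi / Omega) (Phi Omega) v &
    (Linfty_norm (2 * pi / Omega) v <= (C * (1 + nu) * G / Omega)%:E)%E.
Proof.
(* Five derivatives are what [field_approx] consumes, and 45 is an absolute constant, the same for
   every [nu]. *)
exists 5%N; split => // nu nu0; exists 45 => G.
have [Om0 Om0_gt0 h] := ns_of_drivable G nu0.
exists Om0; split => // Phi force Om hOm.
have Om_gt0 : 0 < Om := lt_le_trans Om0_gt0 hOm.
apply: h => //; case: force => [fA|fB]; first exact: drivable_A.
exact: drivable_B.
Qed.
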